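(* Suppose that: (G1) there exists $s_0\in\mathbb{R}$ such that $G(s_0)<0$; (G2) there exist constants $C>0$, $p,q,p_*,s_*$ with $2<p_*<6$ and $2<p\le q$ such that $|G'(s)|\le C(|s|^{p-1}+|s|^{q-1})$ for all $s\in\mathbb{R}$ and $-C|s|^{p_*-1}\le G'(s)$ for all $s\ge s_*$; (G3) $G$ is $C^2$ and $12G(R(x))-7R(x)G'(R(x))+R(x)^2G''(R(x))\ge 0$ for every $x\in\mathbb{R}$, every $\omega\in\mathbb{R}$ and every real-valued $R\in H^1(\mathbb{R})$ solving $-R''+G'(R)+\omega R=0$; (G4) $|G''(s)|\le C(|s|^{p-2}+|s|^{q-2})$ for every $s\in\mathbb{R}$, with $p,q$ as in (G2). Then for every $\lambda>\lambda_*$, every minimum of $E$ on $S(\lambda)\cap H^1_r(\mathbb{R})$ is non-degenerate.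
   Context: Let $f:\mathbb{C}\to\mathbb{C}$ be $C^1$ (in the real sense) with $f(\overline{s})=\overline{f(s)}$ and $f(zs)=zf(s)$ for all $s,z\in\mathbb{C}$ with $|z|=1$. Then $f$ maps $\mathbb{R}$ to $\mathbb{R}$; let $G$ be the primitive of $f|_{\mathbb{R}}$ with $G(0)=0$, and $F(s)=G(|s|)$ for $s\in\mathbb{C}$. On $H^1(\mathbb{R};\mathbb{C})$ put $$E(u)=\frac12\int_{\mathbb{R}}|u'|^2dx+\int_{\mathbb{R}}F(u)\,dx,\qquad M(u)=\int_{\mathbb{R}}|u|^2dx,$$ $S(\lambda)=\{u\in H^1(\mathbb{R};\mathbb{C}):M(u)=\lambda\}$ and $I(\lambda)=\inf_{S(\lambda)}E$ for $\lambda>0$. The number $\lambda_*\ge0$ is $\lambda_*=\sup\{\lambda>0: I(\lambda)=0\}$ (with $\lambda_*=0$ if this set is empty); thus $I=0$ on $(0,\lambda_*]$ and $I<0$ on $(\lambda_*,\infty)$. $H^1_r(\mathbb{R})$ is the space of real-valued even functions in $H^1(\mathbb{R})$. Non-degeneracy: let $R_0$ be a minimum of $E$ on $S(\lambda)\cap H^1_r(\mathbb{R})$ and let $\omega_0\in\mathbb{R}$ be such that $R_0''=G'(R_0)+\omega_0R_0$. The tangent space is $T_{R_0}=\{v\in H^1_r(\mathbb{R}):\int vR_0\,dx=0\}$, and the Hessian of the constrained functional is $$\xi(v)=\int_{\mathbb{R}}\big(|v'(x)|^2+(G''(R_0(x))+\omega_0)v(x)^2\big)dx .$$ $R_0$ is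 non-degenerate if $\inf\{\xi(v): v\in T_{R_0},\ \|v\|_{L^2}=1\}>0$. *)

(* Defs.v *)
From HB Require Import structures.
From mathcomp Require Import all_boot all_order all_algebra.
From mathcomp Require Import complex.
From mathcomp Require Import all_classical all_reals all_analysis.

Set Implicit Arguments.
Unset Strict Implicit.
Unset Printing Implicit Defensive.

Import Order.TTheory GRing.Theory Num.Theory.
Import numFieldNormedType.Exports.

Local Open Scope ring_scope.
Local Open Scope complex_scope.
Local Open Scope classical_set_scope.

Section Defs.
Context {R : realType}.
Local Notation mu := (@lebesgue_measure R).

(* [f] read as a map of the real normed space R^2; [R[i]] itself only carries
   a structure over [R[i]], for which differentiability means holomorphy. *)
Definition real_map (f : R[i] -> R[i]) (z : R * R) : R * R :=
  let w := f (z.1 +i* z.2) in (complex.Re w, complex.Im w).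

(* As R^2 is finite-dimensional, pointwise continuity of [z |-> 'd g z] is
   continuity in operator norm. *)
Definition real_C1 (f : R[i] -> R[i]) : Prop :=
  (forall z, differentiable (real_map f) z) /\
  (forall h, continuous (fun z => 'd (real_map f) z h)).

Definition C2 (G : R -> R) : Prop :=
  [/\ forall x, derivable G x 1, forall x, derivable (derive1 G) x 1
    & continuous (derive1n 2 G)].

Definition test_function : set (R -> R) :=
  [set phi | (forall n x, derivable (derive1n n phi) x 1) /\
             exists A, forall x, A <= `|x| -> phi x = 0].

Definition weak_deriv (u v : R -> R) : Prop :=
  [/\ locally_integrable setT u, locally_integrable setT v &
      forall phi, test_function phi ->
        \int[mu]_x (u x * derive1 phi x) = - \int[mu]_x (v x * phi x)].

(* A chosen weak derivative: well defined up to a null set when one exists,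
   and the zero function otherwise. *)
Definition wD (u : R -> R) : R -> R := xget (cst 0) [set v | weak_deriv u v].

(* A class in H^1 of the line is represented by its unique continuous member,
   so that its values at points make sense. *)
Definition H1 : set (R -> R) :=
  [set u | [/\ continuous u, u \in Lfun mu 2%:E &
      exists2 v, v \in Lfun mu 2%:E & weak_deriv u v]].

Definition H1C : set (R -> R[i]) :=
  [set u | H1 (fun x => complex.Re (u x)) /\ H1 (fun x => complex.Im (u x))].

Definition wDC (u : R -> R[i]) (x : R) : R[i] :=
  wD (fun y => complex.Re (u y)) x +i* wD (fun y => complex.Im (u y)) x.

Definition H1r : set (R -> R) := [set u | H1 u /\ forall x, u (- x) = u x].

Definition toC (u : R -> R) (x : R) : R[i] := (u x)%:C.

Definition potential (G : R -> R) (s : R[i]) : R := G (Normc.normc s).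

Definition energy (G : R -> R) (u : R -> R[i]) : R :=
  2^-1 * \int[mu]_x (Normc.normc (wDC u x) ^+ 2) + \int[mu]_x potential G (u x).

Definition mass (u : R -> R[i]) : R := \int[mu]_x (Normc.normc (u x) ^+ 2).

Definition mass_sphere (lam : R) : set (R -> R[i]) :=
  [set u | H1C u /\ mass u = lam].

Definition min_energy (G : R -> R) (lam : R) : \bar R :=
  ereal_inf [set (energy G u)%:E | u in mass_sphere lam].

(* [ereal_sup set0 = -oo], so the maximum gives 0 when the set is empty. *)
Definition lambda_star (G : R -> R) : \bar R :=
  maxe 0%E (ereal_sup [set lam%:E | lam in [set l | 0 < l /\ min_energy G l = 0%E]]).

Definition minimum_H1r (G : R -> R) (lam : R) (R0 : R -> R) : Prop :=
  [/\ H1r R0, mass_sphere lam (toC R0) &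
      forall v, H1r v -> mass_sphere lam (toC v) -> energy G (toC R0) <= energy G (toC v)].

(* Q'' = G'(Q) + w Q in the sense of distributions. *)
Definition solves (G : R -> R) (w : R) (Q : R -> R) : Prop :=
  weak_deriv (wD Q) (fun x => derive1 G (Q x) + w * Q x).

Definition tangent (R0 : R -> R) : set (R -> R) :=
  [set v | H1r v /\ \int[mu]_x (v x * R0 x) = 0].

Definition xi (G : R -> R) (w0 : R) (R0 v : R -> R) : R :=
  \int[mu]_x (wD v x ^+ 2 + (derive1n 2 G (R0 x) + w0) * v x ^+ 2).

Definition nondegenerate_min (G : R -> R) (w0 : R) (R0 : R -> R) : Prop :=
  (0 < ereal_inf [set (xi G w0 R0 v)%:E |
         v in [set v | tangent R0 v /\ 'N[mu]_2%:E[EFin \o v] = 1]])%E.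

End Defs.

(* Main.v *)
Require Import Defs.
From HB Require Import structures.
From mathcomp Require Import all_boot all_order all_algebra.
From mathcomp Require Import complex.
From mathcomp Require Import all_classical all_reals all_analysis.
From mathcomp Require Import measurable_realfun ring lra.

Set Implicit Arguments.
Unset Strict Implicit.
Unset Printing Implicit Defensive.

Import Order.TTheory GRing.Theory Num.Theory.
Import numFieldNormedType.Exports.

Local Open Scope ring_scope.
Local Open Scope complex_scope.
Local Open Scope classical_set_scope.

(* Write [R] for the minimum, [h = R'/R], [c = h'(0)] and [n = h' - c].  The ODE
   gives [h^2 = 2 G(R)/R^2 + w], and (G3) says exactly that
   [k = h^2 - w - h'/2 = 3 G(R)/R^2 - G'(R)/(2 R)] is nondecreasing on the
   half-line; since [k] tends to [0] at infinity this forces [w > 0], and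
   [2 h^2 - n = 2 (k - k(0)) >= 0].
   For [v] orthogonal to [R] and [a = v(0)/R(0)], completing the square gives
     [v'^2 + G''(R) v^2 + w v^2 - 4 a c R v
        = (v' - (R''/R') v + a c R^2/R')^2 - a^2 c R^2 (2 - n/h^2) + T'],
   where [T] vanishes at [0] and at infinity and [c < 0].  So the Hessian controls
   [a^2] as soon as [k] is not constant, and a Poincare inequality for the
   operator [z' - (R''/R') z] then controls [v].
   If [k] is constant, then [6 G(R) = R G'(R)] and hence [E(R) = 0].  Replacing a
   complex [u] by [|u|], cutting at a half-mass point and reflecting each half,
   one gets [E >= 0] on the whole sphere, so that [I(lam) = 0], contradicting
   [lam > lambda_*]. *)

(** * Absolutely continuous functions on a segment *)

(** The equation makes [R'] a solution of the linearised equation [z'' = (G''(R) + w) z], whence the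
    operator [z' - (R''/R') z]: formally [v'^2 + (G''(R) + w) v^2] is the square of its value at [v]
    plus the derivative of [(R''/R') v^2]. The obstacle is that [R'] vanishes at 0 while an even [v]
    need not, so this boundary term has a pole there. The shift by [a c R^2/R'] removes the pole,
    because [v - a R] vanishes at 0; its price is the cross term [4 a c R v], which orthogonality to
    [R] makes free. On the half-line the operator still has [R'] in its kernel, so one writes
    [v = a R + b R' + z]. The completed square bounds [a] and, through the Poincare inequality, [z];
    orthogonality bounds [b], because the integral of [R R'] over the half-line is [- R(0)^2/2],
    which is not zero. The half-mass point is needed because reflecting a half-line doubles its
    mass, and each reflected function must have mass [lam] to be compared with the minimum. *)

Section IntegralToolkit.
Context {R : realType}.
Local Notation mu := (@lebesgue_measure R).
Implicit Types (f g h u v w : R -> R) (D E : set (measurableTypeR R)) (a b c x y : R).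

Definition ig D f : Prop := mu.-integrable D (EFin \o f).

Lemma ig_eq D f g : measurable D -> (forall x, D x -> f x = g x) ->
  ig D f -> ig D g.
Proof.
move=> mD fg; apply: eq_integrable => // x /set_mem Dx /=.
by rewrite fg.
Qed.

Lemma igS E D f : measurable D -> measurable E -> D `<=` E -> ig E f -> ig D f.
Proof. by move=> mD mE DE; apply: integrableS. Qed.

Lemma ig_meas D f : ig D f -> measurable_fun D f.
Proof. by move/measurable_int/measurable_EFinP. Qed.

Lemma igD D f g : measurable D -> ig D f -> ig D g -> ig D (fun x => f x + g x).
Proof. by move=> mD; exact: integrableD. Qed.

Lemma igB D f g : measurable D -> ig D f -> ig D g -> ig D (fun x => f x - g x).
Proof. by move=> mD; exact: integrableB. Qed.

Lemma igN D f : measurable D -> ig D f -> ig D (fun x => - f x).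
Proof. by move=> mD; exact: integrableN. Qed.

Lemma igZ D c f : measurable D -> ig D f -> ig D (fun x => c * f x).
Proof. by move=> mD; exact: integrableZl. Qed.

Lemma ig0 D : ig D (fun=> 0).
Proof. exact: integrable0. Qed.

Lemma ig_norm D f : measurable D -> ig D f -> ig D (fun x => `|f x|).
Proof. by move=> mD; exact: integrable_norm. Qed.

Lemma ig_le D f g : measurable D -> measurable_fun D f ->
  (forall x, D x -> `|f x| <= g x) -> ig D g -> ig D f.
Proof.
move=> mD mf fg ig_; apply: le_integrable ig_ => //; first exact/measurable_EFinP.
by move=> x Dx /=; rewrite lee_fin (le_trans (fg _ Dx))// ler_norm.
Qed.

Lemma ig_Mb D f g (M : R) : measurable D -> measurable_fun D g ->
  (forall x, D x -> `|g x| <= M) -> ig D f -> ig D (fun x => g x * f x).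
Proof.
move=> mD mg gM fi; apply: (@ig_le _ _ (fun x => M * `|f x|)) => //.
- by apply: measurable_funM => //; exact: ig_meas.
- by move=> x Dx; rewrite normrM ler_wpM2r// gM.
- by apply: igZ => //; exact: ig_norm.
Qed.

Lemma ig_cont a b f : {within `[a, b], continuous f} -> ig `[a, b] f.
Proof. by move=> cf; apply: continuous_compact_integrable => //; exact: segment_compact. Qed.

Lemma ig_contT a b f : continuous f -> ig `[a, b] f.
Proof. by move=> cf; apply: ig_cont; exact: continuous_subspaceT. Qed.

Lemma ig_setU D E f : measurable D -> measurable E -> ig D f -> ig E f -> ig (D `|` E) f.
Proof.
move=> mD mE fD fE.
have mf : measurable_fun (D `|` E) f by apply/measurable_funU => //; split; exact: ig_meas.
have key (A : set (measurableTypeR R)) (mA : measurable A) : ig A f -> ig (D `|` E) (f \_ A).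
  move=> fA; rewrite /ig -restrict_EFin; apply/integrable_restrict => //.
    exact: measurableU.
  by apply: (@igS A) fA => //; apply: measurableI => //; exact: measurableU.
apply: (@ig_le _ _ (fun x => `|(f \_ D) x| + `|(f \_ E) x|)) => //.
- exact: measurableU.
- move=> x [] xDE; rewrite !patchE (mem_set xDE).
    by rewrite lerDl.
  by rewrite lerDr.
- by apply: igD; [exact: measurableU|..]; apply: ig_norm; try exact: measurableU; exact: key.
Qed.

Lemma sub_ccD a b c d : c <= a -> b <= d -> (`[a, b] : set R) `<=` `[c, d].
Proof.
move=> ca bd x /=; rewrite !in_itv/= => /andP[ax xb].
by rewrite (le_trans ca ax) (le_trans xb bd).
Qed.

Lemma igcc a b c d f : c <= a -> b <= d -> ig `[c, d] f -> ig `[a, b] f.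
Proof. by move=> ca bd; apply: igS => //; exact: sub_ccD. Qed.

Lemma RI_chasles a b c f : a <= b -> b <= c -> ig `[a, c] f ->
  \int[mu]_(x in `[a, c]) f x =
  \int[mu]_(x in `[a, b]) f x + \int[mu]_(x in `[b, c]) f x.
Proof.
move=> ab bc fi.
have := @Rintegral_itvB R f (BLeft a) (BRight c) b fi.
rewrite !bnd_simp => /(_ ab bc) /eqP.
rewrite subr_eq addrC => /eqP ->; congr (_ + _).
rewrite Rintegral_itv_obnd_cbnd//.
apply: igS fi => //; apply: subset_itv; rewrite ?bnd_simp//.
Qed.

Lemma RI_point a f : \int[mu]_(x in `[a, a]) f x = 0.
Proof. by rewrite set_itv1 Rintegral_set1. Qed.

Lemma RI_cst a b c : a <= b -> \int[mu]_(x in `[a, b]) c = c * (b - a).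
Proof.
move=> ab; rewrite Rintegral_cst//. rewrite [X in fine X]lebesgue_measure_itv/= lte_fin.
case: ltP => //= ba; suff -> : a = b by rewrite subrr.
by apply/eqP; rewrite eq_le ab ba.
Qed.

Lemma RI_le_norm D f g : measurable D -> ig D f -> ig D g ->
  (forall x, D x -> `|f x| <= g x) ->
  `|\int[mu]_(x in D) f x| <= \int[mu]_(x in D) g x.
Proof.
move=> mD fi gi fg; have := le_normr_Rintegral mD fi. move=> /le_trans; apply.
by apply: le_Rintegral => //; exact: ig_norm.
Qed.

(** Induction along a segment, in the manner of Cousin's lemma: an additive property of intervals
    that holds for all small intervals around each point holds for the whole. The supremum [s] of
    the [y] reachable from [a] is itself reachable, and cannot lie below [b]. *)
Lemma segment_rect (P : R -> R -> Prop) a b : a <= b ->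
  (forall x, a <= x <= b -> exists2 d : R, 0 < d & forall y z, a <= y -> z <= b ->
     x - d < y <= x -> x <= z < x + d -> P y z) ->
  (forall x y z, a <= x -> x <= y -> y <= z -> z <= b -> P x y -> P y z -> P x z) ->
  P a b.
Proof.
move=> ab loc tr.
pose S := [set y | a <= y <= b /\ P a y].
have Sa : S a.
  split; first by rewrite lexx ab.
  have [|d d0 /(_ a a)] := loc a; first by rewrite lexx ab.
  by apply; rewrite ?lexx ?andbT ?ltrBlDr ?ltrDl.
have supS : has_sup S.
  by split; [exists a|exists b => y [/andP[]]].
set s := sup S.
have sab : a <= s <= b.
  rewrite ub_le_sup//=; last by case: supS.
  by apply: ge_sup; [exists a|move=> y [/andP[]]].
have [d d0 dP] := loc s sab.
have [y Sy ys] := sup_adherent d0 supS.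
have yles : y <= s by apply: ub_le_sup => //; case: supS.
have [/andP[ay yb] Py] := Sy.
have key z : s <= z -> z < s + d -> z <= b -> S z.
  move=> sz zsd zb; split; first by rewrite zb andbT (le_trans ay)// (le_trans yles).
  apply: (tr _ y) => //; first exact: le_trans yles sz.
  by apply: dP => //; rewrite ?ys ?sz.
have [sb|bs] := ltP s b; last first.
  suff -> : b = s by have [] := key s; rewrite ?ltrDl ?lexx//; case/andP: sab.
  by apply/eqP; rewrite eq_le bs; case/andP: sab.
pose z := Num.min b (s + d / 2).
have : S z.
  apply: key.
  - by rewrite le_min ltW//= lerDl divr_ge0// ltW.
  - rewrite gt_min; apply/orP; right; rewrite ltrD2l ltr_pdivrMr//.
    by rewrite mulr_natr mulr2n ltrDl.
  - by rewrite ge_min lexx.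
move=> /(ub_le_sup (proj2 supS)); rewrite -/s leNgt => /negP[].
by rewrite lt_min sb ltrDl divr_gt0.
Qed.
End IntegralToolkit.

(** * Calculus of absolutely continuous functions: chain rule and product rule *)

Section Prim.
Context {R : realType}.
Local Notation mu := (@lebesgue_measure R).
Implicit Types (f g h u v w : R -> R) (a b c x y : R).

(* [u] is absolutely continuous on [a, b] with density [w]. *)
Definition prim u w a b : Prop := ig `[a, b] w /\
  forall x y, a <= x -> x <= y -> y <= b ->
    u y - u x = \int[mu]_(t in `[x, y]) w t.

Lemma primS u w a b c d : a <= c -> d <= b -> prim u w a b -> prim u w c d.
Proof.
move=> ac db [wi uw]; split; first exact: igcc wi.
by move=> x y cx xy yd; apply: uw => //; [exact: le_trans cx|exact: le_trans db].
Qed.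

Lemma prim_FTC u w a b : a <= b -> prim u w a b -> u b - u a = \int[mu]_(t in `[a, b]) w t.
Proof. by move=> ab [_]; apply. Qed.

Lemma prim_continuous u w a b : prim u w a b -> {within `[a, b], continuous u}.
Proof.
move=> [wi uw]; have [ab|ba] := leP a b; last first.
  have -> : `[a, b]%classic = set0 :> set R.
    by rewrite set_itv_ge// bnd_simp -ltNge.
  exact: continuous_subspace0.
have := parameterized_integral_continuous ab wi => cI.
apply: (@subspace_eq_continuous _ _ _ (fun x => u a + parameterized_integral mu a x w)).
  move=> x /set_mem; rewrite /= in_itv/= => /andP[ax xb].
  by rewrite /from_subspace/= /parameterized_integral -uw// subrKC.
by move=> x; apply: cvgD; [exact: cvg_cst|exact: cI].
Qed.

Lemma prim_near u w a b x (e : R) : prim u w a b -> a <= x <= b -> 0 < e ->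
  exists2 d : R, 0 < d & forall y, a <= y <= b -> `|y - x| < d -> `|u y - u x| < e.
Proof.
move=> /prim_continuous cu xab e0.
have xi : `[a, b]%classic x by rewrite /= in_itv.
have := cu x; rewrite /continuous_at/= => /cvgrPdist_lt /(_ _ e0).
rewrite /prop_near1 /nbhs/= /nbhs_subspace/= mem_set// => -[d /= d0 H].
exists d => // y yab yx; rewrite distrC; apply: H => //=.
by rewrite distrC.
Qed.

Lemma prim_ext u w u' w' a b : (forall x, a <= x <= b -> u x = u' x) ->
  (forall x, a <= x <= b -> w x = w' x) -> prim u w a b -> prim u' w' a b.
Proof.
move=> uu ww [wi uw]; split.
  by apply: ig_eq wi => // x; rewrite /= in_itv; exact: ww.
move=> x y ax xy yb.
rewrite -!uu ?uw// ?ax ?yb ?(le_trans ax) ?(le_trans xy)//.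
apply: eq_Rintegral => t /set_mem; rewrite /= in_itv/= => /andP[xt ty].
by rewrite ww// (le_trans ax)// (le_trans ty).
Qed.

Lemma primD u w u' w' a b : prim u w a b -> prim u' w' a b ->
  prim (fun x => u x + u' x) (fun x => w x + w' x) a b.
Proof.
move=> [wi uw] [wi' uw']; split; first exact: igD.
move=> x y ax xy yb; rewrite RintegralD//; try exact: (igcc ax yb).
by rewrite -uw// -uw'//; ring.
Qed.

Lemma primZ u w a b k : prim u w a b ->
  prim (fun x => k * u x) (fun x => k * w x) a b.
Proof.
move=> [wi uw]; split; first exact: igZ.
move=> x y ax xy yb; rewrite RintegralZl//; try exact: (igcc ax yb).
by rewrite -uw//; ring.
Qed.

Lemma prim_cst k a b : prim (fun=> k) (fun=> 0) a b.
Proof.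
split; first exact: ig0.
by move=> x y ax xy yb; rewrite RI_cst// mul0r subrr.
Qed.

Lemma continuous_seg_le (f : R -> R) a b : a <= b ->
  {within `[a, b], continuous f} -> exists2 M : R, 0 < M & forall x, a <= x <= b -> `|f x| <= M.
Proof.
move=> ab cf.
have cn : {within `[a, b], continuous (fun x => `|f x|)}.
  by move=> x; apply: cvg_norm; exact: cf.
have [c _ cM] := EVT_max ab cn.
exists (`|f c| + 1); first by rewrite ltr_wpDl.
move=> x xab; rewrite (@le_trans _ _ `|f c|) ?lerDl//.
by apply: cM; rewrite in_itv.
Qed.

(** The defect [F (u y) - F (u x) - \int F' (u t) * w t] is shown to be at most [e] times the
    integral of [|w|], for every [e > 0]. This estimate is additive over adjacent intervals, so by
    [segment_rect] it suffices to prove it on small ones, where the mean value theorem and the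
    continuity of [F'] give it. *)
Lemma prim_comp u w (F F' : R -> R) a b : a <= b -> prim u w a b ->
  (forall s : R, is_derive s 1 F (F' s)) -> continuous F' ->
  prim (F \o u) (fun x => F' (u x) * w x) a b.
Proof.
move=> ab puw dF cF'.
have cu := prim_continuous puw.
have [wi uw] := puw.
have cFu : {within `[a, b], continuous (F' \o u)}.
  by move=> x; exact: (@continuous_comp (subspace `[a, b]) R R u F' x (cu x) (cF' _)).
have mFu : measurable_fun `[a, b] (F' \o u).
  by apply: subspace_continuous_measurable_fun.
have [M M0 FM] := continuous_seg_le ab cFu.
have igF : ig `[a, b] (fun x => F' (u x) * w x).
  apply: (ig_Mb (M := M)) => //.
split => // x y ax xy yb.
suff key (e : R) : 0 < e -> `|F (u y) - F (u x) - \int[mu]_(t in `[x, y]) (F' (u t) * w t)|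
    <= e * \int[mu]_(t in `[x, y]) `|w t|.
  apply/eqP; rewrite -subr_eq0 -normr_le0.
  set I := \int[mu]_(t in _) `|w t| in key.
  have I0 : 0 <= I by apply: Rintegral_ge0.
  apply/ler_addgt0Pr => /= e e0; rewrite add0r.
  have I1 : 0 < I + 1 by rewrite ltr_wpDl.
  apply: (le_trans (key (e / (I + 1)) _)); first exact: divr_gt0.
  by rewrite -mulrAC ler_pdivrMr// ler_pM2l// lerDl.
move=> e0.
have sub s t : x <= s -> t <= y -> ig `[s, t] (fun x => F' (u x) * w x).
  by move=> xs ty; apply: igcc igF; [exact: le_trans xs|exact: le_trans yb].
have subw s t : x <= s -> t <= y -> ig `[s, t] w.
  by move=> xs ty; apply: igcc wi; [exact: le_trans xs|exact: le_trans yb].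
apply: (@segment_rect _ (fun s t => `|F (u t) - F (u s) - \int[mu]_(t in `[s, t]) (F' (u t) * w t)|
    <= e * \int[mu]_(t in `[s, t]) `|w t|) x y) => //; last first.
  move=> s t r xs st tr ry H1 H2.
  rewrite (RI_chasles st tr) ?(RI_chasles (f := fun z => `|w z|) st tr); last 2 first.
    by apply: ig_norm => //; exact: subw.
    exact: sub.
  rewrite mulrDr.
  apply: le_trans (lerD H1 H2); apply: le_trans (ler_normD _ _).
  by rewrite le_eqVlt; apply/orP; left; apply/eqP; congr `|_|; ring.
move=> z xzy.
have zab : a <= z <= b.
  by case/andP: xzy => xz zy; rewrite (le_trans ax)// (le_trans zy).
have e20 : 0 < e / 2 by rewrite divr_gt0.
have [d1 d10 H1] : exists2 d : R, 0 < d & forall r, `|r - u z| < d -> `|F' r - F' (u z)| < e / 2.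
  have /cvgrPdist_lt /(_ _ e20) [d /= d0 H] := cF' (u z).
  by exists d => // r rz; rewrite distrC; apply: H; rewrite /= distrC.
have [d d0 H2] := prim_near puw zab d10.
exists d => // s t xs ty /andP[zs sz] /andP[zt tz].
have st : s <= t by exact: le_trans zt.
have nearz r : s <= r <= t -> a <= r <= b /\ `|u r - u z| < d1.
  move=> /andP[sr rt].
  have rab : a <= r <= b.
    by rewrite (le_trans ax) ?(le_trans xs)//= (le_trans rt)// (le_trans ty).
  split => //; apply: H2 => //; rewrite ltr_norml.
  by apply/andP; split; [rewrite ltrBrDl; exact: lt_le_trans sr|rewrite ltrBlDl; exact: le_lt_trans tz].
have [ut us] : `|u t - u z| < d1 /\ `|u s - u z| < d1.
  by split; [apply: (nearz t _).2; rewrite st lexx|apply: (nearz s _).2; rewrite st lexx].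
(* The mean value point lies between [u s] and [u t], both close to [u z]; the two orders of [u s]
   and [u t] are treated separately. *)
have [xi xi1 FE] : exists2 xi : R, `|xi - u z| < d1 & F (u t) - F (u s) = F' xi * (u t - u s).
  have cF : continuous F by move=> r; apply: differentiable_continuous; apply/derivable1_diffP.
  have bet p q r : `|p - u z| < d1 -> `|q - u z| < d1 -> p <= r -> r <= q -> `|r - u z| < d1.
    rewrite !ltr_norml => /andP[p1 p2] /andP[q1 q2] pr rq.
    by apply/andP; split; [apply: (lt_le_trans p1); rewrite lerD2r|apply: le_lt_trans q2; rewrite lerD2r].
  have [ust|uts] := leP (u s) (u t).
    have [c cst E] := @MVT_segment R F F' _ _ ust (fun r _ => dF r) (continuous_subspaceT cF).
    exists c => //; apply: (bet (u s) (u t)) => //; by rewrite (itvP cst).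
  have [c cst E] := @MVT_segment R F F' _ _ (ltW uts) (fun r _ => dF r) (continuous_subspaceT cF).
  exists c; first by apply: (bet (u t) (u s)) => //; rewrite (itvP cst).
  by apply/eqP; rewrite -eqr_opp -mulrN !opprB E.
rewrite FE uw//; last 2 first.
  exact: le_trans xs.
  exact: le_trans yb.
rewrite -RintegralZl//; last exact: subw.
rewrite -RintegralB//; [|by apply: igZ => //; exact: subw|exact: sub].
rewrite -RintegralZl//; last by apply: ig_norm => //; exact: subw.
apply: RI_le_norm => //.
- by apply: igB => //; [apply: igZ => //; exact: subw|exact: sub].
- by apply: igZ => //; apply: ig_norm => //; exact: subw.
move=> r; rewrite /= in_itv/= => /nearz[_ rz].
rewrite -mulrBl normrM ler_wpM2r//.
rewrite (splitr e) (le_trans (ler_distD (F' (u z)) _ _))// lerD//.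
  by rewrite ltW// H1.
by rewrite distrC ltW// H1.
Qed.

(** Polarisation, [u u' = ((u + u')^2 - u^2 - u'^2) / 2], reduces the product rule to the chain rule
    for the square. *)
Lemma primM u w u' w' a b : a <= b -> prim u w a b -> prim u' w' a b ->
  prim (fun x => u x * u' x) (fun x => w x * u' x + u x * w' x) a b.
Proof.
move=> ab p1 p2.
have sq v g : prim v g a b -> prim (fun x => v x ^+ 2) (fun x => 2 * v x * g x) a b.
  move=> pv; apply: (@prim_comp v g (fun s => s ^+ 2) (fun s => 2 * s)) => //.
    move=> s; by apply: is_derive_eq; rewrite /GRing.scale/=; ring.
  by move=> s; apply: cvgM; [exact: cvg_cst|exact: cvg_id].
have := primZ (2^-1) (primD (sq _ _ (primD p1 p2)) (primZ (-1) (primD (sq _ _ p1) (sq _ _ p2)))).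
by apply: prim_ext => x _; field.
Qed.

Lemma prim_C1 u w a b : (forall x, a <= x <= b -> is_derive x 1 u (w x)) ->
  {within `[a, b], continuous w} -> prim u w a b.
Proof.
move=> du cw; split; first exact: ig_cont.
move=> x y ax; rewrite le_eqVlt => /predU1P[->|xy] yb.
  by rewrite RI_point subrr.
have sub : `[x, y]%classic `<=` `[a, b]%classic by exact: sub_ccD.
have der t : x <= t <= y -> is_derive t 1 u (w t).
  by move=> /andP[xt ty]; apply: du; rewrite (le_trans ax) ?(le_trans ty).
have cu : {within `[x, y], continuous u}.
  apply: derivable_within_continuous => t; rewrite in_itv/= => /der H.
  exact: ex_derive.
rewrite /Rintegral (@continuous_FTC2 _ _ u)//.
- exact: continuous_subspaceW sub cw.
- have [_ cl cr] := (continuous_within_itvP _ xy).1 cu.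
  split => // t; rewrite in_itv/= => /andP[/ltW xt /ltW ty].
  have H : is_derive t 1 u (w t) by apply: der; rewrite xt.
  exact: ex_derive.
- move=> t; rewrite in_itv/= => /andP[/ltW xt /ltW ty].
  have H : is_derive t 1 u (w t) by apply: der; rewrite xt.
  by rewrite derive1E derive_val.
Qed.
End Prim.

(** * Integrals over the half-line *)

Section HalfLine.
Context {R : realType}.
Local Notation mu := (@lebesgue_measure R).
Implicit Types (f g h u v w : R -> R) (D E : set (measurableTypeR R)) (a b c x y : R).

Definition Pos : set (measurableTypeR R) := `]0, +oo[%classic.

(** Compact segments exhausting the open half-line. They stay away from 0, where the quotients by
    [R'] are singular. *)
Definition expanding (n : nat) : set (measurableTypeR R) := `[n.+1%:R^-1, n.+1%:R]%classic.

Lemma mPos : measurable Pos. Proof. exact: measurable_itv. Qed.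

Lemma mexpanding n : measurable (expanding n). Proof. exact: measurable_itv. Qed.

Lemma PosE x : Pos x <-> 0 < x.
Proof. by rewrite /Pos /= in_itv/= andbT. Qed.

Lemma expanding_Pos n : expanding n `<=` Pos.
Proof.
move=> x; rewrite /expanding /Pos /= !in_itv/= andbT => /andP[nx _].
by apply: lt_le_trans nx; rewrite invr_gt0.
Qed.

#[local] Hint Resolve mPos mexpanding expanding_Pos : core.

Lemma expanding_near x : 0 < x -> \forall n \near \oo, expanding n x.
Proof.
move=> x0; near=> n; rewrite /expanding /= in_itv/=; apply/andP; split.
  by apply/ltW; near: n; exact: near_infty_natSinv_lt (PosNum x0).
apply: (@le_trans _ _ n%:R); last by rewrite ler_nat.
by near: n; exact: nbhs_infty_ger.
Unshelve. all: by end_near. Qed.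

Lemma RI_restrict D E f : measurable D -> measurable E -> D `<=` E ->
  \int[mu]_(x in E) (f \_ D) x = \int[mu]_(x in D) f x.
Proof.
by move=> mD mE DE; rewrite -Rintegral_mkcondr setIidr.
Qed.

Lemma ig_restrict D E f : measurable D -> measurable E -> D `<=` E -> ig D f -> ig E (f \_ D).
Proof.
move=> mD mE DE fi; rewrite /ig -restrict_EFin; apply/integrable_restrict => //.
by rewrite setIidr.
Qed.

Lemma expanding_patch f x : Pos x -> (f \_ (expanding n)) x @[n --> \oo] --> f x.
Proof.
move=> /PosE x0; apply: cvg_near_cst.
near=> n; rewrite patchE mem_set//.
by near: n; exact: expanding_near.
Unshelve. all: by end_near. Qed.

Lemma cvg_RI_dominated D (f_ : nat -> R -> R) f g : measurable D ->
  (forall n, measurable_fun D (f_ n)) -> measurable_fun D f ->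
  (forall x, D x -> f_ n x @[n --> \oo] --> f x) ->
  (forall n x, D x -> `|f_ n x| <= g x) -> ig D g ->
  ig D f /\ \int[mu]_(x in D) f_ n x @[n --> \oo] --> \int[mu]_(x in D) f x.
Proof.
move=> mD mf_ mf cf bf gi.
have [|||||fi _ cv] := @dominated_convergence _ _ _ mu D mD (fun n x => (f_ n x)%:E)
   (EFin \o f) (EFin \o g).
- by move=> n; exact/measurable_EFinP.
- exact/measurable_EFinP.
- by apply: aeW => x Dx; apply: cvg_EFin; [exact: nearW|exact: cf].
- exact: gi.
- by apply: aeW => x n Dx; rewrite lee_fin bf.
split => //; rewrite /Rintegral; apply: fine_cvg.
rewrite fineK//; exact: integrable_fin_num.
Qed.

Lemma cvg_RI_expanding f : ig Pos f ->
  \int[mu]_(x in expanding n) f x @[n --> \oo] --> \int[mu]_(x in Pos) f x.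
Proof.
move=> fi.
under eq_fun do rewrite -(RI_restrict _ (mexpanding _) mPos (@expanding_Pos _)).
apply: (@cvg_RI_dominated _ _ _ (fun x => `|f x|) mPos _ _ _ _ _).2.
- move=> n; apply: ig_meas; apply: ig_restrict => //.
  by apply: (igS _ _ _ fi).
- exact: ig_meas.
- exact: expanding_patch.
- by move=> n x _; rewrite patchE; case: ifP => //; rewrite normr0.
- exact: ig_norm.
Qed.

(** Monotone convergence with integrability as a conclusion: this is how the completed square,
    singular at 0 term by term, is found to be integrable. *)
Lemma ig_expanding_ge0 f (B : R) : measurable_fun Pos f -> (forall x, 0 < x -> 0 <= f x) ->
  (forall n, ig (expanding n) f) ->
  (forall n, \int[mu]_(x in expanding n) f x <= B) ->
  ig Pos f /\ \int[mu]_(x in Pos) f x <= B.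
Proof.
move=> mf f0 fi fB.
pose g n x : \bar R := ((f \_ (expanding n)) x)%:E.
have mg n : measurable_fun Pos (g n).
  apply/measurable_EFinP; apply: ig_meas; exact: ig_restrict.
have g0 n x : Pos x -> (0 <= g n x)%E.
  move=> /PosE x0; rewrite lee_fin patchE; case: ifP => // _; exact: f0.
have ndg x : Pos x -> {homo (fun n => g n x) : n m / (n <= m)%N >-> (n <= m)%E}.
  move=> /PosE x0 n m nm; rewrite lee_fin !patchE; case: ifPn => [/set_mem xn|_].
    rewrite mem_set//; move: xn; rewrite /expanding /= !in_itv/= => /andP[nx xn].
    rewrite (le_trans _ nx) ?(le_trans xn) ?ler_nat//.
    by rewrite lef_pV2 ?posrE// ler_nat.
  by case: ifPn => // _; exact: f0.
have := @cvg_monotone_convergence _ _ _ mu Pos mPos g mg g0 ndg.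
have -> : (\int[mu]_(x in Pos) (limn (g ^~ x)) = \int[mu]_(x in Pos) (f x)%:E)%E.
  apply: eq_integral => x /set_mem Px; apply/cvg_lim => //.
  by apply: cvg_EFin; [exact: nearW|exact: expanding_patch].
move=> cv.
have le : (\int[mu]_(x in Pos) (f x)%:E <= B%:E)%E.
  rewrite -(cvg_lim _ cv)//; apply: lime_le; first by apply/cvg_ex; eexists; exact: cv.
  apply: nearW => n.
  rewrite -(@fineK _ (\int[mu]_(x in Pos) _)).
    rewrite lee_fin; apply: le_trans (fB n); by rewrite -(RI_restrict _ (mexpanding n) mPos).
  apply: integrable_fin_num => //; exact: ig_restrict.
have fiP : ig Pos f.
  apply/integrableP; split; first exact/measurable_EFinP.
  under eq_integral => x /set_mem/PosE x0 do rewrite gee0_abs ?lee_fin ?f0//.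
  exact: le_lt_trans le (ltry _).
split => //; rewrite -lee_fin /Rintegral fineK//.
exact: integrable_fin_num.
Qed.

(** Membership in L^2(D). The measurability of [v] is stated separately, since that of its square
    does not imply it. *)
Definition sq D v : Prop := measurable_fun D v /\ ig D (fun x => v x ^+ 2).

Lemma sqS D E v : measurable D -> measurable E -> D `<=` E -> sq E v -> sq D v.
Proof.
move=> mD mE DE [mv vi]; split; first exact: measurable_funS DE mv.
exact: igS vi.
Qed.

Lemma sqM D v w : measurable D -> sq D v -> sq D w -> ig D (fun x => v x * w x).
Proof.
move=> mD [mv vi] [mw wi]; apply: (@ig_le _ _ _ (fun x => v x ^+ 2 + w x ^+ 2)) => //.
- exact: measurable_funM.
- move=> x _; rewrite normrM -(real_normK (num_real (v x))) -(real_normK (num_real (w x))).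
  have := sqr_ge0 (`|v x| - `|w x|).
  have := sqr_ge0 (`|v x| + `|w x|).
  nra.
- exact: igD.
Qed.

Lemma sqD D v w : measurable D -> sq D v -> sq D w -> sq D (fun x => v x + w x).
Proof.
move=> mD sv sw; have [mv vi] := sv; have [mw wi] := sw.
split; first exact: measurable_funD.
have := igD mD (igD mD vi wi) (igZ 2 mD (sqM mD sv sw)).
by apply: ig_eq => // x _; ring.
Qed.

Lemma sqMb D v w (M : R) : measurable D -> measurable_fun D w ->
  (forall x, D x -> `|w x| <= M) -> sq D v -> sq D (fun x => w x * v x).
Proof.
move=> mD mw wM [mv vi]; split; first exact: measurable_funM.
have [M0|M0] := leP 0 M; last first.
  apply: (@ig_eq _ _ (fun=> 0)) (ig0 D) => // x Dx.
  by have := le_lt_trans (wM x Dx) M0; rewrite normr_lt0.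
have : ig D (fun x => w x ^+ 2 * v x ^+ 2).
  apply: (@ig_Mb _ _ _ _ (M ^+ 2)) => //; first exact: measurable_funX.
  by move=> x Dx; rewrite normrX lerXn2r ?nnegrE ?wM.
by apply: ig_eq => // x _; rewrite exprMn.
Qed.

Lemma sqZ D v c : measurable D -> sq D v -> sq D (fun x => c * v x).
Proof.
move=> mD; apply: (@sqMb _ _ (fun=> c) `|c|) => //.
Qed.

Lemma sqN D v : measurable D -> sq D v -> sq D (fun x => - v x).
Proof.
move=> mD /(sqZ (-1) mD) [mv vi]; split.
  by move: mv; apply: eq_measurable_fun => x _; rewrite mulN1r.
by apply: ig_eq vi => // x _; rewrite mulN1r.
Qed.

Lemma sqB D v w : measurable D -> sq D v -> sq D w -> sq D (fun x => v x - w x).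
Proof. by move=> mD sv sw; apply: sqD => //; exact: sqN. Qed.

Lemma Lfun_sq v : v \in Lfun mu 2%:E <-> sq setT v.
Proof.
split => [vL|[mv vi]].
  split; first by have /andP[/set_mem] := vL.
  exact: Lfun2_integrable_sqr.
rewrite inE/=; apply/andP; split; first exact/mem_set.
rewrite inE/= /finite_norm unlock /Lnorm poweR_lty//.
have /integrableP[_] := vi.
congr (_ < _)%E; apply: eq_integral => x _ /=.
by rewrite -[2]/(2%:R) powR_mulrn// normrX.
Qed.
End HalfLine.

(** * Derivatives and smooth cutoffs *)

Section RealDerivatives.
Context {R : realType}.
Implicit Types (f g : R -> R) (a b c x y : R).

Lemma derD f g x a b : is_derive x 1 f a -> is_derive x 1 g b ->
  is_derive x 1 (fun y => f y + g y) (a + b).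
Proof. by move=> df dg; exact: is_deriveD. Qed.

Lemma derN f x a : is_derive x 1 f a -> is_derive x 1 (fun y => - f y) (- a).
Proof. by move=> df; exact: is_deriveN. Qed.

Lemma derB f g x a b : is_derive x 1 f a -> is_derive x 1 g b ->
  is_derive x 1 (fun y => f y - g y) (a - b).
Proof. by move=> df dg; exact: is_deriveB. Qed.

Lemma derM f g x a b : is_derive x 1 f a -> is_derive x 1 g b ->
  is_derive x 1 (fun y => f y * g y) (a * g x + f x * b).
Proof.
move=> df dg; have := is_deriveM df dg.
by move/is_derive_eq; apply; rewrite /GRing.scale/=; ring.
Qed.

Lemma derZ c f x a : is_derive x 1 f a -> is_derive x 1 (fun y => c * f y) (c * a).
Proof. by move=> df; have := is_deriveZ c df. Qed.

Lemma derX2 f x a : is_derive x 1 f a -> is_derive x 1 (fun y => f y ^+ 2) (2 * f x * a).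
Proof.
move=> df; have := derM df df; under eq_fun do rewrite -expr2.
by move/is_derive_eq; apply; ring.
Qed.

Lemma derV f x a : f x != 0 -> is_derive x 1 f a ->
  is_derive x 1 (fun y => (f y)^-1) (- a / f x ^+ 2).
Proof.
move=> f0 df; have := is_deriveV f0 df.
by move/is_derive_eq; apply; rewrite /GRing.scale/= mulNr mulrC mulNr.
Qed.

Lemma derdiv f g x a b : g x != 0 -> is_derive x 1 f a -> is_derive x 1 g b ->
  is_derive x 1 (fun y => f y / g y) ((a * g x - f x * b) / g x ^+ 2).
Proof.
move=> g0 df dg; have := derM df (derV g0 dg).
by move/is_derive_eq; apply; field.
Qed.

Lemma der_comp f g x a b : is_derive (g x) 1 f a -> is_derive x 1 g b ->
  is_derive x 1 (fun y => f (g y)) (a * b).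
Proof. by move=> df dg; exact: is_derive1_comp. Qed.

Lemma der_cst c x : is_derive x 1 (fun=> c : R) 0.
Proof. exact: is_derive_cst. Qed.

Lemma der_id x : is_derive x 1 (fun y : R => y) 1.
Proof. exact: is_derive_id. Qed.

Lemma der_eq f x a b : is_derive x 1 f a -> a = b -> is_derive x 1 f b.
Proof. by move=> ? <-. Qed.

Lemma der_ext f g x a : f =1 g -> is_derive x 1 f a -> is_derive x 1 g a.
Proof. by move/funext => ->. Qed.

Lemma der_near f g x a : (\forall y \near x, f y = g y) -> is_derive x 1 f a -> is_derive x 1 g a.
Proof. exact: near_eq_is_derive. Qed.

Lemma der_derivable f x a : is_derive x 1 f a -> derivable f x 1.
Proof. by move=> ?; exact: ex_derive. Qed.

Lemma der_derive1 f x a : is_derive x 1 f a -> derive1 f x = a.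
Proof. by move=> ?; rewrite derive1E derive_val. Qed.

Lemma derivable_der f x : derivable f x 1 -> is_derive x 1 f (derive1 f x).
Proof. by move=> /derivableP; rewrite derive1E. Qed.

Lemma der_continuous f x a : is_derive x 1 f a -> {for x, continuous f}.
Proof. by move=> df; apply: differentiable_continuous; apply/derivable1_diffP; exact: der_derivable. Qed.

Lemma continuousM' f g : continuous f -> continuous g -> continuous (fun x => f x * g x).
Proof. by move=> cf cg x; apply: cvgM; [exact: cf|exact: cg]. Qed.

Lemma continuousD' f g : continuous f -> continuous g -> continuous (fun x => f x + g x).
Proof. by move=> cf cg x; apply: cvgD; [exact: cf|exact: cg]. Qed.

Lemma continuous_comp' f g : continuous f -> continuous g -> continuous (fun x => f (g x)).
Proof. by move=> cf cg x; apply: continuous_comp; [exact: cg|exact: cf]. Qed.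

End RealDerivatives.

(** * A smooth step and a mollifier built from [exp(-1/x)] *)

Section Smooth.
Context {R : realType}.
Implicit Types (f g : R -> R) (a b c x y : R).

(** The index is shifted: the derivatives of order 0 to [n] are all derivable, so [f] has [n + 1]
    derivatives. *)
Record times_derivable (n : nat) f : Prop := TimesDerivable {
  derive1n_derivable : forall k, (k <= n)%N -> forall x, derivable (derive1n k f) x 1 }.
Arguments derive1n_derivable : clear implicits.

Lemma times_derivableP f : (forall n x, derivable (derive1n n f) x 1) <->
  forall n, times_derivable n f.
Proof.
split=> [df n|df n x]; first by split=> k _ x; exact: df.
exact: (derive1n_derivable n f (df n) n (leqnn n) x).
Qed.

Lemma times_derivable1 n f x : times_derivable n f -> derivable f x 1.
Proof. by move=> fn; exact: (derive1n_derivable n f fn 0%N (leq0n n) x). Qed.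

Lemma times_derivableS n f : times_derivable n.+1 f -> times_derivable n (derive1 f).
Proof.
by move=> fn; split=> k kn x; rewrite -derive1Sn; exact: (derive1n_derivable _ _ fn k.+1 kn x).
Qed.

Lemma times_derivable0 f : (forall x, derivable f x 1) -> times_derivable 0 f.
Proof. by move=> df; split=> k; rewrite leqn0 => /eqP ->. Qed.

Lemma times_derivable_intro n f f' : (forall x, is_derive x 1 f (f' x)) ->
  times_derivable n f' -> times_derivable n.+1 f.
Proof.
move=> df f'n; split=> -[|k] kn x; first exact: der_derivable (df x).
rewrite derive1Sn (_ : derive1 f = f'); first exact: (derive1n_derivable _ _ f'n k).
by apply/funext => y; exact: der_derive1.
Qed.

Lemma times_derivableW n f : times_derivable n.+1 f -> times_derivable n f.
Proof.
by move=> fn; split=> k kn; apply: (derive1n_derivable _ _ fn k); exact: leqW.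
Qed.

Lemma times_derivable_der n f x : times_derivable n f -> is_derive x 1 f (derive1 f x).
Proof. by move=> fn; apply: derivable_der; exact: times_derivable1 fn. Qed.

Lemma times_derivableD n f g : times_derivable n f -> times_derivable n g ->
  times_derivable n (fun x => f x + g x).
Proof.
elim: n f g => [|n ih] f g fn gn.
  by apply: times_derivable0 => x; apply: der_derivable (derD (times_derivable_der x fn) (times_derivable_der x gn)).
apply: (@times_derivable_intro n (fun x => f x + g x) (fun x => derive1 f x + derive1 g x)).
  by move=> x; exact: derD (times_derivable_der x fn) (times_derivable_der x gn).
by apply: ih; exact: times_derivableS.
Qed.

Lemma times_derivableM n f g : times_derivable n f -> times_derivable n g ->
  times_derivable n (fun x => f x * g x).
Proof.
elim: n f g => [|n ih] f g fn gn.
  by apply: times_derivable0 => x; apply: der_derivable (derM (times_derivable_der x fn) (times_derivable_der x gn)).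
apply: (@times_derivable_intro n (fun x => f x * g x) (fun x => derive1 f x * g x + f x * derive1 g x)).
  by move=> x; exact: derM (times_derivable_der x fn) (times_derivable_der x gn).
have f'n := times_derivableS fn; have g'n := times_derivableS gn.
by apply: times_derivableD; apply: ih => //; exact: times_derivableW.
Qed.

Lemma times_derivable_cst n c : times_derivable n (fun=> c).
Proof.
elim: n c => [|n ih] c; first by apply: times_derivable0 => x; exact: derivable_cst.
by apply: (@times_derivable_intro _ _ (fun=> 0)) => // x; exact: der_cst.
Qed.

Lemma times_derivableV n f : (forall x, f x != 0) -> times_derivable n f ->
  times_derivable n (fun x => (f x)^-1).
Proof.
move=> f0; elim: n => [|n ih] fn.
  by apply: times_derivable0 => x; apply: der_derivable (derV (f0 x) (times_derivable_der x fn)).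
apply: (@times_derivable_intro n (fun x => (f x)^-1) (fun x => -1 * derive1 f x * ((f x)^-1 * (f x)^-1))).
  move=> x; apply: der_eq (derV (f0 x) (times_derivable_der x fn)) _.
  by field.
have f'n := times_derivableS fn; have In := ih (times_derivableW fn).
by do 2 apply: times_derivableM => //; exact: times_derivable_cst.
Qed.

Lemma times_derivable_affine n f k c : times_derivable n f ->
  times_derivable n (fun x => f (k * x + c)).
Proof.
have der m g x : times_derivable m g ->
    is_derive x 1 (fun x => g (k * x + c)) (derive1 g (k * x + c) * k).
  move=> gm; apply: (@der_comp _ g (fun x => k * x + c)).
    exact: times_derivable_der gm.
  by apply: der_eq (derD (derZ k (der_id x)) (der_cst c x)) _; rewrite mulr1 addr0.
elim: n f => [|n ih] f fn; first by apply: times_derivable0 => x; exact: der_derivable (der _ _ _ fn).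
apply: (@times_derivable_intro n (fun x => f (k * x + c)) (fun x => derive1 f (k * x + c) * k)).
  by move=> x; exact: (der _ f x fn).
apply: times_derivableM; last exact: times_derivable_cst.
by apply: ih; exact: times_derivableS.
Qed.

(** The parameter [p] makes the family stable: the derivative of a member is a combination of
    members, so smoothness of [exp(-1/x)] follows by induction on the order, for all [p] at once. *)
Definition flat (p : nat) x : R := if 0 < x then x^-1 ^+ p * expR (- x^-1) else 0.

Lemma flat_pos p x : 0 < x -> flat p x = x^-1 ^+ p * expR (- x^-1).
Proof. by rewrite /flat => ->. Qed.

Lemma flat_npos p x : x <= 0 -> flat p x = 0.
Proof. by rewrite /flat ltNge => ->. Qed.

Lemma flat_ge0 p x : 0 <= flat p x.
Proof.
rewrite /flat; case: ifPn => // x0.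
by rewrite mulr_ge0 ?expR_ge0// exprn_ge0// invr_ge0 ltW.
Qed.

Lemma flat_gt0 p x : 0 < x -> 0 < flat p x.
Proof. by move=> x0; rewrite flat_pos// mulr_gt0 ?expR_gt0// exprn_gt0// invr_gt0. Qed.

(** With [y = 1/x], this is [y^(p+1) / (p+1)! <= exp y], one term of the exponential series. *)
Lemma flat_le p x : `|flat p x| <= p.+1`!%:R * `|x|.
Proof.
rewrite ger0_norm ?flat_ge0//; have [x0|x0] := leP x 0.
  by rewrite flat_npos// mulr_ge0.
rewrite flat_pos// gtr0_norm// expRN.
have y0 : 0 <= x^-1 by rewrite invr_ge0 ltW.
have := expR_ge1Dxn p y0.
set y := x^-1 in y0 *; have -> : x = y^-1 by rewrite invrK.
have yp : 0 < y by rewrite invr_gt0.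
have F : 0 < p.+1`!%:R :> R by rewrite ltr0n fact_gt0.
move=> H; have {}H : y ^+ p.+1 / p.+1`!%:R <= expR y by apply: le_trans H; rewrite lerDr.
rewrite ler_pdivrMr ?expR_gt0//.
rewrite ler_pdivrMr// in H.
rewrite mulrAC ler_pdivlMr// -exprSr; apply: le_trans H _.
by rewrite mulrC.
Qed.

(** Away from 0 the function agrees locally with an explicit formula. At 0 its difference quotient
    is [flat p.+1], which tends to 0 by [flat_le]. *)
Lemma flat_der p x : is_derive x 1 (flat p) (flat p.+2 x - p%:R * flat p.+1 x).
Proof.
have [x0|x0|->] := ltgtP x 0.
- rewrite !flat_npos ?ltW// mulr0 subr0.
  apply: der_near (der_cst 0 x).
  near=> y; rewrite flat_npos// ltW//; near: y; exact: lt_nbhsl.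
- have xN : x != 0 by rewrite gt_eqF.
  apply: (@der_near _ (fun y => y^-1 ^+ p * expR (- y^-1))).
    near=> y; rewrite flat_pos//; near: y; exact: lt_nbhsr.
  have dV := derV xN (der_id x).
  have dX : is_derive x 1 (fun y => y^-1 ^+ p) ((p%:R * x^-1 ^+ p.-1) * (-1 / x ^+ 2)).
    have := @is_deriveX R R (fun y : R => y^-1) p x 1 _ dV.
    by rewrite (_ : _ ^+ p = (fun y => y^-1 ^+ p))//; apply/funext => y; rewrite fctE.
  have dE := @der_comp _ expR (fun y => - y^-1) _ _ _ (is_derive_expR (- x^-1)) (derN dV).
  apply: der_eq (derM dX dE) _.
  rewrite !flat_pos// /GRing.scale/=.
  case: p dX => [|p] _; rewrite ?mulr0n ?mul0r ?add0r ?expr0 ?mul1r ?subr0.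
    by rewrite expr2; field.
  rewrite -mulr_natr /= !exprS; field.
  by rewrite xN.
- rewrite !flat_npos// mulr0 subr0.
  have cv : (fun h => h^-1 *: (flat p (h *: 1 + 0) - flat p 0)) @ (0 : R)^' --> (0 : R).
    apply/cvgr0Pnorm_le => e e0; near=> h.
    have h0 : h != 0 by near: h; exact: nbhs_dnbhs_neq.
    rewrite (@flat_npos p 0)// subr0 addr0 /GRing.scale/= mulr1.
    have -> : h^-1 * flat p h = flat p.+1 h.
      have [hn|hp] := leP h 0; first by rewrite !flat_npos// mulr0.
      by rewrite !flat_pos// exprS mulrA.
    apply: (le_trans (flat_le _ _)).
    rewrite -ler_pdivlMl ?ltr0n ?fact_gt0//.
    near: h; apply: dnbhs0_le; rewrite mulr_gt0// invr_gt0 ltr0n fact_gt0//.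
  by apply: DeriveDef; [exact: cvgP cv|exact: cvg_lim cv].
Unshelve. all: by end_near. Qed.

Lemma flat_times_derivable n p : times_derivable n (flat p).
Proof.
elim: n p => [|n ih] p; first by apply: times_derivable0 => x; exact: der_derivable (flat_der p x).
apply: times_derivable_intro (flat_der p) _.
have -> : (fun x => flat p.+2 x - p%:R * flat p.+1 x) =
    (fun x => flat p.+2 x + (- p%:R) * flat p.+1 x).
  by apply/funext => x; rewrite mulNr.
apply: times_derivableD => //; apply: times_derivableM => //.
exact: times_derivable_cst.
Qed.

Definition smooth_step x : R := flat 0 x / (flat 0 x + flat 0 (1 - x)).

Lemma smooth_step_den_gt0 x : 0 < flat 0 x + flat 0 (1 - x).
Proof.
have [x0|x0] := ltP 0 x; first by rewrite ltr_wpDr ?flat_ge0 ?flat_gt0.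
by rewrite ltr_wpDl ?flat_ge0 ?flat_gt0// subr_gt0 (le_lt_trans x0).
Qed.

Lemma smooth_step0 x : x <= 0 -> smooth_step x = 0.
Proof. by move=> x0; rewrite /smooth_step flat_npos// mul0r. Qed.

Lemma smooth_step1 x : 1 <= x -> smooth_step x = 1.
Proof.
move=> x1; rewrite /smooth_step (@flat_npos _ (1 - x)) ?subr_le0// addr0 divff//.
by rewrite gt_eqF// flat_gt0// (lt_le_trans _ x1).
Qed.

Lemma smooth_step_times_derivable n : times_derivable n smooth_step.
Proof.
apply: times_derivableM; first exact: flat_times_derivable.
apply: times_derivableV; first by move=> x; rewrite gt_eqF// smooth_step_den_gt0.
apply: times_derivableD; first exact: flat_times_derivable.
have := @times_derivable_affine n _ (-1) 1 (@flat_times_derivable n 0).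
by under eq_fun do rewrite mulN1r addrC.
Qed.

(** A mollifier supported in [0, 1]. Being the derivative of a step from 0 to 1 it has integral 1,
    and the difference of two of its translates is the derivative of a test function. *)
Definition bump := derive1 smooth_step.

Lemma smooth_step_der x : is_derive x 1 smooth_step (bump x).
Proof. exact: times_derivable_der (@smooth_step_times_derivable 0). Qed.

Lemma bump_continuous : continuous bump.
Proof.
move=> x; have H := times_derivableS (@smooth_step_times_derivable 1).
exact: der_continuous (times_derivable_der x H).
Qed.

Lemma bump0 x : x < 0 -> bump x = 0.
Proof.
move=> x0; apply: der_derive1; apply: der_near (der_cst 0 x).
near=> y; rewrite smooth_step0// ltW//; near: y; exact: lt_nbhsl.
Unshelve. all: by end_near. Qed.

Lemma bump1 x : 1 < x -> bump x = 0.
Proof.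
move=> x0; apply: der_derive1; apply: der_near (der_cst 1 x).
near=> y; rewrite smooth_step1// ltW//; near: y; exact: lt_nbhsr.
Unshelve. all: by end_near. Qed.

Lemma bump_bounded : exists2 M : R, 0 < M & forall x, `|bump x| <= M.
Proof.
have [M M0 bM] := continuous_seg_le ler01 (continuous_subspaceT bump_continuous).
exists M => // x; have [x0|x0] := ltP x 0; first by rewrite bump0// normr0 ltW.
have [x1|x1] := ltP 1 x; first by rewrite bump1// normr0 ltW.
by apply: bM; rewrite x0.
Qed.
End Smooth.

(** * Weak derivatives and absolute continuity *)

Section WeakDerivative.
Context {R : realType}.
Local Notation mu := (@lebesgue_measure R).
Implicit Types (f g u v w phi : R -> R) (D E : set (measurableTypeR R)) (a b c x y : R).

Definition segint f : Prop := forall a b, ig `[a, b] f.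

Definition primT u w : Prop := forall a b, prim u w a b.

Lemma segint_measurable f : segint f -> measurable_fun setT f.
Proof.
move=> fi.
have -> : setT = \bigcup_n (`[- n%:R, n%:R]%classic : set (measurableTypeR R)).
  apply/esym/seteqP; split => // x _; exists (Num.trunc `|x|).+1 => //=.
  have : `|x| <= (Num.trunc `|x|).+1%:R by apply/ltW/truncnS_gt.
  by rewrite ler_norml in_itv.
apply/measurable_fun_bigcup => // n; exact: ig_meas.
Qed.

Lemma segint_locally f : locally_integrable setT f <-> segint f.
Proof.
split=> [[mf _ fi] a b|fi].
  apply/integrableP; split; first by apply/measurable_EFinP; exact: measurable_funS mf.
  by apply: fi => //; exact: segment_compact.
split; [exact: segint_measurable|exact: openT|move=> K _ cK].
have [M [_ KM]] := compact_bounded cK.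
have sub : K `<=` `[- (`|M| + 1), `|M| + 1]%classic.
  move=> x Kx; rewrite /= in_itv/= -ler_norml; apply: KM => //.
  by rewrite ltr_pwDr// ler_norm.
have : ig K f by apply: (igS _ _ sub (fi _ _)) => //; exact: compact_measurable.
by move=> /integrableP[].
Qed.

Lemma segint_cont f : continuous f -> segint f.
Proof. by move=> cf a b; exact: ig_contT. Qed.

Lemma segintB f g : segint f -> segint g -> segint (fun x => f x - g x).
Proof. by move=> fi gi a b; exact: igB. Qed.

Lemma segintM f g : segint f -> continuous g -> segint (fun x => g x * f x).
Proof.
move=> fi cg a b; have [ab|ba] := leP a b; last first.
  by rewrite set_itv_ge ?bnd_simp -?ltNge//; exact: integrable_set0.
have [M M0 gM] := continuous_seg_le ab (continuous_subspaceT cg).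
apply: (ig_Mb (M := M)) => //.
by apply: measurable_funTS; exact: continuous_measurable_fun.
Qed.

Lemma segintMr f g : segint f -> continuous g -> segint (fun x => f x * g x).
Proof.
move=> fi cg a b; apply: (@ig_eq _ _ (fun x => g x * f x)) => //.
  by move=> x _; rewrite mulrC.
exact: segintM.
Qed.

Lemma segint_cst c : segint (fun=> c).
Proof. by apply: segint_cont => x; exact: cvg_cst. Qed.

Lemma primT_segint u w : primT u w -> segint w.
Proof. by move=> uw a b; have [] := uw a b. Qed.

Lemma primT_continuous u w : primT u w -> continuous u.
Proof.
move=> uw x; have /prim_continuous cu := uw (x - 1) (x + 1).
apply: (within_continuous_continuous _ cu).
  by rewrite ltrBlDr -addrA ltrDl.
by rewrite in_itv/= ltrBlDr !ltrDl ltr01.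
Qed.

Lemma support_ig f B : (forall x, B < `|x| -> f x = 0) -> ig `[- B, B] f -> ig setT f.
Proof.
move=> f0 fi.
have : ig setT (f \_ `[- B, B]) by apply: ig_restrict.
apply: ig_eq => // x _; rewrite patchE; case: ifPn => // /negP xB.
rewrite f0// ltNge ler_norml; apply/negP => H; apply: xB.
by apply/mem_set; rewrite /= in_itv.
Qed.

Lemma support_RI f B : (forall x, B < `|x| -> f x = 0) ->
  \int[mu]_x f x = \int[mu]_(x in `[- B, B]) f x.
Proof.
move=> f0; rewrite [RHS]Rintegral_mkcond; congr Rintegral; apply/funext => x.
rewrite patchE; case: ifPn => // /negP xB.
rewrite f0// ltNge ler_norml; apply/negP => H; apply: xB.
by apply/mem_set; rewrite /= in_itv.
Qed.

Lemma test_der phi x : test_function phi -> is_derive x 1 phi (derive1 phi x).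
Proof. by move=> [dphi _]; apply: derivable_der; exact: (dphi 0%N x). Qed.

Lemma test_continuous phi : test_function phi -> continuous phi.
Proof. by move=> tphi x; exact: der_continuous (test_der x tphi). Qed.

Lemma test_derive1 phi : test_function phi -> test_function (derive1 phi).
Proof.
move=> [dphi [A phi0]]; split; first by move=> n x; rewrite -derive1Sn.
exists (A + 1) => x Ax; apply: der_derive1; apply: der_near (der_cst 0 x).
have Ax' : A < `|x| by apply: lt_le_trans Ax; rewrite ltrDl.
have : \forall y \near x, A < `|y|.
  exact: (cvgr_gt `|x| (@norm_continuous _ R x) _ Ax').
by apply: filterS => y Ay; rewrite phi0// ltW.
Qed.

Lemma primT_weak_deriv u w : primT u w -> weak_deriv u w.
Proof.
move=> uw.
have cu := primT_continuous uw.
split; first exact/segint_locally/segint_cont.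
  exact/segint_locally/(primT_segint uw).
move=> phi tphi; have tphi' := test_derive1 tphi.
have cphi' := test_continuous tphi'; have cphi := test_continuous tphi.
have [_ [A phi0]] := tphi; have [_ [A' phi0']] := tphi'.
pose B := Num.max A (Num.max A' 1).
have B0 : 0 < B by rewrite !lt_max ltr01 !orbT.
have BA x : B < `|x| -> A <= `|x| /\ A' <= `|x|.
  by rewrite !gt_max => /andP[/ltW ? /andP[/ltW ? _]].
have s1 x : B < `|x| -> u x * derive1 phi x = 0.
  by move=> /BA[_ xA]; rewrite phi0'// mulr0.
have s2 x : B < `|x| -> w x * phi x = 0.
  by move=> /BA[xA _]; rewrite phi0// mulr0.
rewrite (support_RI s1) (support_RI s2).
have BB : - B <= B by rewrite ge0_cp// ltW.
have pphi : prim phi (derive1 phi) (- B) B.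
  apply: prim_C1; first by move=> x _; exact: test_der.
  exact: continuous_subspaceT.
have [wi _] := uw (- B) B.
have := prim_FTC BB (primM BB (uw _ _) pphi).
have phiB x : `|x| = B -> phi x = 0.
  by move=> xB; apply: phi0; rewrite xB !le_max lexx.
rewrite (phiB B) ?gtr0_norm// (phiB (- B)) ?normrN ?gtr0_norm// !mulr0 subr0.
rewrite RintegralD//.
- by move=> /eqP; rewrite eq_sym addrC addr_eq0 => /eqP.
- by apply: segintMr => //; exact: primT_segint uw.
- by apply: segintM => //; exact: segint_cont.
Qed.

Lemma davgE u a (r : R) : segint u -> 0 < r ->
  davg u a r = ((r *+ 2)^-1 * \int[mu]_(y in ball a r) `|u y - u a|)%:E.
Proof.
move=> ui r0.
have fi : ig (ball a r) (fun y => `|u y - u a|).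
  apply: (@igS _ `[a - r, a + r] (ball a r)) => //; first exact: measurable_ball.
    by rewrite ball_itv; exact: subset_itv_oo_cc.
  apply: ig_norm => //; apply: igB => //; exact: segint_cst.
rewrite /davg /iavg lebesgue_measure_ball ?ltW// EFinM; congr (_ * _)%E.
  by rewrite inver mulrn_eq0/= gt_eqF.
rewrite /Rintegral fineK//; apply: integrable_fin_num => //; exact: measurable_ball.
Qed.

(** Far to the left both steps are 0 and far to the right both are 1, so the difference has compact
    support although neither step has. *)
Lemma test_step a b (k : R) : 0 < k ->
  test_function (fun x => smooth_step (k * (x - a)) - smooth_step (k * (x - b))).
Proof.
move=> k0; split.
  apply/times_derivableP => n.
  have H c : times_derivable n (fun x => smooth_step (k * (x - c))).
    have := @times_derivable_affine R n _ k (- (k * c)) (@smooth_step_times_derivable R n).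
    by under eq_fun do rewrite -mulrBr.
  have := times_derivableD (H a) (times_derivableM (times_derivable_cst n (-1)) (H b)).
  by under eq_fun do rewrite mulN1r.
exists (Num.max `|a| `|b| + k^-1) => x.
have [x0 xl|x0 xl] := leP 0 x.
  have H c : `|c| <= Num.max `|a| `|b| -> 1 <= k * (x - c).
    move=> cm; rewrite -ler_pdivrMl// mulr1 lerBrDr.
    rewrite (ger0_norm x0) in xl; apply: le_trans _ xl; rewrite addrC lerD2r.
    exact: le_trans (ler_norm _) cm.
  by rewrite !smooth_step1 ?subrr// H// le_max lexx ?orbT.
have H c : `|c| <= Num.max `|a| `|b| -> k * (x - c) <= 0.
  move=> cm; rewrite pmulr_rle0// subr_le0.
  rewrite (ltr0_norm x0) in xl.
  have : 0 <= k^-1 by rewrite invr_ge0 ltW.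
  have := ler_norm (- c); rewrite normrN; lra.
by rewrite !smooth_step0 ?subrr// H// le_max lexx ?orbT.
Qed.

(** A weighted mean of [u] over [[a, a + 1/k]]; [k] is the inverse of the width. *)
Definition mollify u a (k : R) := \int[mu]_x (u x * (k * bump (k * (x - a)))).

Lemma mollifier_der a (k : R) x :
  is_derive x 1 (fun x => smooth_step (k * (x - a))) (k * bump (k * (x - a))).
Proof.
have d1 : is_derive x 1 (fun x => k * (x - a)) k.
  by apply: der_eq (derZ k (derB (der_id x) (der_cst a x))) _; rewrite subr0 mulr1.
by apply: der_eq (@der_comp _ smooth_step (fun x => k * (x - a)) _ _ _ (smooth_step_der _) d1) _; rewrite mulrC.
Qed.

Lemma mollifier_continuous a (k : R) : continuous (fun x => k * bump (k * (x - a))).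
Proof.
move=> x; apply: cvgM; first exact: cvg_cst.
apply: continuous_comp; last exact: bump_continuous.
by apply: cvgM; [exact: cvg_cst|apply: cvgB; [exact: cvg_id|exact: cvg_cst]].
Qed.

Lemma mollifier_supp a (k : R) : 0 < k -> forall x, ~ (`[a, a + k^-1]%classic : set R) x ->
  k * bump (k * (x - a)) = 0.
Proof.
move=> k0 x /=; rewrite in_itv/= => /negP; rewrite negb_and -!ltNge => /orP[xa|xa].
  by rewrite bump0 ?mulr0// pmulr_rlt0// subr_lt0.
by rewrite bump1 ?mulr0// -ltr_pdivrMl// mulr1 ltrBrDl.
Qed.

Lemma RI_supp f D : measurable D -> (forall x, ~ D x -> f x = 0) ->
  \int[mu]_x f x = \int[mu]_(x in D) f x.
Proof.
move=> mD f0; rewrite [RHS]Rintegral_mkcond; congr Rintegral; apply/funext => x.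
by rewrite patchE; case: ifPn => // /negP; rewrite inE => /f0.
Qed.

Lemma ig_supp f D : measurable D -> (forall x, ~ D x -> f x = 0) -> ig D f -> ig setT f.
Proof.
move=> mD f0 fi; have : ig setT (f \_ D) by apply: ig_restrict.
by apply: ig_eq => // x _; rewrite patchE; case: ifPn => // /negP; rewrite inE => /f0.
Qed.

(** At scale [k = 2/r] the mollifier lives on [[a, a + r/2]], inside the open ball of radius [r], so
    the error is at most [k M] times the integral of [|u - u a|] over that ball. *)
Lemma mollify_cvg u a (e : R) : segint u -> lebesgue_pt u a -> 0 < e ->
  \forall r \near 0^'+, `|mollify u a (2 / r) - u a| < e.
Proof.
move=> ui ula e0.
have [M M0 bM] := @bump_bounded R.
(* The averages [davg] divide by the length [2 r] of the ball, and [k M = (2/r) M] is [4 M] times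
   [(2 r)^-1]. *)
have e40 : 0 < e / (4 * M) by rewrite divr_gt0// mulr_gt0.
have [ula1 ula2] := (fine_cvgP _ _).1 ula.
have near_lt : \forall t \near 0^'+, (fine \o davg u a) t < e / (4 * M).
  exact: cvgr_lt 0 ula2 _ e40.
near=> r.
have r0 : 0 < r by near: r; exact: nbhs_right_gt.
pose k := 2 / r; have k0 : 0 < k by rewrite divr_gt0.
have ki : k^-1 = r / 2 by rewrite invf_div.
have ak : a <= a + k^-1 by rewrite lerDl invr_ge0 ltW.
have supp f x : ~ (`[a, a + k^-1]%classic : set R) x -> f x * (k * bump (k * (x - a))) = 0.
  by move=> /(mollifier_supp k0) ->; rewrite mulr0.
have cb : continuous (fun x => k * bump (k * (x - a))) by exact: mollifier_continuous.
have I1 : \int[mu]_(x in `[a, a + k^-1]) (k * bump (k * (x - a))) = 1.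
  have p : prim (fun x => smooth_step (k * (x - a))) (fun x => k * bump (k * (x - a))) a (a + k^-1).
    apply: prim_C1; first by move=> x _; exact: mollifier_der.
    exact: continuous_subspaceT.
  have E : k * (a + k^-1 - a) = 1 by field; rewrite gt_eqF.
  by rewrite -(prim_FTC ak p) E subrr mulr0 (smooth_step1 (lexx 1)) (smooth_step0 (lexx 0)) subr0.
have iu : segint (fun x => u x * (k * bump (k * (x - a)))).
  exact: segintMr.
have -> : mollify u a (2 / r) - u a =
    \int[mu]_(x in `[a, a + k^-1]) ((u x - u a) * (k * bump (k * (x - a)))).
  rewrite /mollify -/k (@RI_supp _ `[a, a + k^-1]) => [|//|]; last exact: supp.
  rewrite -[X in _ - X]mulr1 -I1 -RintegralZl//; last exact: ig_contT.
  rewrite -RintegralB//; [|exact: iu|by apply: igZ => //; exact: ig_contT].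
  by apply: eq_Rintegral => x _; rewrite mulrBl.
have iu' : segint (fun x => (u x - u a) * (k * bump (k * (x - a)))).
  by apply: segintMr => //; apply: segintB => //; exact: segint_cst.
have iua : segint (fun y => `|u y - u a|).
  by move=> s t; apply: ig_norm => //; apply: segintB => //; exact: segint_cst.
have iub : ig (ball a r) (fun y => `|u y - u a|).
  apply: (@igS _ `[a - r, a + r] (ball a r)) => //; first exact: measurable_ball.
  by rewrite ball_itv; exact: subset_itv_oo_cc.
have H1 : `|\int[mu]_(x in `[a, a + k^-1]) ((u x - u a) * (k * bump (k * (x - a))))| <=
    \int[mu]_(x in `[a, a + k^-1]) (k * M * `|u x - u a|).
  apply: RI_le_norm => //; first exact: igZ.
  move=> x _; rewrite normrM mulrC ler_wpM2r// normrM (gtr0_norm k0) ler_wpM2l// ltW//.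
apply: (le_lt_trans H1); rewrite RintegralZl//; last exact: iua.
have H2 : \int[mu]_(x in `[a, a + k^-1]) `|u x - u a| <= \int[mu]_(x in ball a r) `|u x - u a|.
  rewrite -(@RI_restrict _ `[a, a + k^-1] (ball a r))//; last 2 first.
  - exact: measurable_ball.
  - rewrite ki ball_itv; apply: subset_itv; rewrite ?bnd_simp; lra.
  apply: le_Rintegral => //; first exact: measurable_ball.
    apply: ig_restrict => //; first exact: measurable_ball.
    by rewrite ki ball_itv; apply: subset_itv; rewrite ?bnd_simp; lra.
  by move=> x _; rewrite patchE; case: ifP => _; rewrite ?lexx ?normr_ge0.
have : fine (davg u a r) < e / (4 * M) by near: r; exact: near_lt.
rewrite davgE//= ltr_pdivlMr ?mulr_gt0// => H3.
apply: le_lt_trans H3; rewrite /k -[r *+ 2]mulr_natl.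
set J := \int[mu]_(x in ball a r) _; rewrite -/J in H2.
have -> : (2 * r)^-1 * J * (4 * M) = 2 / r * M * J by field; rewrite gt_eqF.
by apply: ler_wpM2l => //; rewrite mulr_ge0 ?ltW.
Unshelve. all: by end_near. Qed.

Lemma ae_imp (P Q : R -> Prop) : (forall x, P x -> Q x) ->
  {ae mu, forall x, P x} -> {ae mu, forall x, Q x}.
Proof. by move=> PQ; apply: filterS; [exact: (ae_filter_ringOfSetsType mu)|exact: PQ]. Qed.

(** The du Bois-Reymond lemma. Two mollified means of [u] at the same scale differ by the integral
    of [u] against the derivative of a [test_step], hence coincide whatever their centres; at
    Lebesgue points they converge to the values of [u]. *)
Lemma weakly_constant u : segint u ->
  (forall phi, test_function phi -> \int[mu]_x (u x * derive1 phi x) = 0) ->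
  exists c, {ae mu, forall x, u x = c}.
Proof.
move=> ui u0.
have mk a b (k : R) : 0 < k -> mollify u a k = mollify u b k.
  move=> k0.
  have cb c : continuous (fun x => k * bump (k * (x - c))) by exact: mollifier_continuous.
  have iu c : ig setT (fun x => u x * (k * bump (k * (x - c)))).
    apply: (@ig_supp _ `[c, c + k^-1]) => //.
      by move=> x /(mollifier_supp k0) ->; rewrite mulr0.
    exact: segintMr.
  apply/eqP; rewrite -subr_eq0 /mollify -RintegralB//; [apply/eqP|exact: iu|exact: iu].
  rewrite -[RHS](u0 _ (test_step a b k0)); apply: eq_Rintegral => x _.
  by rewrite (der_derive1 (derB (mollifier_der a k x) (mollifier_der b k x))) [RHS]mulrBr.
have lp := lebesgue_differentiation ((segint_locally u).2 ui).
(* Otherwise the whole line would be a null set, although [0, 1] has measure 1. *)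
have [a la] : exists a, lebesgue_pt u a.
  apply: contrapT => /forallNP nl.
  have : {ae mu, forall x : R, False} by apply: ae_imp lp => x /nl.
  case=> N [mN N0 sub].
  have : (mu setT <= mu N)%E by apply: le_measure; rewrite ?inE// => x _; exact: sub.
  rewrite N0 => /(le_trans (le_measure mu _ _ (@subsetT _ `[0, 1]%classic))).
  rewrite !inE => /(_ (measurable_itv _) measurableT).
  by rewrite [X in (X <= _)%E]lebesgue_measure_itv/= lte_fin ltr01 oppr0 adde0 lee_fin ler10.
exists (u a); apply: ae_imp lp => x lx.
apply/eqP; rewrite -subr_eq0 -normr_le0; apply/ler_addgt0Pr => e e0; rewrite add0r.
have e20 : 0 < e / 2 by rewrite divr_gt0.
have Fx := mollify_cvg ui lx e20; have Fa := mollify_cvg ui la e20.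
near (0 : R)^'+ => r.
have r0 : 0 < r by near: r; exact: nbhs_right_gt.
have H1 : `|mollify u x (2 / r) - u x| < e / 2 by near: r.
have H2 : `|mollify u a (2 / r) - u a| < e / 2 by near: r.
rewrite (mk x a) ?divr_gt0// in H1.
rewrite (splitr e) -(subrKA (mollify u a (2 / r))) (le_trans (ler_normD _ _))//.
by rewrite lerD// ltW// distrC.
Unshelve. all: by end_near. Qed.
End WeakDerivative.

(** * Sobolev functions on the line as absolutely continuous functions *)

Section H1Theory.
Context {R : realType}.
Local Notation mu := (@lebesgue_measure R).
Implicit Types (f g u v w phi : R -> R) (D E : set (measurableTypeR R)) (a b c x y : R).

(** The signed integral from 0 to [x]: at least one of the two segments is empty or a point, and
    contributes 0. *)
Definition primitive w x := \int[mu]_(t in `[0, x]) w t - \int[mu]_(t in `[x, 0]) w t.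

Lemma RI_empty a b f : b < a -> \int[mu]_(t in `[a, b]) f t = 0.
Proof.
move=> ba; rewrite set_itv_ge ?bnd_simp -?ltNge// Rintegral_set0 //.
Qed.

Lemma primitive_primT w : segint w -> primT (primitive w) w.
Proof.
move=> wi a b; split => // x y _ xy _.
have ch := fun s t r st tr => @RI_chasles R s t r w st tr (wi s r).
have P0 z : 0 <= z -> primitive w z = \int[mu]_(t in `[0, z]) w t.
  rewrite /primitive le_eqVlt => /predU1P[<-|z0]; first by rewrite !RI_point subr0.
  by rewrite (RI_empty _ z0) subr0.
have N0 z : z <= 0 -> primitive w z = - \int[mu]_(t in `[z, 0]) w t.
  rewrite /primitive le_eqVlt => /predU1P[->|z0]; first by rewrite !RI_point subr0 oppr0.
  by rewrite (RI_empty _ z0) sub0r.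
have [x0|x0] := leP 0 x.
  by rewrite !P0 ?(le_trans x0)// (ch 0 x y)//; ring.
have [y0|y0] := leP 0 y.
  by rewrite P0// N0 ?ltW// (ch x 0 y)// ?ltW//; ring.
by rewrite !N0 ?ltW// (ch x y 0)// ?ltW//; ring.
Qed.

Lemma test_ig phi u : test_function phi -> segint u -> ig setT (fun x => u x * phi x).
Proof.
move=> tphi ui; have [_ [A phi0]] := tphi.
apply: (@support_ig _ _ A); first by move=> x Ax; rewrite phi0 ?mulr0// ltW.
by apply: segintMr => //; exact: test_continuous.
Qed.

(** The difference of [u] and the primitive of [v] has zero weak derivative, so it is constant
    almost everywhere by [weakly_constant]. *)
Lemma weak_deriv_primT u v : weak_deriv u v ->
  exists2 U, primT U v & {ae mu, forall x, u x = U x}.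
Proof.
move=> [/segint_locally ui /segint_locally vi uv].
have pV := primitive_primT vi.
have [_ _ VV] := primT_weak_deriv pV.
have Vi : segint (primitive v) := segint_cont (primT_continuous pV).
have [|c uc] := @weakly_constant _ (fun x => u x - primitive v x) (segintB ui Vi).
  move=> phi tphi; have tphi' := test_derive1 tphi.
  have -> : \int[mu]_x ((u x - primitive v x) * derive1 phi x) =
            \int[mu]_x (u x * derive1 phi x - primitive v x * derive1 phi x).
    by apply: eq_Rintegral => x _; rewrite mulrBl.
  rewrite RintegralB//; try exact: test_ig.
  by rewrite uv// VV// subrr.
exists (fun x => primitive v x + c).
  move=> a b; have := primD (pV a b) (prim_cst c a b).
  by apply: prim_ext => // x _; rewrite addr0.
by apply: ae_imp uc => x <-; rewrite addrC subrK.
Qed.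

Lemma ae_ball (P : R -> Prop) a (r : R) : {ae mu, forall x, P x} -> 0 < r ->
  exists2 x, ball a r x & P x.
Proof.
move=> [N [mN N0 sub]] r0; apply: contrapT => /forall2NP nP.
have : (mu (ball a r) <= mu N)%E.
  apply: le_measure; rewrite ?inE//; first exact: measurable_ball.
  by move=> x bx; apply: sub => /= Px; have [] := nP x.
rewrite N0 (lebesgue_measure_ball a (ltW r0)) => H.
have : (0 < (r *+ 2)%:E :> \bar R)%E by rewrite lte_fin mulrn_wgt0.
by rewrite ltNge H.
Qed.

Lemma ae_continuous_eq f g : continuous f -> continuous g ->
  {ae mu, forall x, f x = g x} -> f =1 g.
Proof.
move=> cf cg fg x; apply/eqP; rewrite -subr_eq0 -normr_le0.
apply/ler_addgt0Pr => e e0; rewrite add0r.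
have ch : {for x, continuous (fun y => f y - g y)} by apply: cvgB; [exact: cf|exact: cg].
have /cvgrPdist_lt /(_ _ e0) [r /= r0 H] := ch.
have [y xy fgy] := ae_ball x fg r0.
have := H y xy; rewrite /= fgy subrr subr0 => /ltW//.
Qed.

Lemma RI0 D : measurable D -> \int[mu]_(x in D) 0 = 0 :> R.
Proof. by move=> mD; rewrite Rintegral_cst// mul0r. Qed.

(** The difference of the densities is a density of the zero function. Integration by parts makes it
    weakly constant, and its integral over [0, 1], which is 0, identifies the constant. *)
Lemma ae_primT_unique u w w' : primT u w -> primT u w' -> {ae mu, forall x, w x = w' x}.
Proof.
move=> uw uw'.
have wi := primT_segint uw; have wi' := primT_segint uw'.
have p0 : primT (fun=> 0) (fun x => w x - w' x).
  move=> a b; have := primD (uw a b) (primZ (-1) (uw' a b)).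
  by apply: prim_ext => x _; rewrite mulN1r ?subrr.
have [_ _ H] := primT_weak_deriv p0.
have [|c wc] := @weakly_constant _ (fun x => w x - w' x) (segintB wi wi').
  move=> phi /test_derive1 tphi; apply/eqP; rewrite -oppr_eq0 -H//; apply/eqP.
  rewrite -[RHS](@RI0 setT)//; apply: eq_Rintegral => x _; exact: mul0r.
have c0 : c = 0.
  have := prim_FTC ler01 (p0 0 1); rewrite subrr.
  have -> : \int[mu]_(t in `[0, 1]) (w t - w' t) = \int[mu]_(t in `[0, 1]) c.
    rewrite /Rintegral; congr fine; apply: ae_eq_integral => //.
    - by apply/measurable_EFinP; apply: ig_meas; exact: segintB.
    - by apply: ae_imp wc => x -> _.
  by rewrite RI_cst// subr0 mulr1.
by apply: ae_imp wc => x /eqP; rewrite c0 subr_eq0 => /eqP.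
Qed.

Lemma RI_ae D f g : measurable D -> {ae mu, forall x, f x = g x} ->
  measurable_fun D f -> measurable_fun D g -> \int[mu]_(x in D) f x = \int[mu]_(x in D) g x.
Proof.
move=> mD fg mf mg; congr fine; apply: ae_eq_integral => //; try exact/measurable_EFinP.
by apply: ae_imp fg => x -> _.
Qed.

Lemma ig_ae D f g : measurable D -> {ae mu, forall x, f x = g x} ->
  measurable_fun D g -> ig D f -> ig D g.
Proof.
move=> mD fg mg fi; apply/integrableP; split; first exact/measurable_EFinP.
have /integrableP[mf] := fi; apply: le_lt_trans.
rewrite (@ae_eq_integral _ _ _ mu D (fun x => `|(f x)%:E|)%E (fun x => `|(g x)%:E|)%E)//.
- by apply/measurableT_comp => //; exact/measurable_EFinP.
- exact: measurableT_comp.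
- by apply: ae_imp fg => x -> _.
Qed.

Lemma sq_ae v w : {ae mu, forall x, v x = w x} -> measurable_fun setT w -> sq setT v -> sq setT w.
Proof.
move=> vw mw [mv vi]; split => //; apply: ig_ae vi => //; last exact: measurable_funX.
by apply: ae_imp vw => x ->.
Qed.

Lemma H1_intro u w : primT u w -> sq setT u -> sq setT w -> H1 u.
Proof.
move=> uw su sw; split; [exact: primT_continuous uw|exact/Lfun_sq|].
by exists w; [exact/Lfun_sq|exact: primT_weak_deriv].
Qed.

(** Since a weak derivative exists, the choice behind [wD] returns one rather than its default;
    uniqueness of densities then compares it with [w]. *)
Lemma wD_ae u w : primT u w -> {ae mu, forall x, w x = wD u x} /\ primT u (wD u).
Proof.
move=> uw; have wduw := primT_weak_deriv uw.
have wdu : weak_deriv u (wD u).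
  by apply: (@xgetPex _ _ [set v | weak_deriv u v]); exists w.
have [U pU uU] := weak_deriv_primT wdu.
have uE : u =1 U by apply: ae_continuous_eq => //; [exact: primT_continuous uw|exact: primT_continuous pU].
have pu : primT u (wD u) by move=> a b; apply: prim_ext (pU a b) => // x _; rewrite uE.
by split => //; exact: ae_primT_unique uw pu.
Qed.

Lemma H1_elim u : H1 u -> [/\ primT u (wD u), sq setT u & sq setT (wD u)].
Proof.
move=> [cu /Lfun_sq su [v /Lfun_sq sv uv]].
have [U pU uU] := weak_deriv_primT uv.
have uE : u =1 U by apply: ae_continuous_eq => //; exact: primT_continuous pU.
have pu : primT u v by move=> a b; apply: prim_ext (pU a b) => // x _; rewrite uE.
have [vw pw] := wD_ae pu; split => //.
by apply: sq_ae sv => //; apply: segint_measurable; exact: primT_segint pw.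
Qed.

Lemma RI_wD2 u w : primT u w -> \int[mu]_x (wD u x ^+ 2) = \int[mu]_x (w x ^+ 2).
Proof.
move=> uw; have [ww pw] := wD_ae uw.
apply: RI_ae => //.
- by apply: ae_imp ww => x ->.
- by apply: measurable_funX; apply: segint_measurable; exact: primT_segint pw.
- by apply: measurable_funX; apply: segint_measurable; exact: primT_segint uw.
Qed.
End H1Theory.

(** * Translations and reflections *)

Section Symmetries.
Context {R : realType}.
Local Notation mu := (@lebesgue_measure R).
Implicit Types (f g u v w : R -> R) (D E : set (measurableTypeR R)) (a b c x y : R).

Lemma RI_preserve (phi : measurableTypeR R -> measurableTypeR R) f :
  measurable_fun setT phi ->
  (forall A : set (measurableTypeR R), measurable A -> mu (phi @^-1` A) = mu A) ->
  ig setT f -> ig setT (f \o phi) /\ \int[mu]_x f (phi x) = \int[mu]_x f x.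
Proof.
move=> mphi pres fi; have mf := ig_meas fi.
have eqm (g : R -> \bar R) : (\int[pushforward mu phi]_x g x = \int[mu]_x g x)%E.
  by apply: eq_measure_integral => A mA _; exact: pres.
have fphi : ig setT (f \o phi).
  apply/integrableP; split; first by apply/measurable_EFinP; exact: measurableT_comp.
  have /integrableP[_] := fi; apply: le_lt_trans.
  rewrite -[leRHS]eqm ge0_integral_pushforward//.
  by apply: measurableT_comp => //; exact/measurable_EFinP.
split => //; rewrite /Rintegral -[RHS](congr1 fine (eqm _)) (@integral_pushforward _ _ _ _ _ _ mphi mu setT (EFin \o f))//.
exact/measurable_EFinP.
Qed.

Lemma RI_opp f : ig setT f -> ig setT (fun x => f (- x)) /\ \int[mu]_x f (- x) = \int[mu]_x f x.
Proof.
apply: (@RI_preserve (-%R)); first exact: oppr_measurable.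
by move=> A mA; rewrite -[RHS](lebesgue_measureN mA).
Qed.

Lemma RI_shift a f : ig setT f -> ig setT (fun x => f (a + x)) /\ \int[mu]_x f (a + x) = \int[mu]_x f x.
Proof.
have mphi : measurable_fun setT ((fun x => a + x) : measurableTypeR R -> measurableTypeR R).
  exact: measurable_funD.
apply: (@RI_preserve (fun x => a + x)) => // A mA.
(* The translated measure has the same values on half-open intervals, which determine Lebesgue
   measure. *)
have := @lebesgue_measure_unique R (pushforward mu ((fun x => a + x) : measurableTypeR R -> measurableTypeR R)) _ _ mA.
move=> H; rewrite [RHS]H// => _ [[x y]] _ <-.
transitivity (mu `]x - a, y - a]%classic); last first.
  congr (mu _); apply/seteqP; split => z /=; rewrite !in_itv/= ltrBlDl lerBrDl//.
rewrite [LHS]lebesgue_measure_itv [RHS]lebesgue_measure_itv /= !lte_fin ltrD2r.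
by case: ifP => // _; congr EFin; ring.
Qed.

Lemma RI_comp_opp_Pos f : ig setT f ->
  [/\ ig Pos f, ig Pos (fun x => f (- x)) &
  \int[mu]_x f x = \int[mu]_(x in Pos) f x + \int[mu]_(x in Pos) f (- x)].
Proof.
move=> fi; have [foi _] := RI_opp fi.
have PT : Pos `<=` setT by [].
have fP : ig Pos f by apply: igS fi => //; exact: mPos.
have foP : ig Pos (fun x => f (- x)) by apply: igS foi => //; exact: mPos.
split => //.
have E : setT = (Pos : set (measurableTypeR R)) `|` `]-oo, 0].
  by apply/seteqP; split => // x _; rewrite /Pos /= !in_itv/= andbT; case: ltP; [left|right].
rewrite {1}E Rintegral_setU; [|exact: mPos|exact: measurable_itv|by rewrite -E|]; last first.
  by apply/disj_setPS => x; rewrite /Pos /= !in_itv/= andbT => -[]; case: ltP.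
congr (_ + _).
have fN : ig `]-oo, 0] f by apply: igS fi.
have [g1 g2] := RI_opp (ig_restrict (measurable_itv _) measurableT (@subsetT _ _) fN).
rewrite -[LHS](@RI_restrict _ _ setT)// -g2.
rewrite (_ : (fun x => (f \_ `]-oo, 0]) (- x)) = (fun x => f (- x)) \_ `[0, +oo[); last first.
  apply/funext => x; rewrite !patchE; congr (if _ then _ else _).
  by apply/idP/idP => /set_mem /= H; apply/mem_set; move: H; rewrite /= !in_itv/= andbT oppr_le0.
rewrite RI_restrict// -Rintegral_itv_obnd_cbnd//.
Qed.

Lemma ig_evenodd f : measurable_fun setT f -> ig Pos f -> ig Pos (fun x => f (- x)) -> ig setT f.
Proof.
move=> mf fP fN.
have r1 := ig_restrict mPos measurableT (@subsetT _ _) fP.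
have [r2 _] := RI_opp (ig_restrict mPos measurableT (@subsetT _ _) fN).
have E0 : ig [set 0] f.
  apply/integrableP; split; first exact: measurable_fun_set1.
  by rewrite integral_set1.
have r3 := ig_restrict (measurable_set1 _) measurableT (@subsetT _ _) E0.
have := igD measurableT (igD measurableT r1 r2) r3.
apply: ig_eq => // x _; rewrite !patchE.
have PE y : (y \in (Pos : set (measurableTypeR R))) = (0 < y).
  by apply/idP/idP => [/set_mem/PosE//|/PosE/mem_set].
rewrite !PE.
have SE : (x \in [set 0]) = (x == 0).
  by apply/idP/eqP => [/set_mem//|->]; exact/mem_set.
rewrite SE oppr_gt0 opprK.
have p0 : (point : R) = 0 by [].
by case: (ltgtP x 0) => _; rewrite !p0 ?addr0 ?add0r.
Qed.

Definition evenify u x := u `|x|.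

(** At 0 the value is [w 0], so oddness may fail at the origin; the square is even everywhere. *)
Definition oddify w x := if 0 <= x then w x else - w (- x).

Lemma RI_opp_seg f a b : ig `[- b, - a] f ->
  ig `[a, b] (fun x => f (- x)) /\ \int[mu]_(t in `[a, b]) f (- t) = \int[mu]_(t in `[- b, - a]) f t.
Proof.
move=> fi.
have [g1 g2] := RI_opp (ig_restrict (measurable_itv _) measurableT (@subsetT _ _) fi).
have E : (fun x => (f \_ `[- b, - a]) (- x)) = (fun x => f (- x)) \_ `[a, b].
  apply/funext => x; rewrite !patchE; congr (if _ then _ else _).
  by apply/idP/idP => /set_mem /= H; apply/mem_set; move: H; rewrite /= !in_itv/= !lerN2 andbC.
split; last by rewrite -[RHS](@RI_restrict _ _ setT)// -g2 E RI_restrict.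
have : ig `[a, b] ((fun x => f (- x)) \_ `[a, b]) by rewrite -E; apply: igS g1.
by apply: ig_eq => // x abx; rewrite patchE mem_set.
Qed.

Lemma prim_opp u w a b : prim u w (- b) (- a) ->
  prim (fun x => u (- x)) (fun x => - w (- x)) a b.
Proof.
move=> [wi uw]; have [g1 _] := RI_opp_seg wi; split; first exact: igN.
move=> x y ax xy yb.
have wi' : ig `[- y, - x] w by apply: igcc wi; rewrite lerN2.
have [h1 h2] := RI_opp_seg wi'.
have -> : \int[mu]_(t in `[x, y]) (- w (- t)) = - \int[mu]_(t in `[x, y]) w (- t).
  rewrite -[RHS]mulN1r -RintegralZl//; by apply: eq_Rintegral => t _; rewrite mulN1r.
by rewrite h2 -uw ?lerN2// opprB.
Qed.

Lemma RI_shift_seg c f a b : ig `[c + a, c + b] f ->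
  ig `[a, b] (fun x => f (c + x)) /\ \int[mu]_(t in `[a, b]) f (c + t) = \int[mu]_(t in `[c + a, c + b]) f t.
Proof.
move=> fi.
have [g1 g2] := RI_shift c (ig_restrict (measurable_itv _) measurableT (@subsetT _ _) fi).
have E : (fun x => (f \_ `[c + a, c + b]) (c + x)) = (fun x => f (c + x)) \_ `[a, b].
  apply/funext => x; rewrite !patchE; congr (if _ then _ else _).
  by apply/idP/idP => /set_mem /= H; apply/mem_set; move: H; rewrite /= !in_itv/= !lerD2l.
split; last by rewrite -[RHS](@RI_restrict _ _ setT)// -g2 E RI_restrict.
have : ig `[a, b] ((fun x => f (c + x)) \_ `[a, b]) by rewrite -E; apply: igS g1.
by apply: ig_eq => // x abx; rewrite patchE mem_set.
Qed.

Lemma primT_shift c u w : primT u w -> primT (fun x => u (c + x)) (fun x => w (c + x)).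
Proof.
move=> uw a b; have [wi uwi] := uw (c + a) (c + b).
have [g1 _] := RI_shift_seg wi; split => // x y ax xy yb.
have wi' : ig `[c + x, c + y] w by apply: igcc wi; rewrite lerD2l.
have [_ ->] := RI_shift_seg wi'.
by rewrite uwi// ?lerD2l.
Qed.

Lemma prim_glue u w a b c : a <= c -> c <= b -> prim u w a c -> prim u w c b -> prim u w a b.
Proof.
move=> ac cb [wi1 uw1] [wi2 uw2].
have wi : ig `[a, b] w.
  have E : (`[a, b]%classic : set R) = `[a, c] `|` `[c, b].
    apply/seteqP; split => x /=; rewrite !in_itv/=.
      by move=> /andP[ax xb]; case: (leP x c) => xc; [left|right]; rewrite ?ax ?xb ?andbT// ltW.
    by move=> [/andP[-> /le_trans ->]//|/andP[/(le_trans ac) -> ->]].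
  by rewrite E; apply: ig_setU.
split => // x y ax xy yb.
have [yc|cy] := leP y c; first exact: uw1.
have [xc|cx] := leP x c; last by apply: uw2 => //; exact: ltW.
rewrite (RI_chasles xc (ltW cy)); last exact: igcc wi.
rewrite -uw1// -uw2// ?ltW//; ring.
Qed.

Lemma RI_oo a b f : ig `]a, b[ f -> ig `[a, b] f /\ \int[mu]_(t in `[a, b]) f t = \int[mu]_(t in `]a, b[) f t.
Proof.
move=> fi.
have pt c : ig [set c] f.
  by apply/integrableP; split; [exact: measurable_fun_set1|rewrite integral_set1].
have fcc : ig `[a, b] f.
  have := ig_setU (measurable_itv _) (measurableU _ _ (measurable_set1 a) (measurable_set1 b))
    fi (ig_setU (measurable_set1 a) (measurable_set1 b) (pt a) (pt b)).
  apply: igS => //; first by do ?apply: measurableU.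
  move=> x /=; rewrite !in_itv/= !le_eqVlt => /andP[/predU1P[->|ax] /predU1P[xb|xb]].
  - by right; left.
  - by right; left.
  - by right; right.
  - by left; rewrite ax xb.
split => //; rewrite -Rintegral_itv_obnd_cbnd; last by apply: igS fcc => //; apply: subset_itv; rewrite ?bnd_simp.
by rewrite Rintegral_itv_bndo_bndc.
Qed.

(** Changing a density at the endpoints does not affect the integrals. It is needed where the two
    halves of [oddify] meet at 0. *)
Lemma prim_ext_oo u w w' a b : (forall x, a < x < b -> w x = w' x) -> prim u w a b -> prim u w' a b.
Proof.
move=> ww [wi uw].
have igoo x y : a <= x -> y <= b -> ig `]x, y[ w'.
  move=> ax yb; apply: (@ig_eq _ _ w) => //.
    by move=> t; rewrite /= in_itv/= => /andP[xt ty]; rewrite ww// (le_lt_trans ax)// (lt_le_trans ty).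
  by apply: igS wi => //; apply: subset_itv; rewrite bnd_simp.
split; first exact: (RI_oo (igoo _ _ _ _)).1.
move=> x y ax xy yb; rewrite uw// (RI_oo (igoo _ _ _ _)).2// (RI_oo (f := w) _).2; last first.
  by apply: igS wi => //; apply: subset_itv; rewrite bnd_simp.
apply: eq_Rintegral => t /set_mem; rewrite /= in_itv/= => /andP[xt ty].
by rewrite ww// (le_lt_trans ax)// (lt_le_trans ty).
Qed.

Lemma primT_evenify u w : (forall b, prim u w 0 b) -> primT (evenify u) (oddify w).
Proof.
move=> uw.
have pos b : prim (evenify u) (oddify w) 0 b.
  apply: prim_ext (uw b) => x /andP[x0 _]; first by rewrite /evenify ger0_norm.
  by rewrite /oddify x0.
have neg a : prim (evenify u) (oddify w) (- a) 0.
  apply: (@prim_ext_oo _ (fun x => - w (- x))).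
    by move=> x /andP[_ x0]; rewrite /oddify leNgt x0.
  have : prim (fun x => u (- x)) (fun x => - w (- x)) (- a) 0.
    by apply: prim_opp; rewrite oppr0 opprK.
  by apply: prim_ext => // x /andP[_ x0]; rewrite /evenify ler0_norm.
move=> a b; pose m := Num.max `|a| `|b|.
have m0 : 0 <= m by rewrite le_max normr_ge0.
apply: (@primS _ _ _ (- m) m); last by apply: (@prim_glue _ _ _ _ 0) => //; rewrite oppr_le0.
  by rewrite lerNl (le_trans (ler_norm _))// normrN le_max lexx.
by rewrite (le_trans (ler_norm _))// le_max lexx orbT.
Qed.

Lemma evenify_even u x : evenify u (- x) = evenify u x.
Proof. by rewrite /evenify normrN. Qed.

Lemma RI_even f : (forall x, f (- x) = f x) -> measurable_fun setT f -> ig Pos f ->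
  ig setT f /\ \int[mu]_x f x = 2 * \int[mu]_(x in Pos) f x.
Proof.
move=> fe mf fi.
have fo : ig Pos (fun x => f (- x)) by apply: ig_eq fi => //; exact: mPos.
have fT := ig_evenodd mf fi fo; split => //.
have [_ _ ->] := RI_comp_opp_Pos fT.
rewrite mulr_natl mulr2n; congr (_ + _).
by apply: eq_Rintegral => x _; rewrite fe.
Qed.
End Symmetries.

(** * Estimates on the half-line *)

Section RealAnalysis.
Context {R : realType}.
Local Notation mu := (@lebesgue_measure R).
Implicit Types (f g u v w : R -> R) (D E : set (measurableTypeR R)) (a b c x y : R).

Lemma near_pinftyE (P : R -> Prop) : (\forall x \near +oo, P x) <->
  exists2 X : R, 0 < X & forall x, X < x -> P x.
Proof.
split=> [[M [_ MP]]|[X X0 XP]]; last by exists X; rewrite num_real.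
exists (`|M| + 1); first by rewrite ltr_wpDl.
move=> x Mx; apply: MP; apply: le_lt_trans Mx.
by rewrite (le_trans (ler_norm _))// lerDl.
Qed.

Lemma near_right0E (P : R -> Prop) : (\forall x \near 0^'+, P x) <->
  exists2 d : R, 0 < d & forall x, 0 < x -> x < d -> P x.
Proof.
split=> [[d /= d0 dP]|[d d0 dP]].
  exists d => // x x0 xd; apply: dP => //=.
  by rewrite sub0r normrN gtr0_norm.
by exists d => // x /=; rewrite sub0r normrN => xd x0; apply: dP => //; rewrite gtr0_norm in xd.
Qed.

Lemma mean_value f f' a b : a <= b -> (forall x, a <= x <= b -> is_derive x 1 f (f' x)) ->
  exists2 c, a <= c <= b & f b - f a = f' c * (b - a).
Proof.
move=> ab df.
have cf : {within `[a, b], continuous f}.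
  apply: derivable_within_continuous => t; rewrite in_itv/= => /df.
  exact: der_derivable.
have [|c ci E] := @MVT_segment R f f' a b ab _ cf.
  by move=> x; rewrite in_itv/= => /andP[/ltW ax /ltW xb]; apply: df; rewrite ax.
by exists c => //; rewrite in_itv in ci.
Qed.

Lemma der_le0 f f' a b : a <= b -> (forall x, a <= x <= b -> is_derive x 1 f (f' x)) ->
  (forall x, a <= x <= b -> f' x <= 0) -> f b <= f a.
Proof.
move=> ab df f'0; have [c /f'0 c0 E] := mean_value ab df.
by rewrite -subr_le0 E mulr_le0_ge0// subr_ge0.
Qed.

Lemma der_ge0 f f' a b : a <= b -> (forall x, a <= x <= b -> is_derive x 1 f (f' x)) ->
  (forall x, a <= x <= b -> 0 <= f' x) -> f a <= f b.
Proof.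
move=> ab df f'0; have [c /f'0 c0 E] := mean_value ab df.
by rewrite -subr_ge0 E mulr_ge0// subr_ge0.
Qed.

Lemma der0_cst f : (forall x, is_derive x 1 f 0) -> forall x y, f x = f y.
Proof. by move=> df x y; apply: is_derive_0_is_cst => z; exact: df. Qed.

(** The product [f x * expR (- M * x)] is nonincreasing, nonnegative and 0 at [a]. Below, [f] is a
    sum of squares measuring how far two solutions of the equation are apart. *)
Lemma gronwall f f' (M : R) a : (forall x, a <= x -> is_derive x 1 f (f' x)) ->
  (forall x, a <= x -> f' x <= M * f x) -> (forall x, 0 <= f x) -> f a = 0 ->
  forall x, a <= x -> f x = 0.
Proof.
move=> df fM f0 fa x ax.
have dE y : is_derive y 1 (fun t => expR (- M * t)) (expR (- M * y) * (- M * 1)).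
  exact: (@der_comp _ expR (fun t => - M * t) _ _ _ (is_derive_expR _) (derZ (- M) (der_id y))).
have := @der_le0 (fun t => f t * expR (- M * t)) _ a x ax
  (fun y H => derM (df y (proj1 (andP H))) (dE y)).
rewrite fa mul0r => H.
have {}H : f x * expR (- M * x) <= 0.
  apply: H => y /andP[ay _].
  have -> : f' y * expR (- M * y) + f y * (expR (- M * y) * (- M * 1)) =
      (f' y - M * f y) * expR (- M * y) by ring.
  by rewrite mulr_le0_ge0 ?expR_ge0// subr_le0 fM.
apply/eqP; rewrite eq_le f0 andbT.
by rewrite pmulr_lle0 ?expR_gt0// in H.
Qed.

Lemma bounded_Pos f : (forall x, 0 < x -> {for x, continuous f}) ->
  (exists M : R, \forall x \near 0^'+, `|f x| <= M) ->
  (exists M : R, \forall x \near +oo, `|f x| <= M) ->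
  exists2 M : R, 0 < M & forall x, 0 < x -> `|f x| <= M.
Proof.
move=> cf [M1 /near_right0E[d d0 H1]] [M2 /near_pinftyE[X X0 H2]].
have m0 : 0 < Num.min d X by rewrite lt_min d0.
have m2 : Num.min d X / 2 <= Num.min d X by lra.
have md : Num.min d X <= d by rewrite ge_min lexx.
have dM : d <= Num.max d X by rewrite le_max lexx.
have [||M M0 H3] := @continuous_seg_le R f (Num.min d X / 2) (Num.max d X).
- exact: le_trans m2 (le_trans md dM).
- apply: continuous_in_subspaceT => x /set_mem; rewrite /= in_itv/= => /andP[xl _].
  by apply: cf; apply: lt_le_trans xl; rewrite divr_gt0.
exists (Num.max M (Num.max M1 M2)); first by rewrite lt_max M0.
move=> x x0; rewrite !le_max.
have [xd|dx] := ltP x d; first by rewrite H1 ?orbT.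
have [xX|Xx] := ltP X x; first by rewrite H2 ?orbT.
by rewrite H3// (le_trans m2 (le_trans md dx)) le_max Xx orbT.
Qed.

Lemma measurable_Pos f : (forall x, 0 < x -> {for x, continuous f}) -> measurable_fun Pos f.
Proof.
move=> cf; apply: open_continuous_measurable_fun; first exact: interval_open.
by move=> x /set_mem/PosE; exact: cf.
Qed.

Lemma RI_le_sub D E f : measurable D -> measurable E -> D `<=` E -> ig E f ->
  (forall x, E x -> 0 <= f x) -> \int[mu]_(x in D) f x <= \int[mu]_(x in E) f x.
Proof.
move=> mD mE DE fi f0; rewrite -(RI_restrict _ mD mE DE).
apply: le_Rintegral => //; first by apply: ig_restrict => //; exact: igS fi.
by move=> x Ex; rewrite patchE; case: ifP => // _; exact: f0.
Qed.

Lemma tail_small f (e : R) : ig Pos f -> (forall x, 0 < x -> 0 <= f x) -> 0 < e ->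
  exists2 X : R, 0 < X & forall a b, X < a -> \int[mu]_(t in `[a, b]) f t <= e.
Proof.
move=> fi f0 e0.
have /cvgrPdist_le /(_ _ e0) [N _ /(_ N (leqnn N)) HN] := cvg_RI_expanding fi.
exists N.+1%:R => // a b Na.
have H1 : expanding N `|` `[a, b] `<=` (Pos : set (measurableTypeR R)).
  move=> x [/expanding_Pos//|]; rewrite /= in_itv/= => /andP[ax _].
  by apply/PosE; apply: lt_le_trans ax; apply: lt_trans Na.
have mU : measurable (expanding N `|` `[a, b] : set (measurableTypeR R)).
  by apply: measurableU => //; exact: mexpanding.
have := RI_le_sub mU (@mPos R) H1 fi (fun x H => f0 x ((PosE x).1 H)).
rewrite Rintegral_setU//.
- move=> H; have := le_trans (ler_norm _) HN; lra.
- exact: mexpanding.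
- by apply: igS fi => //; exact: mPos.
- apply/disj_setPS => x [] /=; rewrite /expanding /= !in_itv/= => /andP[_ xN] /andP[ax _].
  by have := lt_le_trans Na ax; rewrite ltNge xN.
Qed.

Lemma normr_double_product a b : `|b * a + a * b| <= a ^+ 2 + b ^+ 2.
Proof.
rewrite ler_norml -subr_ge0 -[X in _ && X]subr_ge0; apply/andP; split.
  by have -> : b * a + a * b - - (a ^+ 2 + b ^+ 2) = (a + b) ^+ 2; [ring|exact: sqr_ge0].
by have -> : a ^+ 2 + b ^+ 2 - (b * a + a * b) = (a - b) ^+ 2; [ring|exact: sqr_ge0].
Qed.

(** Far out, the minimum of [u^2] on [[x, x + 1]] is at most its mean there, hence at most [e/2];
    between that minimum and [x] the square varies by at most the integral of
    [2 |u w| <= u^2 + w^2], again at most [e/2]. *)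
Lemma sq_segment_small u w (e : R) : (forall b, prim u w 0 b) -> sq Pos u -> sq Pos w -> 0 < e ->
  exists2 X : R, 0 < X & forall x, X < x -> u x ^+ 2 <= e.
Proof.
move=> uw su sw e0.
have [mu_ ui] := su; have [mw wi] := sw.
have [X X0 HX] := @tail_small (fun x => u x ^+ 2 + w x ^+ 2) (e / 2) (igD (@mPos R) ui wi)
   (fun x _ => addr_ge0 (sqr_ge0 _) (sqr_ge0 _)) (divr_gt0 e0 (ltr0Sn _ 1)).
exists X => // x Xx.
have x0 : 0 < x by exact: lt_trans Xx.
have sub a b : 0 < a -> `[a, b] `<=` (Pos : set (measurableTypeR R)).
  by move=> a0 t; rewrite /= in_itv/= => /andP[/(lt_le_trans a0) ? _]; apply/PosE.
have x1 : x <= x + 1 by rewrite lerDl.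
have px : prim u w x (x + 1) by apply: primS (uw (x + 1)) => //; exact: ltW.
have pu2 := primM x1 px px.
have cu2 := prim_continuous pu2.
have [c cx cmin] := EVT_min x1 cu2.
rewrite in_itv/= in cx; have /andP[xc cx1] := cx.
have iT : ig `[x, x + 1] (fun t => u t ^+ 2 + w t ^+ 2).
  by apply: igS (igD (@mPos R) ui wi) => //; [exact: mPos|exact: sub].
have H1 : u c * u c <= e / 2.
  have -> : u c * u c = \int[mu]_(t in `[x, x + 1]) (u c * u c).
    by rewrite RI_cst// addrAC subrr add0r mulr1.
  apply: le_trans (HX x (x + 1) Xx); apply: le_Rintegral => //.
    by apply: ig_cont; apply: continuous_subspaceT => ?; exact: cvg_cst.
  move=> t xt; rewrite expr2 (le_trans (cmin t _))// lerDl; exact: sqr_ge0.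
have := @prim_FTC _ _ _ x c xc (primS (lexx x) cx1 pu2).
have iS : ig `[x, c] (fun t => w t * u t + u t * w t).
  have [H _] := pu2; exact: igcc (lexx _) cx1 H.
have iT' : ig `[x, c] (fun t => u t ^+ 2 + w t ^+ 2) by apply: igcc iT.
have H2 : `|\int[mu]_(t in `[x, c]) (w t * u t + u t * w t)| <= e / 2.
  apply: le_trans (HX x c Xx); apply: RI_le_norm => // t _.
  exact: normr_double_product.
move=> E; rewrite -E in H2.
rewrite expr2; move: H2; rewrite ler_norml => /andP[]; lra.
Qed.

Lemma sq_cvg0 u w : (forall b, prim u w 0 b) -> sq Pos u -> sq Pos w -> u x @[x --> +oo] --> 0.
Proof.
move=> uw su sw; apply/cvgr0Pnorm_le => e e0.
have [X X0 H] := sq_segment_small uw su sw (exprn_gt0 2 e0).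
apply/near_pinftyE; exists X => // x /H.
rewrite -(real_normK (num_real (u x))) ler_pXn2r// nnegrE ltW//.
Qed.

Lemma cauchy_schwarz D v w : measurable D -> sq D v -> sq D w ->
  (\int[mu]_(x in D) (v x * w x)) ^+ 2 <=
  \int[mu]_(x in D) (v x ^+ 2) * \int[mu]_(x in D) (w x ^+ 2).
Proof.
move=> mD sv sw; have vw := sqM mD sv sw; have [mv vi] := sv; have [mw wi] := sw.
set a := \int[mu]_(x in D) (v x ^+ 2); set b := \int[mu]_(x in D) (w x ^+ 2).
set c := \int[mu]_(x in D) (v x * w x).
have key (t s : R) : 0 <= t ^+ 2 * a + 2 * t * s * c + s ^+ 2 * b.
  have : 0 <= \int[mu]_(x in D) ((t * v x + s * w x) ^+ 2).
    by apply: Rintegral_ge0 => x _; exact: sqr_ge0.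
  have -> : \int[mu]_(x in D) ((t * v x + s * w x) ^+ 2) =
     \int[mu]_(x in D) ((t ^+ 2 * v x ^+ 2 + 2 * t * s * (v x * w x)) + s ^+ 2 * w x ^+ 2).
    by apply: eq_Rintegral => x _; ring.
  have i1 := igZ (t ^+ 2) mD vi; have i2 := igZ (2 * t * s) mD vw; have i3 := igZ (s ^+ 2) mD wi.
  by rewrite RintegralD//; [rewrite RintegralD// !RintegralZl|exact: igD].
have a0 : 0 <= a by apply: Rintegral_ge0 => x _; exact: sqr_ge0.
have b0 : 0 <= b by apply: Rintegral_ge0 => x _; exact: sqr_ge0.
have [az|an0] := eqVneq a 0; last first.
  have ap : 0 < a by rewrite lt_neqAle eq_sym an0.
  have := key c (- a).
  have -> : c ^+ 2 * a + 2 * c * - a * c + (- a) ^+ 2 * b = a * (a * b - c ^+ 2) by ring.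
  by rewrite pmulr_rge0// subr_ge0.
rewrite az mul0r; have [->|c0] := eqVneq c 0; first by rewrite expr0n.
(* With [a = 0] the quadratic form is affine in [t], and this [t] gives it the value -1. *)
exfalso; have := key (- (b + 1) / (2 * c)) 1.
have -> : (- (b + 1) / (2 * c)) ^+ 2 * a + 2 * (- (b + 1) / (2 * c)) * 1 * c + 1 ^+ 2 * b = -1.
  by rewrite az; field.
by rewrite ler0N1.
Qed.

Lemma RI_gt0 f x0 : ig Pos f -> (forall x, 0 < x -> 0 <= f x) -> 0 < x0 ->
  {for x0, continuous f} -> 0 < f x0 -> 0 < \int[mu]_(x in Pos) f x.
Proof.
move=> fi f0 x00 cf fx0.
have f20 : 0 < f x0 / 2 by rewrite divr_gt0.
have /cvgrPdist_lt /(_ _ f20) [d /= d0 H] := cf.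
pose b := x0 + d / 2.
have xb : x0 < b by rewrite ltrDl divr_gt0.
have sub : `[x0, b] `<=` (Pos : set (measurableTypeR R)).
  by move=> t; rewrite /= in_itv/= => /andP[/(lt_le_trans x00) ? _]; apply/PosE.
apply: lt_le_trans (RI_le_sub (measurable_itv _) (@mPos R) sub fi (fun x H => f0 x ((PosE x).1 H))).
have : 0 < f x0 / 2 * (b - x0) by rewrite mulr_gt0// subr_gt0.
move=> /lt_le_trans; apply.
rewrite -(RI_cst _ (ltW xb)); apply: le_Rintegral => //.
- by apply: ig_cont; apply: continuous_subspaceT => ?; exact: cvg_cst.
- by apply: igS fi => //; exact: mPos.
move=> x; rewrite /= in_itv/= => /andP[xx xb'].
have : ball_ (fun x => `|x|) x0 d x.
  rewrite /= distrC ger0_norm ?subr_ge0//.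
  have : d / 2 < d by rewrite ltr_pdivrMr// ltr_pMr// ltr1n.
  by rewrite /b in xb'; lra.
by move=> /H; rewrite ltr_norml => /andP[_]; lra.
Qed.

(** Cauchy-Schwarz on [[0, x]] bounds [u(x)^2] by [x] times the integral of [w^2] over [[0, x]],
    which tends to 0. This rate beats the pole of order [1/x] of [R''/R']. *)
Lemma sq_vanish_at0 u w : (forall b, prim u w 0 b) -> sq `[0, 1] w -> u 0 = 0 ->
  (u x ^+ 2 / x) @[x --> 0^'+] --> 0.
Proof.
move=> uw sw u0; have [mw wi] := sw.
have := parameterized_integral_cvg_left (@ltr01 R) wi.
move=> /cvg_at_right_filter cI.
apply/cvgr0Pnorm_le => e e0; near=> x.
have x0 : 0 < x by near: x; exact: nbhs_right_gt.
have x1 : x <= 1 by near: x; exact: nbhs_right_le.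
have sx : sq `[0, x] w by apply: sqS sw => //; exact: sub_ccD.
have s1 : sq `[0, x] (fun=> 1).
  split; first exact: measurable_cst.
  by apply: ig_cont; apply: continuous_subspaceT => ?; exact: cvg_cst.
have := cauchy_schwarz (measurable_itv _) s1 sx.
have -> : \int[mu]_(t in `[0, x]) (1 * w t) = u x.
  have := prim_FTC (ltW x0) (uw x); rewrite u0 subr0 => ->.
  by apply: eq_Rintegral => t _; rewrite mul1r.
rewrite expr1n (RI_cst _ (ltW x0)) subr0 mul1r => CS.
have ux0 : 0 <= u x ^+ 2 / x by rewrite divr_ge0 ?sqr_ge0// ltW.
rewrite (ger0_norm ux0) ler_pdivrMr// (le_trans CS)// mulrC ler_pM2r//.
have : `|parameterized_integral mu 0 x (fun t => w t ^+ 2)| <= e.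
  by near: x; exact: cvgr0_norm_le.
by apply: le_trans; exact: ler_norm.
Unshelve. all: by end_near. Qed.

Lemma cvg_expanding_pinfty f (l : R) : f x @[x --> +oo] --> l -> f n.+1%:R @[n --> \oo] --> l.
Proof.
move=> fl; apply: (@cvg_comp _ _ _ (fun n : nat => n.+1%:R : R) f _ +oo) => //.
apply/cvgryPge => A; near=> n.
apply: (@le_trans _ _ n%:R); last by rewrite ler_nat.
by near: n; exact: nbhs_infty_ger.
Unshelve. all: by end_near. Qed.

Lemma cvg_expanding_right0 f (l : R) : f x @[x --> 0^'+] --> l -> f n.+1%:R^-1 @[n --> \oo] --> l.
Proof.
move=> /cvg_at_rightP; apply; split; first by move=> n; rewrite invr_gt0.
exact: cvg_harmonic.
Qed.
End RealAnalysis.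

(** * Limits and elementary inequalities for the coercivity argument *)

Section Auxiliary.
Context {R : realType}.

Lemma continuous_right0 (f : R -> R) : {for 0, continuous f} -> f x @[x --> 0^'+] --> f 0.
Proof. exact: cvg_at_right_filter. Qed.

Lemma cvg_bounded (F : set_system R) {FF : Filter F} (f : R -> R) (l : R) :
  f x @[x --> F] --> l -> exists M : R, \forall x \near F, `|f x| <= M.
Proof.
move=> fl; exists (`|l| + 1).
have /cvgrPdist_le /(_ _ ltr01) := fl.
apply: filterS => x H; rewrite -[f x](subKr l) (le_trans (ler_normB _ _))// lerD2l//.
Qed.

Lemma cvg0_mul_bounded (F : set_system R) {FF : Filter F} (f g : R -> R) :
  (exists M : R, \forall x \near F, `|f x| <= M) -> g x @[x --> F] --> 0 ->
  f x * g x @[x --> F] --> 0.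
Proof.
move=> [M fM] g0; apply/cvgr0Pnorm_le => e e0.
have M1 : 0 < `|M| + 1 by rewrite ltr_wpDl.
have /cvgr0Pnorm_le /(_ _ (divr_gt0 e0 M1)) := g0.
apply: filterS2 fM => x fx gx; rewrite normrM.
rewrite (@le_trans _ _ ((`|M| + 1) * (e / (`|M| + 1))))//; last by rewrite mulrC divfK// gt_eqF.
rewrite ler_pM// (le_trans fx)// (le_trans (ler_norm _))// lerDl//.
Qed.

Lemma primT_der (u w : R -> R) (x : R) : primT u w -> continuous w -> is_derive x 1 u (w x).
Proof.
move=> uw cw.
have [wi _] := uw (x - 1) (x + 1).
have x1 : x < x + 1 by rewrite ltrDl.
have x2 : x - 1 < x by rewrite ltrBlDr ltrDl.
have [d1 d2] := continuous_FTC1_closed x1 wi x2 (@cw x).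
have dF := derivable_der d1; rewrite d2 in dF.
apply: der_near (der_eq (derD (der_cst (u (x - 1)) x) dF) (add0r _)).
near=> y; have y1 : x - 1 <= y.
  by apply: ltW; near: y; exact: lt_nbhsr.
by rewrite -(prim_FTC y1 (uw _ _)) subrKC.
Unshelve. all: by end_near. Qed.

Lemma bounded_left (f : R -> R) (b : R) : (forall x, 0 < x -> {for x, continuous f}) ->
  (exists M : R, \forall x \near 0^'+, `|f x| <= M) ->
  exists2 M : R, 0 < M & forall x, 0 < x -> x <= b -> `|f x| <= M.
Proof.
move=> cf [M1 /near_right0E[d d0 H1]].
have [db|bd] := leP d b; last first.
  exists (`|M1| + 1); first by rewrite ltr_wpDl.
  by move=> x x0 xb; rewrite (le_trans (H1 x x0 (le_lt_trans xb bd)))// (le_trans (ler_norm _))// lerDl.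
have [|M M0 HM] := @continuous_seg_le R f d b db.
  apply: continuous_in_subspaceT => x /set_mem; rewrite /= in_itv/= => /andP[xl _].
  by apply: cf; exact: lt_le_trans xl.
exists (Num.max M M1); first by rewrite lt_max M0.
move=> x x0 xb; rewrite le_max; have [dx|xd] := leP d x; first by rewrite HM// dx.
by rewrite H1 ?orbT.
Qed.

(** The bookkeeping for [v = a Q + b P + z]: [N], [NP], [Z], [s] are the squared L^2 norms of [Q],
    [P], [z] and of the completed square, [X] is the Hessian, [g] the integral of [Q z], and
    [p = Q(0)^2/2]. The point is that [K] is fixed before the quantities depending on [v]. *)
Lemma coercivity_arith (C N NP M2 p r : R) : 0 < C -> 0 <= N -> 0 <= NP -> 0 <= M2 ->
  0 < p -> 0 < r -> exists2 K : R, 0 < K & forall a b s Z g X : R,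
    0 <= s -> 0 <= Z -> s + a ^+ 2 * r <= X -> Z <= C * (2 * s + 2 * a ^+ 2 * M2) ->
    b * p = a * N + g -> g ^+ 2 <= N * Z ->
    3 * (a ^+ 2 * N + b ^+ 2 * NP + Z) <= K * X.
Proof.
move=> C0 N0 NP0 M20 p0 r0.
pose k1 := r^-1; have k10 : 0 < k1 by rewrite invr_gt0.
pose k2 := C * (2 + 2 * k1 * M2).
have k20 : 0 <= k2 by rewrite mulr_ge0 ?(ltW C0)// addr_ge0// mulr_ge0// mulr_ge0// ltW.
pose k3 := (2 * k1 * N ^+ 2 + 2 * N * k2) / p ^+ 2.
have p2 : 0 < p ^+ 2 by rewrite exprn_gt0.
have k30 : 0 <= k3.
  by rewrite divr_ge0 ?(ltW p2)// addr_ge0// mulr_ge0// ?sqr_ge0// mulr_ge0// ltW.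
exists (3 * (k1 * N + k3 * NP + k2) + 1).
  by rewrite ltr_wpDl// mulr_ge0// addr_ge0// addr_ge0// mulr_ge0// ltW.
move=> a b s Z g X s0 Z0 sX ZC bE gN.
have a20 : 0 <= a ^+ 2 by exact: sqr_ge0.
have X0 : 0 <= X by apply: le_trans sX; rewrite addr_ge0// mulr_ge0// ltW.
have aX : a ^+ 2 <= k1 * X.
  rewrite ler_pdivlMl// mulrC; apply: le_trans sX; rewrite lerDr//.
have sX' : s <= X by apply: le_trans sX; rewrite lerDl mulr_ge0// ltW.
have ZX : Z <= k2 * X.
  apply: (le_trans ZC); rewrite /k2 -[leRHS]mulrA (ler_pM2l C0).
  rewrite [leRHS]mulrDl lerD//; first by rewrite ler_wpM2l.
  rewrite [leRHS](_ : _ = 2 * (k1 * X) * M2); last by ring.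
  by rewrite ler_wpM2r// ler_wpM2l.
have bX : b ^+ 2 <= k3 * X.
  rewrite /k3 mulrAC ler_pdivlMr// -exprMn bE.
  rewrite (@le_trans _ _ (2 * N ^+ 2 * a ^+ 2 + 2 * g ^+ 2))//.
    by rewrite -subr_ge0 (_ : _ - _ = (a * N - g) ^+ 2) ?sqr_ge0//; ring.
  have h1 : 2 * N ^+ 2 * a ^+ 2 <= 2 * N ^+ 2 * (k1 * X) by rewrite ler_wpM2l// mulr_ge0// sqr_ge0.
  have h2 : 2 * g ^+ 2 <= 2 * (N * (k2 * X)).
    by rewrite ler_wpM2l// (le_trans gN)// ler_wpM2l.
  apply: le_trans (lerD h1 h2) _.
  by rewrite le_eqVlt; apply/orP; left; apply/eqP; ring.
rewrite [leRHS]mulrDl mul1r -[leLHS]addr0; apply: lerD => //.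
rewrite -[leRHS]mulrA ler_wpM2l// [leRHS]mulrDl lerD//.
rewrite [leRHS]mulrDl lerD//.
  by rewrite [leRHS]mulrAC ler_wpM2r.
by rewrite [leRHS]mulrAC ler_wpM2r.
Qed.

Lemma expanding_sub M N : (M <= N)%N -> expanding M `<=` (expanding N : set (measurableTypeR R)).
Proof.
move=> MN x; rewrite /expanding /= !in_itv/= => /andP[x1 x2]; apply/andP; split.
  by apply: le_trans _ x1; rewrite lef_pV2 ?posrE ?ltr0n// ler_nat.
by apply: (le_trans x2); rewrite ler_nat.
Qed.

Lemma sqrD_le (a s t : R) : (s + a * t) ^+ 2 <= 2 * s ^+ 2 + 2 * a ^+ 2 * t ^+ 2.
Proof.
rewrite -subr_ge0 (_ : _ - _ = (s - a * t) ^+ 2); first exact: sqr_ge0.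
by ring.
Qed.

Lemma sqrD3_le (v a b s t : R) :
  v ^+ 2 <= 3 * (a ^+ 2 * s ^+ 2 + b ^+ 2 * t ^+ 2 + (v - a * s - b * t) ^+ 2).
Proof.
set z := v - a * s - b * t.
rewrite -subr_ge0 (_ : _ - _ = (a * s - b * t) ^+ 2 + (a * s - z) ^+ 2 + (b * t - z) ^+ 2).
  by apply: addr_ge0; [apply: addr_ge0|]; exact: sqr_ge0.
by rewrite /z; ring.
Qed.

Lemma split_product (q v a b p : R) :
  q * v = a * q ^+ 2 + b * (q * p) + q * (v - a * q - b * p).
Proof. by ring. Qed.

Lemma residual_shift (w b A y P : R) : P != 0 -> w - b * A - A / P * (y - b * P) = w - A / P * y.
Proof. by move=> P0; field. Qed.

Lemma constraint_arith (a b N p g : R) : 0 = a * N + b * - p + g -> b * p = a * N + g.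
Proof. by lra. Qed.

Lemma near0_arith (t c x : R) : 0 < x -> - (- c / 2) <= t -> t <= - c / 2 ->
  - c / 2 * x <= - ((t + c) * x) <= 2 * - c * x.
Proof.
move=> x0 t1 t2; have -> : - ((t + c) * x) = (- t - c) * x by ring.
by rewrite ler_pM2r// ler_pM2r//; apply/andP; split; lra.
Qed.

Lemma close_norm_arith (s t x : R) : 0 <= x -> `|s - t| <= `|s| / 2 ->
  `|s| / 2 * x <= `|t| * x <= 3 / 2 * `|s| * x.
Proof.
move=> x0 st; have H1 := ler_distD t s 0; have H2 := ler_distD s t 0.
rewrite !subr0 in H1 H2; rewrite (distrC t) in H2.
by apply/andP; split; rewrite ler_wpM2r//; lra.
Qed.

Lemma prim_Pos (f f' : R -> R) (a b : R) : 0 < a ->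
  (forall x : R, 0 < x -> is_derive x 1 f (f' x)) ->
  (forall x : R, 0 < x -> {for x, continuous f'}) -> prim f f' a b.
Proof.
move=> a0 df cf; apply: prim_C1.
  by move=> x /andP[ax _]; apply: df; exact: lt_le_trans ax.
apply: continuous_in_subspaceT => x /set_mem; rewrite /= in_itv/= => /andP[ax _].
by apply: cf; exact: lt_le_trans ax.
Qed.
End Auxiliary.

(** * Coercivity of the Hessian on the half-line *)

Section Coercivity.
Context {R : realType}.
Local Notation mu := (@lebesgue_measure R).
Implicit Types (D E : set (measurableTypeR R)) (a b x y : R).
(** [Q] is the profile, [P] and [A] its first two derivatives, and [q] the coefficient of the
    linearised equation, which [P] solves by [dA]. The number [kappa] is the exponential decay rate
    of [Q], later the square root of the frequency. *)
Variables (Q P A q : R -> R) (kappa : R).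
Hypothesis dQ : forall x, is_derive x 1 Q (P x).
Hypothesis dP : forall x, is_derive x 1 P (A x).
Hypothesis dA : forall x, is_derive x 1 A (q x * P x).
Hypothesis cq : continuous q.
Hypothesis Q_neq0 : forall x, Q x != 0.
Hypothesis P0 : P 0 = 0.

Definition slope x := P x / Q x.
Let h := slope.
(** The derivative of [slope] at 0, since [P 0 = 0] makes [slope] vanish there. *)
Definition curv : R := A 0 / Q 0.
Let c := curv.
Definition excess x := A x / Q x - h x ^+ 2 - c.
Let n := excess.

Hypothesis h_lt0 : forall x, 0 < x -> h x < 0.
Hypothesis c_lt0 : c < 0.
Hypothesis sQ : sq Pos Q.
Hypothesis sP : sq Pos P.
Hypothesis kappa_gt0 : 0 < kappa.
Hypothesis h_infty : h x @[x --> +oo] --> - kappa.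
Hypothesis AQ_infty : A x / Q x @[x --> +oo] --> kappa ^+ 2.
Hypothesis q_bounded : exists2 M : R, 0 < M & forall x, 0 < x -> `|q x| <= M.
Hypothesis n_le : forall x, 0 < x -> n x <= 2 * h x ^+ 2.
Hypothesis n_lt : exists2 x, 0 < x & n x < 2 * h x ^+ 2.

#[local] Lemma P_neq0 x : 0 < x -> P x != 0.
Proof.
by move=> /h_lt0; rewrite /h /slope => H; apply: contraTneq H => ->; rewrite mul0r ltxx.
Qed.

#[local] Lemma h_neq0 x : 0 < x -> h x != 0.
Proof. by move=> /h_lt0 H; rewrite lt_eqF. Qed.

#[local] Lemma invf_slope x : (h x)^-1 = Q x / P x. Proof. by rewrite /h /slope invf_div. Qed.

Lemma slope_der x : is_derive x 1 h (A x / Q x - h x ^+ 2).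
Proof.
apply: der_eq (derdiv (Q_neq0 x) (dP x) (dQ x)) _.
by rewrite /h /slope; field; exact: Q_neq0.
Qed.

Let bracket x := q x - 3 * (A x / Q x) + 2 * h x ^+ 2.

Lemma excess_der x : is_derive x 1 n (bracket x * h x).
Proof.
apply: der_eq (derB (derB (derdiv (Q_neq0 x) (dA x) (dQ x)) (derX2 (slope_der x))) (der_cst c x)) _.
by rewrite /bracket /h /slope; field; exact: Q_neq0.
Qed.

#[local] Lemma cQ x : {for x, continuous Q}. Proof. exact: der_continuous (dQ x). Qed.
#[local] Lemma cP x : {for x, continuous P}. Proof. exact: der_continuous (dP x). Qed.
#[local] Lemma cA x : {for x, continuous A}. Proof. exact: der_continuous (dA x). Qed.
#[local] Lemma ch x : {for x, continuous h}. Proof. exact: der_continuous (slope_der x). Qed.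
#[local] Lemma cn x : {for x, continuous n}. Proof. exact: der_continuous (excess_der x). Qed.

#[local] Lemma h0 : h 0 = 0. Proof. by rewrite /h /slope P0 mul0r. Qed.
#[local] Lemma n0 : n 0 = 0. Proof. by rewrite /n /excess h0 expr0n/= subr0 /c /curv subrr. Qed.

#[local] Lemma near0_linear : exists2 d : R, 0 < d & forall x, 0 < x -> x < d ->
  - c / 2 * x <= - h x <= 2 * - c * x.
Proof.
have c2 : 0 < - c / 2 by rewrite divr_gt0// oppr_gt0.
have := continuous_right0 (@cn 0); rewrite n0.
move=> /cvgr0Pnorm_le /(_ _ c2) /near_right0E [d d0 H].
exists d => // x x0 xd.
have [y /andP[y0 yx] E] := mean_value (ltW x0) (fun x _ => slope_der x).
rewrite h0 !subr0 in E.
have ny : `|n y| <= - c / 2.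
  move: y0; rewrite le_eqVlt => /predU1P[<-|y0]; first by rewrite n0 normr0 ltW.
  exact: H (le_lt_trans yx xd).
have E2 : A y / Q y - h y ^+ 2 = n y + c by rewrite /n /excess subrK.
rewrite E E2; move: ny; rewrite ler_norml => /andP[n1 n2].
exact: near0_arith.
Qed.

Let m x := n x / h x ^+ 2.

(** Near 0, [h] is comparable to [x] and [n' = bracket * h], so [n] is of order [x^2], like [h^2].
    At infinity [h] has the nonzero limit [- kappa]. *)
Lemma excess_bounded : exists2 M : R, 0 < M & forall x, 0 < x -> `|m x| <= M.
Proof.
apply: bounded_Pos => [x x0||].
- by apply: der_continuous (derdiv _ (excess_der x) (derX2 (slope_der x))); rewrite expf_neq0// h_neq0.
- have cb : {for 0, continuous bracket}.
    apply: cvgD; last first.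
      by apply: cvgM; [exact: cvg_cst|apply: cvgM; exact: ch].
    apply: cvgB; first exact: cq.
    apply: cvgM; first exact: cvg_cst.
    by apply: cvgM; [exact: cA|apply: cvgV; [exact: Q_neq0|exact: cQ]].
  have [M /near_right0E[d1 d10 H1]] := cvg_bounded (continuous_right0 cb).
  have [d2 d20 H2] := near0_linear.
  exists (Num.max M `|bracket 0| * (2 * - c) / (- c / 2) ^+ 2).
  apply/near_right0E; exists (Num.min d1 d2); first by rewrite lt_min d10.
  move=> x x0; rewrite lt_min => /andP[xd1 xd2].
  have [y /andP[y0 yx] E] := mean_value (ltW x0) (fun x _ => excess_der x).
  rewrite n0 !subr0 in E.
  have bM : `|bracket y| <= Num.max M `|bracket 0|.
    move: y0; rewrite le_eqVlt le_max => /predU1P[<-|y0]; first by rewrite lexx orbT.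
    by rewrite H1// (le_lt_trans yx).
  have hy : `|h y| <= 2 * - c * x.
    move: y0; rewrite le_eqVlt => /predU1P[<-|y0].
      by rewrite h0 normr0 !mulr_ge0// ?oppr_ge0 ltW.
    have /andP[_ H] := H2 y y0 (le_lt_trans yx xd2).
    rewrite ltr0_norm ?h_lt0// (le_trans H)// ler_wpM2l// mulr_ge0// oppr_ge0 ltW//.
  have /andP[hx _] := H2 x x0 xd2.
  have c2 : 0 < - c / 2 by rewrite divr_gt0// oppr_gt0.
  have hx2 : (- c / 2) ^+ 2 * x ^+ 2 <= h x ^+ 2.
    rewrite -exprMn -[h x ^+ 2]sqrrN lerXn2r// nnegrE ?oppr_ge0 ?ltW// ?h_lt0//.
    by rewrite mulr_gt0.
  have h2 : 0 < h x ^+ 2 by rewrite exprn_even_gt0//= h_neq0.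
  have nx : `|n x| <= Num.max M `|bracket 0| * (2 * - c) * x ^+ 2.
    rewrite E (normrM (bracket y * h y) x) (normrM (bracket y) (h y)) (gtr0_norm x0).
    rewrite [leRHS](_ : _ = Num.max M `|bracket 0| * (2 * - c * x) * x); last by ring.
    by rewrite ler_pM2r// ler_pM.
  rewrite /m normrM normfV (ger0_norm (ltW h2)) ler_pdivrMr// (le_trans nx)//.
  rewrite -[leRHS]mulrA ler_wpM2l//.
    by rewrite mulr_ge0 ?le_max ?normr_ge0 ?orbT// mulr_ge0// oppr_ge0 ltW.
  by rewrite mulrC ler_pdivlMr ?exprn_gt0// mulrC.
- have k2 : kappa ^+ 2 != 0 by rewrite expf_neq0// gt_eqF.
  apply: (cvg_bounded (l := (kappa ^+ 2 - (- kappa) ^+ 2 - c) / (- kappa) ^+ 2)).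
  have h2 : h x ^+ 2 @[x --> +oo] --> (- kappa) ^+ 2 by rewrite !expr2; apply: cvgM.
  apply: cvgM; last by apply: cvgV => //; rewrite sqrrN.
  by apply: cvgB; [exact: cvgB|exact: cvg_cst].
Qed.

#[local] Lemma cvgQ0 : Q x @[x --> +oo] --> 0.
Proof.
apply: (@sq_cvg0 _ Q P) => // b; apply: prim_C1.
by apply: continuous_subspaceT => x; exact: cP.
Qed.

Lemma AP_der x : 0 < x -> is_derive x 1 (fun t => A t / P t) (q x - A x / P x * (A x / P x)).
Proof.
move=> x0; apply: der_eq (derdiv (P_neq0 x0) (dA x) (dP x)) _.
by field; exact: P_neq0.
Qed.

Lemma Q2P_der x : 0 < x ->
  is_derive x 1 (fun t => Q t ^+ 2 / P t) (2 * Q x - Q x ^+ 2 / P x * (A x / P x)).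
Proof.
move=> x0; apply: der_eq (derdiv (P_neq0 x0) (derX2 (dQ x)) (dP x)) _.
by field; exact: P_neq0.
Qed.

Lemma Q3P_der x : 0 < x ->
  is_derive x 1 (fun t => Q t * Q t ^+ 2 / P t) (3 * Q x ^+ 2 - Q x * Q x ^+ 2 / P x * (A x / P x)).
Proof.
move=> x0; apply: der_eq (derdiv (P_neq0 x0) (derM (dQ x) (derX2 (dQ x))) (dP x)) _.
by field; exact: P_neq0.
Qed.

#[local] Lemma P_linear : exists2 d : R, 0 < d & forall x, 0 <= x -> x < d ->
  `|A 0| / 2 * x <= `|P x| <= 3 / 2 * `|A 0| * x.
Proof.
have A0 : A 0 != 0.
  by apply: contraTneq c_lt0; rewrite /c /curv => ->; rewrite mul0r ltxx.
have A20 : 0 < `|A 0| / 2 by rewrite divr_gt0// normr_gt0.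
have := continuous_right0 (@cA 0).
move=> /cvgrPdist_le /(_ _ A20) /near_right0E [d d0 H].
exists d => // x x0 xd.
have [y /andP[y0 yx] E] := mean_value x0 (fun x _ => dP x).
rewrite P0 !subr0 in E; rewrite E normrM (ger0_norm x0).
have Ay : `|A 0 - A y| <= `|A 0| / 2.
  move: y0; rewrite le_eqVlt => /predU1P[<-|y0]; first by rewrite subrr normr0 ltW.
  exact: H (le_lt_trans yx xd).
exact: close_norm_arith.
Qed.

Let F := primitive (fun t => P t ^+ 2).

#[local] Lemma F_der x : is_derive x 1 F (P x ^+ 2).
Proof.
have cP2 : continuous (fun t => P t ^+ 2) by move=> t; apply: cvgM; exact: cP.
by apply: (@primT_der _ _ (fun t => P t ^+ 2)) => //; apply: primitive_primT; exact: segint_cont.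
Qed.

#[local] Lemma F0 : F 0 = 0. Proof. by rewrite /F /primitive subrr. Qed.

#[local] Lemma F_ge0 x : 0 <= x -> 0 <= F x.
Proof.
move=> x0; rewrite -F0; apply: der_ge0 x0 (fun y _ => F_der y) _.
by move=> y _; exact: sqr_ge0.
Qed.

Let weight x := - (F x / P x ^+ 2).

#[local] Lemma weight_der x : 0 < x -> is_derive x 1 weight (- 1 - 2 * weight x * (A x / P x)).
Proof.
move=> x0; have P2 : P x ^+ 2 != 0 by rewrite expf_neq0// P_neq0.
apply: der_eq (derN (@derdiv _ F (fun t => P t ^+ 2) x _ _ P2 (F_der x) (derX2 (dP x)))) _.
by rewrite /weight; field; exact: P_neq0.
Qed.

#[local] Lemma weight_bounded b : exists2 M : R, 0 < M & forall x, 0 < x -> x <= b -> `|weight x| <= M.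
Proof.
apply: bounded_left => [x /weight_der H|]; first exact: der_continuous H.
have [d d0 H] := P_linear.
(* Here [F x] is at most [x] times the square of the upper bound in [P_linear], and
   [9 = (3/2)^2 / (1/2)^2] compares that square with the one of the lower bound. *)
exists (9 * d); apply/near_right0E; exists d => // x x0 xd.
have [y /andP[y0 yx] E] := mean_value (ltW x0) (fun x _ => F_der x).
rewrite F0 !subr0 in E.
have /andP[_ H2] := H y y0 (le_lt_trans yx xd).
have /andP[H1 _] := H x (ltW x0) xd.
have A0 := normr_ge0 (A 0).
have P2 : 0 < P x ^+ 2 by rewrite exprn_even_gt0//= P_neq0.
have Fx := F_ge0 (ltW x0).
rewrite /weight normrN ger0_norm ?divr_ge0// ?(ltW P2)// ler_pdivrMr//.
have K1 : P y ^+ 2 <= (3 / 2 * `|A 0| * x) ^+ 2.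
  rewrite -(real_normK (num_real (P y))) lerXn2r ?nnegrE ?normr_ge0//.
    by rewrite !mulr_ge0// ltW.
  by rewrite (le_trans H2)// ler_wpM2l// mulr_ge0.
have K2 : (`|A 0| / 2 * x) ^+ 2 <= P x ^+ 2.
  by rewrite -(real_normK (num_real (P x))) lerXn2r ?nnegrE// !mulr_ge0// ltW.
rewrite E (@le_trans _ _ ((3 / 2 * `|A 0| * x) ^+ 2 * x))//; first by rewrite ler_pM2r.
rewrite (@le_trans _ _ (9 * d * (`|A 0| / 2 * x) ^+ 2))//; last first.
  by rewrite ler_wpM2l// mulr_ge0// ltW.
rewrite [leRHS](_ : _ = (3 / 2 * `|A 0| * x) ^+ 2 * d); last by field.
by rewrite ler_wpM2l ?sqr_ge0// ltW.
Qed.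

#[local] Lemma cvg_h1 : (h x)^-1 @[x --> +oo] --> (- kappa)^-1.
Proof. by apply: cvgV => //; rewrite oppr_eq0 gt_eqF. Qed.

#[local] Lemma AP_eq x : A x / P x = A x / Q x * (h x)^-1.
Proof. by rewrite /h /slope invfM invrK mulrA mulrAC divfK// mulrC. Qed.

#[local] Lemma AP_infty : A x / P x @[x --> +oo] --> - kappa.
Proof.
have -> : - kappa = kappa ^+ 2 * (- kappa)^-1 by field; rewrite gt_eqF.
under eq_cvg do rewrite AP_eq.
exact: (cvgM AQ_infty cvg_h1).
Qed.

Lemma ler_RI_expanding_near f g : ig Pos f -> ig Pos g ->
  (\forall n \near \oo, \int[mu]_(x in expanding n) f x <= \int[mu]_(x in expanding n) g x) ->
  \int[mu]_(x in Pos) f x <= \int[mu]_(x in Pos) g x.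
Proof. by move=> fi gi; exact: ler_cvg_to (cvg_RI_expanding fi) (cvg_RI_expanding gi). Qed.

(* On ]0, x1] the square is completed with a small multiple of [weight], the
   solution of [r' = - 1 - 2 r A / P] that stays bounded at 0; beyond [x1] the
   coefficient [A / P] is close to [- kappa], so a constant weight suffices. *)
Lemma poincare : exists2 x1 : R, 0 < x1 & exists2 C : R, 0 < C & forall z z',
  (forall b, prim z z' 0 b) -> sq Pos z -> sq Pos (fun x => z' x - A x / P x * z x) ->
  z x1 = 0 ->
  \int[mu]_(x in Pos) (z x ^+ 2) <= C * \int[mu]_(x in Pos) ((z' x - A x / P x * z x) ^+ 2).
Proof.
pose d := kappa / 2; have d0 : 0 < d by rewrite divr_gt0.
have dk : - kappa < - d by rewrite ltrN2 ltr_pdivrMr// ltr_pMr// ltr1n.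
have /near_pinftyE[X X0 HX] : \forall x \near +oo, A x / P x < - d.
  exact: cvgr_lt AP_infty _ dk.
pose x1 := X + 1; have x10 : 0 < x1 by rewrite addr_gt0.
have [M M0 HM] := weight_bounded x1.
(* Chosen so that [d2^2 M^2 = d2/2]: completing the square costs at most half of the gain
   [d2 z^2]. *)
pose d2 := (2 * M ^+ 2)^-1; have d20 : 0 < d2 by rewrite invr_gt0 mulr_gt0// exprn_gt0.
pose c0 := Num.min (d ^+ 2) (d2 / 2).
have c00 : 0 < c0 by rewrite lt_min exprn_gt0//= divr_gt0.
exists x1 => //; exists c0^-1; first by rewrite invr_gt0.
move=> z z' zz' sz ss zx1; set s := fun x => z' x - A x / P x * z x in ss *.
rewrite ler_pdivlMl// -RintegralZl; [|exact: mPos|exact: sz.2].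
apply: ler_RI_expanding_near; [by apply: igZ; [exact: mPos|exact: sz.2]|exact: ss.2|].
have := expanding_near x10; apply: filterS => N.
have ep0 : 0 < N.+1%:R^-1 :> R by rewrite invr_gt0.
rewrite /expanding /= in_itv/=; move: ep0.
set ep : R := N.+1%:R^-1; set Y : R := N.+1%:R => ep0 /andP[epx x1Y].
have subP x y : 0 < x -> `[x, y] `<=` (Pos : set (measurableTypeR R)).
  by move=> x0 t; rewrite /= in_itv/= => /andP[/(lt_le_trans x0) ? _]; apply/PosE.
have iz x y : 0 < x -> ig `[x, y] (fun t => z t ^+ 2).
  by move=> x0; apply: igS sz.2 => //; [exact: mPos|exact: subP].
have iss x y : 0 < x -> ig `[x, y] (fun t => s t ^+ 2).
  by move=> x0; apply: igS ss.2 => //; [exact: mPos|exact: subP].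
have pz x y : 0 < x -> prim z z' x y by move=> x0; apply: primS (zz' y) => //; exact: ltW.
have icz x y : 0 < x -> ig `[x, y] (fun t => c0 * z t ^+ 2) by move=> x0; apply: igZ => //; exact: iz.
rewrite (RI_chasles epx x1Y (icz _ _ ep0)) (RI_chasles epx x1Y (iss _ _ ep0)).
apply: lerD.
- have pw : prim weight (fun x => - 1 - 2 * weight x * (A x / P x)) ep x1.
    apply: (prim_Pos _ ep0 (@weight_der)) => t t0.
    apply: cvgB; first exact: cvg_cst.
    apply: cvgM; last exact: der_continuous (AP_der t0).
    by apply: cvgM; [exact: cvg_cst|exact: der_continuous (weight_der t0)].
  have pz2 := primM epx (pz _ x1 ep0) (pz _ x1 ep0).
  have pT := primZ d2 (primM epx pw pz2).
  have E := prim_FTC epx pT; have [iT _] := pT.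
  rewrite /= zx1 !mulr0 sub0r in E.
  (* The boundary term at [x1] vanishes with [z x1], and the one at [ep] has a sign because
     [weight <= 0]; no limit at 0 has to be taken. *)
  have T0 : 0 <= \int[mu]_(x in `[ep, x1]) (d2 * ((- 1 - 2 * weight x * (A x / P x)) * (z x * z x) +
     weight x * (z' x * z x + z x * z' x))).
    rewrite -E oppr_ge0 pmulr_rle0// mulr_le0_ge0// -?expr2 ?sqr_ge0//.
    by rewrite /weight oppr_le0 divr_ge0 ?sqr_ge0// F_ge0// ltW.
  rewrite -[leLHS]addr0; apply: le_trans (lerD (lexx _) T0) _.
  rewrite -RintegralD//; last exact: icz.
  apply: le_Rintegral => //; [by apply: igD => //; exact: icz|exact: iss|].
  move=> x; rewrite /= in_itv/= => /andP[epx' xx1].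
  have x0 : 0 < x by exact: lt_le_trans epx'.
  have wM := HM x x0 xx1.
  have w2 : weight x ^+ 2 <= M ^+ 2.
    by rewrite -(real_normK (num_real (weight x))) lerXn2r ?nnegrE ?normr_ge0// ltW.
  have d2w : d2 ^+ 2 * weight x ^+ 2 <= d2 / 2.
    rewrite (@le_trans _ _ (d2 ^+ 2 * M ^+ 2))//; first by rewrite ler_wpM2l ?sqr_ge0.
    by rewrite le_eqVlt; apply/orP; left; apply/eqP; rewrite /d2; field; rewrite gt_eqF.
  have c0d : c0 <= d2 / 2 by rewrite /c0 ge_min lexx orbT.
  rewrite -subr_ge0.
  have -> : s x ^+ 2 - (c0 * z x ^+ 2 + d2 * ((- 1 - 2 * weight x * (A x / P x)) * (z x * z x) +
     weight x * (z' x * z x + z x * z' x))) =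
     (z' x - (A x / P x + d2 * weight x) * z x) ^+ 2 +
     (d2 - d2 ^+ 2 * weight x ^+ 2 - c0) * z x ^+ 2 by rewrite /s; ring.
  rewrite addr_ge0 ?sqr_ge0// mulr_ge0 ?sqr_ge0// subr_ge0 (le_trans c0d)//.
  by rewrite [X in X - _](splitr d2) -[leLHS]addr0 -addrA lerD2l subr_ge0.
- have pz2 := primM x1Y (pz _ Y x10) (pz _ Y x10).
  have pT := primZ d pz2.
  have E := prim_FTC x1Y pT; have [iT _] := pT.
  rewrite /= zx1 !mulr0 subr0 in E.
  (* The boundary term at [x1] vanishes again, and the one at [Y] is [d z(Y)^2 >= 0]. *)
  have T0 : 0 <= \int[mu]_(x in `[x1, Y]) (d * (z' x * z x + z x * z' x)).
    by rewrite -E mulr_ge0 ?(ltW d0)// -expr2 sqr_ge0.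
  rewrite -[leLHS]addr0; apply: le_trans (lerD (lexx _) T0) _.
  rewrite -RintegralD//; last exact: icz.
  apply: le_Rintegral => //; [by apply: igD => //; exact: icz|exact: iss|].
  move=> x; rewrite /= in_itv/= => /andP[x1x _].
  have APx : A x / P x < - d by apply: HX; apply: lt_le_trans x1x; rewrite ltrDl.
  have c0d : c0 <= d ^+ 2 by rewrite /c0 ge_min lexx.
  rewrite -subr_ge0.
  have -> : s x ^+ 2 - (c0 * z x ^+ 2 + d * (z' x * z x + z x * z' x)) =
     (z' x - (A x / P x + d) * z x) ^+ 2 +
     (2 * d * (- (A x / P x) - d) + (d ^+ 2 - c0)) * z x ^+ 2 by rewrite /s; ring.
  rewrite addr_ge0 ?sqr_ge0// mulr_ge0 ?sqr_ge0// addr_ge0 ?subr_ge0//.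
  apply: mulr_ge0; first by rewrite mulr_ge0// ltW.
  by rewrite subr_ge0 lerNr ltW.
Qed.

#[local] Lemma m_cont x : 0 < x -> {for x, continuous m}.
Proof.
move=> x0; apply: der_continuous (derdiv _ (excess_der x) (derX2 (slope_der x))).
by rewrite expf_neq0// h_neq0.
Qed.

(** * Completion of the square for one perturbation orthogonal to [Q] *)

Section fixed_v.
Variables v w : R -> R.
Hypothesis vw : forall b, prim v w 0 b.
Hypothesis sv : sq Pos v.
Hypothesis sw : sq Pos w.
Hypothesis vQ0 : \int[mu]_(x in Pos) (Q x * v x) = 0.

Let a : R := v 0 / Q 0.
(* Up to the derivative [T'] of the boundary term [T], which vanishes at both
   ends, completing the square leaves [S1 ^+ 2] and a multiple of [a ^+ 2]. *)
Let T x := A x / P x * (v x * v x) + (- (2 * a * c)) * (Q x ^+ 2 / P x * v x) +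
  a ^+ 2 * c * (Q x * Q x ^+ 2 / P x).
Let T' x := ((q x - A x / P x * (A x / P x)) * (v x * v x) +
    A x / P x * (w x * v x + v x * w x)) +
  (- (2 * a * c)) * ((2 * Q x - Q x ^+ 2 / P x * (A x / P x)) * v x + Q x ^+ 2 / P x * w x) +
  a ^+ 2 * c * (3 * Q x ^+ 2 - Q x * Q x ^+ 2 / P x * (A x / P x)).
Let S1 x := w x - A x / P x * v x + a * c * (Q x ^+ 2 / P x).

(** The first term of [T] comes from factorising the operator through its solution [P]. The second
    trades the cross term of the shift for [4 a c Q v]. The third cancels [a^2 c^2 Q^4 / P^2], the
    part of the squared shift that would be singular at 0, and leaves the factor [2 - m]. *)
#[local] Lemma square_identity x : 0 < x ->
  w x ^+ 2 + q x * v x ^+ 2 - 4 * a * c * (Q x * v x) - T' x =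
  S1 x ^+ 2 + a ^+ 2 * - c * (Q x ^+ 2 * (2 - m x)).
Proof.
move=> x0; rewrite /T' /S1 /m /n /excess /h /slope; field.
by rewrite Q_neq0 P_neq0.
Qed.

#[local] Lemma T_prim x y : 0 < x -> x <= y -> prim T T' x y.
Proof.
move=> x0 xy.
have pv : prim v w x y by apply: primS (vw y) => //; exact: ltW.
have cAP t : 0 < t -> {for t, continuous (fun t => A t / P t)}.
  by move=> /AP_der H; exact: der_continuous H.
have c2 t : {for t, continuous (fun t => Q t ^+ 2)} by apply: cvgM; exact: cQ.
apply: primD; first apply: primD.
- apply: (primM xy); last exact: primM.
  apply: (prim_Pos _ x0 (@AP_der)) => t t0.
  by apply: cvgB; [exact: cq|apply: cvgM; exact: cAP].
- apply: primZ; apply: (primM xy) => //.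
  apply: (prim_Pos _ x0 (@Q2P_der)) => t t0.
  apply: cvgB; first by apply: cvgM; [exact: cvg_cst|exact: cQ].
  by apply: cvgM; [exact: der_continuous (Q2P_der t0)|exact: cAP].
- apply: primZ; apply: (prim_Pos _ x0 (@Q3P_der)) => t t0.
  apply: cvgB; first by apply: cvgM; [exact: cvg_cst|exact: c2].
  by apply: cvgM; [exact: der_continuous (Q3P_der t0)|exact: cAP].
Qed.

Let y x := v x - a * Q x.

#[local] Lemma v_right0 : v x @[x --> 0^'+] --> v 0.
Proof.
apply/cvgrPdist_lt => e e0.
have [|d d0 H] := @prim_near R v w 0 1 0 e (vw 1) _ e0; first by rewrite lexx ler01.
apply/near_right0E; exists (Num.min d 1); first by rewrite lt_min d0 ltr01.
move=> x x0; rewrite lt_min => /andP[xd x1].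
by rewrite distrC H ?(ltW x0) ?(ltW x1)// subr0 gtr0_norm.
Qed.

#[local] Lemma y_right0 : y x @[x --> 0^'+] --> 0.
Proof.
have H : (fun x => v x - a * Q x) x @[x --> 0^'+] --> v 0 - a * Q 0.
  apply: cvgB; first exact: v_right0.
  by apply: cvgM; [exact: cvg_cst|exact: (continuous_right0 (@cQ 0))].
by rewrite /a divfK ?subrr// in H.
Qed.

(** Regrouped around [y], which vanishes at 0, the poles of the three terms of [T] cancel: each
    summand is a factor bounded near 0 times one that tends to 0. *)
#[local] Lemma T_eq x : 0 < x -> T x = (x * (A x / P x)) * (y x ^+ 2 / x) +
  (2 * a * Q x * (m x + 1)) * (h x * y x) + (a ^+ 2 * Q x ^+ 2 * (m x + 1)) * h x.
Proof.
move=> x0; rewrite /T /y /m /n /excess /h /slope; field.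
by rewrite Q_neq0 P_neq0// gt_eqF.
Qed.

#[local] Lemma vP_prim b : prim y (fun x => w x - a * P x) 0 b.
Proof.
have pQ : prim Q P 0 b.
  by apply: prim_C1; apply: continuous_subspaceT => x; exact: cP.
apply: prim_ext (primD (vw b) (primZ (- a) pQ)) => x _; rewrite /y mulNr//.
Qed.

#[local] Lemma T_right0 : T x @[x --> 0^'+] --> 0.
Proof.
have [M M0 HM] := excess_bounded.
have mb : \forall x \near 0^'+, `|m x + 1| <= M + 1.
  apply/near_right0E; exists 1 => // x x0 _.
  by rewrite (le_trans (ler_normD _ _))// normr1 lerD2r HM.
have [MQ HQ] := cvg_bounded (continuous_right0 (@cQ 0)).
have h_right0 : h x @[x --> 0^'+] --> 0 by have := continuous_right0 (@ch 0); rewrite h0.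
have E : \forall x \near 0^'+, (x * (A x / P x)) * (y x ^+ 2 / x) +
  (2 * a * Q x * (m x + 1)) * (h x * y x) + (a ^+ 2 * Q x ^+ 2 * (m x + 1)) * h x = T x.
  by apply/near_right0E; exists 1 => // x x0 _; rewrite T_eq.
have wP01 : sq `[0, 1] (fun x => w x - a * P x).
  have [wi _] := vP_prim 1; split; first exact: ig_meas wi.
  apply: (RI_oo _).1.
  have := (sqB (@mPos R) sw (sqZ a (@mPos R) sP)).2.
  apply: igS => //; first exact: mPos.
  by move=> x; rewrite /= in_itv/= => /andP[x0 _]; apply/PosE.
have lim3 : (fun x => (x * (A x / P x)) * (y x ^+ 2 / x) +
  (2 * a * Q x * (m x + 1)) * (h x * y x) + (a ^+ 2 * Q x ^+ 2 * (m x + 1)) * h x) x @[x --> 0^'+]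
    --> (0 + 0 + 0 : R).
  apply: cvgD; first apply: cvgD.
  - apply: cvg0_mul_bounded; last first.
      apply: (@sq_vanish_at0 _ y (fun x => w x - a * P x)); [exact: vP_prim|exact: wP01|].
      by rewrite /y /a divfK// subrr.
    have [d d0 H] := P_linear.
    have [MA HA] := cvg_bounded (continuous_right0 (@cA 0)).
    exists (MA * (2 / `|A 0|)).
    have : \forall x \near 0^'+, 0 < x /\ x < d.
      by apply/near_right0E; exists d.
    apply: filterS2 HA => x MAx [x0 xd].
    have /andP[H1 _] := H x (ltW x0) xd.
    have Px : 0 < `|P x| by rewrite normr_gt0 P_neq0.
    rewrite normrM normrM normfV (gtr0_norm x0) mulrA ler_pdivrMr//.
    have A0p : 0 < `|A 0|.
      by rewrite normr_gt0; apply: contraTneq c_lt0; rewrite /c /curv => ->; rewrite mul0r ltxx.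
    rewrite mulrC -mulrA ler_pM ?(ltW x0)//.
    by rewrite -[2 / _]invf_div ler_pdivlMl// divr_gt0.
  - apply: cvg0_mul_bounded; last first.
      have : (fun x => h x * y x) x @[x --> 0^'+] --> (0 * 0 : R) by exact: (cvgM h_right0 y_right0).
      by rewrite mulr0.
    exists (`|2 * a| * `|MQ| * (M + 1)).
    apply: filterS2 HQ mb => x H1 H2; rewrite normrM (normrM (2 * a)) ler_pM ?mulr_ge0//.
    by rewrite ler_wpM2l// (le_trans H1)// ler_norm.
  - apply: cvg0_mul_bounded => //.
    exists (a ^+ 2 * `|MQ| ^+ 2 * (M + 1)).
    apply: filterS2 HQ mb => x H1 H2; rewrite normrM (normrM (a ^+ 2)) ler_pM ?mulr_ge0//.
    rewrite ger0_norm ?sqr_ge0// ler_wpM2l ?sqr_ge0// normrX lerXn2r ?nnegrE//.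
    by rewrite (le_trans H1)// ler_norm.
rewrite !addr0 in lim3.
exact: cvg_trans (near_eq_cvg E) lim3.
Qed.

#[local] Lemma T_infty : T x @[x --> +oo] --> 0.
Proof.
have v0 := sq_cvg0 vw sv sw.
have lim1 : (fun x => A x / P x * (v x * v x)) x @[x --> +oo] --> - kappa * (0 * 0).
  exact: cvgM AP_infty (cvgM v0 v0).
have lim2 : (fun x => - (2 * a * c) * (Q x * (h x)^-1 * v x)) x @[x --> +oo] -->
    - (2 * a * c) * (0 * (- kappa)^-1 * 0).
  exact: cvgM (cvg_cst _) (cvgM (cvgM cvgQ0 cvg_h1) v0).
have lim3 : (fun x => a ^+ 2 * c * (Q x * Q x * (h x)^-1)) x @[x --> +oo] -->
    a ^+ 2 * c * (0 * 0 * (- kappa)^-1).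
  exact: cvgM (cvg_cst _) (cvgM (cvgM cvgQ0 cvgQ0) cvg_h1).
have E : T = (fun x => A x / P x * (v x * v x) + - (2 * a * c) * (Q x * (h x)^-1 * v x) +
    a ^+ 2 * c * (Q x * Q x * (h x)^-1)).
  by apply/funext => x; rewrite /T !invf_slope !expr2 !mulrA.
have lim := cvgD (cvgD lim1 lim2) lim3.
rewrite !(mulr0, mul0r) !addr0 in lim.
by rewrite E; exact: lim.
Qed.

Let L x := w x ^+ 2 + q x * v x ^+ 2 - 4 * a * c * (Q x * v x).

#[local] Lemma iqv : ig Pos (fun x => w x ^+ 2 + q x * v x ^+ 2).
Proof.
have [M M0 qM] := q_bounded.
apply: igD; [exact: mPos|exact: sw.2|].
apply: (@ig_Mb _ _ _ _ M); [exact: mPos|by apply: measurable_Pos => x _; exact: cq| |exact: sv.2].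
by move=> x /PosE; exact: qM.
Qed.

#[local] Lemma iL : ig Pos L.
Proof.
by apply: igB; [exact: mPos|exact: iqv|apply: igZ; [exact: mPos|apply: sqM => //; exact: mPos]].
Qed.

Let xi := \int[mu]_(x in Pos) (w x ^+ 2 + q x * v x ^+ 2).

#[local] Lemma int_L : \int[mu]_(x in Pos) L x = xi.
Proof.
have iQv : ig Pos (fun x => Q x * v x) by apply: sqM => //; exact: mPos.
rewrite /L RintegralB; [|exact: mPos|exact: iqv|by apply: igZ => //; exact: mPos].
by rewrite RintegralZl ?vQ0 ?mulr0 ?subr0//; exact: mPos.
Qed.

Let S x := S1 x ^+ 2 + a ^+ 2 * - c * (Q x ^+ 2 * (2 - m x)).

#[local] Lemma m_le2 x : 0 < x -> m x <= 2.
Proof. by move=> x0; rewrite /m ler_pdivrMr ?n_le// exprn_even_gt0//= h_neq0. Qed.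

#[local] Lemma D_ge0 x : 0 < x -> 0 <= a ^+ 2 * - c * (Q x ^+ 2 * (2 - m x)).
Proof.
move=> x0; apply: mulr_ge0.
  by apply: mulr_ge0; [exact: sqr_ge0|rewrite oppr_ge0; exact: ltW].
by apply: mulr_ge0; [exact: sqr_ge0|rewrite subr_ge0; exact: m_le2].
Qed.

#[local] Lemma S_ge0 x : 0 < x -> 0 <= S x.
Proof. by move=> x0; rewrite addr_ge0 ?sqr_ge0 ?D_ge0. Qed.

#[local] Lemma S_expanding N : ig (expanding N) S /\
  \int[mu]_(x in expanding N) S x =
  \int[mu]_(x in expanding N) L x - (T N.+1%:R - T N.+1%:R^-1).
Proof.
have e0 : 0 < N.+1%:R^-1 :> R by rewrite invr_gt0.
have eY : N.+1%:R^-1 <= N.+1%:R :> R.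
  by rewrite (@le_trans _ _ 1)// ?ler1n// invf_le1 ?ler1n// ltr0n.
have pT := T_prim e0 eY; have [iT _] := pT.
have iLe : ig (expanding N) L.
  by apply: (igS _ _ _ iL); [exact: mexpanding|exact: mPos|exact: expanding_Pos].
have ES x : expanding N x -> L x - T' x = S x.
  by move=> /expanding_Pos/PosE x0; rewrite /L square_identity.
split.
  by apply: ig_eq (igB (@mexpanding R N) iLe iT) => //; exact: mexpanding.
rewrite (prim_FTC eY pT) -[X in _ - X]/(\int[mu]_(x in expanding N) T' x).
rewrite -RintegralB//; last exact: mexpanding.
by apply: eq_Rintegral => x /set_mem xe; rewrite ES.
Qed.

#[local] Lemma cvg_S : \int[mu]_(x in expanding N) S x @[N --> \oo] --> xi.
Proof.
under eq_cvg do rewrite (S_expanding _).2.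
rewrite -[xi]subr0 -[X in _ - X](subr0 0) -int_L.
apply: cvgB; first exact: cvg_RI_expanding iL.
by apply: cvgB; [exact: (cvg_expanding_pinfty T_infty)|exact: (cvg_expanding_right0 T_right0)].
Qed.

#[local] Lemma mS1 : measurable_fun Pos S1.
Proof.
have [mw _] := sw; have [mv _] := sv.
apply: measurable_funD; first apply: measurable_funB => //.
  apply: measurable_funM => //; apply: measurable_Pos => x x0.
  exact: der_continuous (AP_der x0).
apply: measurable_funM; first exact: measurable_cst.
by apply: measurable_Pos => x x0; exact: der_continuous (Q2P_der x0).
Qed.

#[local] Lemma mS : measurable_fun Pos S.
Proof.
apply: measurable_funD; first by apply: measurable_funX; exact: mS1.
apply: measurable_funM; first exact: measurable_cst.
apply: measurable_Pos => x x0; apply: cvgM; first by apply: cvgM; exact: cQ.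
by apply: cvgB; [exact: cvg_cst|exact: m_cont].
Qed.

(** The integrals of [S >= 0] over the exhausting segments increase and converge to [xi] once the
    boundary terms die out, so they are bounded by [xi] and monotone convergence applies. *)
#[local] Lemma S_int : ig Pos S /\ \int[mu]_(x in Pos) S x <= xi.
Proof.
apply: ig_expanding_ge0; [exact: mS|exact: S_ge0|by move=> N; case: (S_expanding N)|].
move=> N; rewrite -(cvg_lim _ cvg_S)//.
apply: (@nondecreasing_cvgn_le _ (fun N => \int[mu]_(x in expanding N) S x)).
  move=> i j ij; apply: RI_le_sub; [exact: mexpanding|exact: mexpanding|exact: expanding_sub|exact: (S_expanding j).1|].
  by move=> x /expanding_Pos/PosE; exact: S_ge0.
by apply/cvg_ex; exists xi; exact: cvg_S.
Qed.

Lemma square_completion : sq Pos S1 /\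
  \int[mu]_(x in Pos) (S1 x ^+ 2) + a ^+ 2 * - c * \int[mu]_(x in Pos) (Q x ^+ 2 * (2 - m x)) <= xi.
Proof.
have [iS Sxi] := S_int.
have iS1 : ig Pos (fun x => S1 x ^+ 2).
  apply: (ig_le _ _ _ iS); [exact: mPos|exact: measurable_funX mS1|].
  by move=> x /PosE x0; rewrite (ger0_norm (sqr_ge0 _)) lerDl; exact: D_ge0.
have [M M0 HM] := excess_bounded.
have iD : ig Pos (fun x => Q x ^+ 2 * (2 - m x)).
  apply: (@ig_eq _ _ (fun x => (2 - m x) * Q x ^+ 2)); [exact: mPos|by move=> x _; rewrite mulrC|].
  apply: (@ig_Mb _ _ _ _ (2 + M)); [exact: mPos| | |exact: sQ.2].
    by apply: measurable_Pos => x x0; apply: cvgB; [exact: cvg_cst|exact: m_cont].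
  by move=> x /PosE x0; rewrite (le_trans (ler_normB _ _))// ger0_norm// lerD2l HM.
split; first by split; [exact: mS1|exact: iS1].
apply: le_trans Sxi.
rewrite -RintegralZl; [|exact: mPos|exact: iD].
rewrite -RintegralD; [exact: lexx|exact: mPos|exact: iS1|].
by apply: igZ; [exact: mPos|exact: iD].
Qed.

(** Carries the control of [S1] and [a] over to the first-order operator applied to [y]; the error
    [a m P] is square integrable because [m] is bounded. *)
Lemma residual_eq x : 0 < x -> (w x - a * P x) - A x / P x * y x = S1 x + a * (m x * P x).
Proof.
move=> x0; rewrite /S1 /y /m /n /excess /h /slope; field.
by rewrite Q_neq0 P_neq0.
Qed.
End fixed_v.

Lemma sq_eq D v w : measurable D -> (forall x, D x -> v x = w x) -> sq D v -> sq D w.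
Proof.
move=> mD vw [mv vi]; split.
  by apply: eq_measurable_fun mv => x /set_mem; exact: vw.
by apply: ig_eq vi => // x /vw ->.
Qed.

Let D0 := \int[mu]_(x in Pos) (Q x ^+ 2 * (2 - m x)).

#[local] Lemma D0_gt0 : 0 < D0.
Proof.
have [M M0 HM] := excess_bounded.
have h2 x : 0 < x -> 0 < h x ^+ 2 by move=> x0; rewrite exprn_even_gt0//= h_neq0.
have iD : ig Pos (fun x => Q x ^+ 2 * (2 - m x)).
  apply: (@ig_eq _ _ (fun x => (2 - m x) * Q x ^+ 2)); [exact: mPos|by move=> x _; rewrite mulrC|].
  apply: (@ig_Mb _ _ _ _ (2 + M)); [exact: mPos| | |exact: sQ.2].
    by apply: measurable_Pos => x x0; apply: cvgB; [exact: cvg_cst|exact: m_cont].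
  by move=> x /PosE x0; rewrite (le_trans (ler_normB _ _))// ger0_norm// lerD2l HM.
have [x0 x00 nx0] := n_lt.
apply: (@RI_gt0 _ _ x0) => //.
- move=> x xp; rewrite mulr_ge0 ?sqr_ge0// subr_ge0 /m ler_pdivrMr ?n_le// h2//.
- apply: cvgM; first by apply: cvgM; exact: cQ.
  by apply: cvgB; [exact: cvg_cst|exact: m_cont].
- rewrite mulr_gt0//; first by rewrite exprn_even_gt0//= Q_neq0.
  by rewrite subr_gt0 /m ltr_pdivrMr// h2.
Qed.

#[local] Lemma int_QP : \int[mu]_(x in Pos) (Q x * P x) = - (Q 0 ^+ 2 / 2).
Proof.
have iQP : ig Pos (fun x => Q x * P x) by apply: sqM => //; exact: mPos.
have cv := cvg_RI_expanding iQP.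
have E N : \int[mu]_(x in expanding N) (Q x * P x) = 2^-1 * (Q N.+1%:R * Q N.+1%:R) - 2^-1 * (Q N.+1%:R^-1 * Q N.+1%:R^-1).
  have eY : N.+1%:R^-1 <= N.+1%:R :> R.
    by rewrite (@le_trans _ _ 1)// ?ler1n// invf_le1 ?ler1n// ltr0n.
  have pQ x y : prim Q P x y.
    by apply: prim_C1; apply: continuous_subspaceT => t; exact: cP.
  rewrite (prim_FTC eY (primZ 2^-1 (primM eY (pQ _ _) (pQ _ _)))).
  by apply: eq_Rintegral => x _; field.
have cv2 : \int[mu]_(x in expanding N) (Q x * P x) @[N --> \oo] --> 2^-1 * (0 * 0) - 2^-1 * (Q 0 * Q 0).
  under eq_cvg do rewrite E.
  have l1 := cvg_expanding_pinfty cvgQ0.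
  have l2 := cvg_expanding_right0 (continuous_right0 (@cQ 0)).
  apply: cvgB; apply: cvgM => //; try exact: cvg_cst.
    by apply: cvgM; exact: l1.
  by apply: cvgM; exact: l2.
have -> : - (Q 0 ^+ 2 / 2) = 2^-1 * (0 * 0) - 2^-1 * (Q 0 * Q 0) by field.
by rewrite -(cvg_lim _ cv)// -(cvg_lim _ cv2).
Qed.

Theorem coercivity : exists2 K : R, 0 < K & forall v w, (forall b, prim v w 0 b) ->
  sq Pos v -> sq Pos w -> \int[mu]_(x in Pos) (Q x * v x) = 0 ->
  \int[mu]_(x in Pos) (v x ^+ 2) <=
    K * \int[mu]_(x in Pos) (w x ^+ 2 + q x * v x ^+ 2).
Proof.
have [x1 x10 [C C0 HC]] := poincare.
have [M M0 HM] := excess_bounded.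
have mP := @mPos R.
have I0 f : 0 <= \int[mu]_(x in Pos) (f x ^+ 2) :> R.
  by apply: Rintegral_ge0 => x _; exact: sqr_ge0.
pose N := \int[mu]_(x in Pos) (Q x ^+ 2); pose NP := \int[mu]_(x in Pos) (P x ^+ 2).
have sE : sq Pos (fun x => m x * P x).
  apply: (@sqMb _ _ _ _ M); [exact: mP|by apply: measurable_Pos => x x0; exact: m_cont| |exact: sP].
  by move=> x /PosE; exact: HM.
pose M2 := \int[mu]_(x in Pos) ((m x * P x) ^+ 2).
have q0 : 0 < Q 0 ^+ 2 / 2 by apply: divr_gt0; [rewrite exprn_even_gt0//=; exact: Q_neq0|exact: ltr0Sn].
have rD : 0 < - c * D0 by apply: mulr_gt0; [rewrite oppr_gt0; exact: c_lt0|exact: D0_gt0].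
have [K K0 HK] := @coercivity_arith R C N NP M2 _ _ C0 (I0 Q) (I0 P) (I0 (fun x => m x * P x)) q0 rD.
exists K; first exact: K0.
move=> v w vw sv sw vQ0.
pose a : R := v 0 / Q 0.
pose S1 x := w x - A x / P x * v x + a * c * (Q x ^+ 2 / P x).
have [sS1 H1] : sq Pos S1 /\ \int[mu]_(x in Pos) (S1 x ^+ 2) + a ^+ 2 * - c * D0 <=
    \int[mu]_(x in Pos) (w x ^+ 2 + q x * v x ^+ 2) := square_completion vw sv sw vQ0.
(* Subtracting a multiple of [P] does not change the operator, whose kernel it spans; this [b]
   provides the condition [z x1 = 0] required by [poincare]. *)
pose y x := v x - a * Q x; pose b := y x1 / P x1; pose z x := y x - b * P x.
pose z' x := (w x - a * P x) - b * A x.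
have pQ x : prim Q P 0 x by apply: prim_C1; apply: continuous_subspaceT => t; exact: cP.
have pP x : prim P A 0 x by apply: prim_C1; apply: continuous_subspaceT => t; exact: cA.
have pz t : prim z z' 0 t.
  apply: prim_ext (primD (primD (vw t) (primZ (- a) (pQ t))) (primZ (- b) (pP t))) => x _.
    by rewrite /z /y !mulNr.
  by rewrite /z' !mulNr.
have sz : sq Pos z by exact: (sqB mP (sqB mP sv (sqZ a mP sQ)) (sqZ b mP sP)).
have zE x : 0 < x -> S1 x + a * (m x * P x) = z' x - A x / P x * z x.
  move=> x0; have Px := P_neq0 x0.
  have -> : z' x - A x / P x * z x = w x - a * P x - A x / P x * y x := residual_shift _ _ _ _ Px.
  exact: esym (residual_eq v w x0).
have ss : sq Pos (fun x => z' x - A x / P x * z x).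
  apply: (sq_eq mP _ (sqD mP sS1 (sqZ a mP sE))) => x /PosE; exact: zE.
have zx1 : z x1 = 0 by rewrite /z /b (divfK (P_neq0 x10)) subrr.
have Zb := HC z z' pz sz ss zx1.
have Zs : \int[mu]_(x in Pos) (z x ^+ 2) <=
    C * (2 * \int[mu]_(x in Pos) (S1 x ^+ 2) + 2 * a ^+ 2 * M2).
  apply: (le_trans Zb); rewrite (ler_pM2l C0).
  have i1 := igZ 2 mP sS1.2; have i2 := igZ (2 * a ^+ 2) mP sE.2.
  rewrite -(RintegralZl _ mP sS1.2) -(RintegralZl _ mP sE.2) -(RintegralD mP i1 i2).
  apply: (le_Rintegral mP ss.2 (igD mP i1 i2)) => x /PosE x0.
  rewrite -(zE x x0); exact: sqrD_le.
have iQz : ig Pos (fun x => Q x * z x) by exact: (sqM mP sQ sz).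
have iQP : ig Pos (fun x => Q x * P x) by exact: (sqM mP sQ sP).
have iQQ := sQ.2.
(* The decomposition of [v] tested against [Q]: the orthogonality relation becomes an equation for
   [b]. *)
have bE : b * (Q 0 ^+ 2 / 2) = a * N + \int[mu]_(x in Pos) (Q x * z x).
  have i1 := igZ a mP iQQ; have i2 := igZ b mP iQP.
  have E : \int[mu]_(x in Pos) (Q x * v x) =
    \int[mu]_(x in Pos) (a * Q x ^+ 2 + b * (Q x * P x) + Q x * z x).
    by apply: eq_Rintegral => x _; exact: split_product.
  rewrite vQ0 (RintegralD mP (igD mP i1 i2) iQz) (RintegralD mP i1 i2) in E.
  rewrite (RintegralZl _ mP iQQ) (RintegralZl _ mP iQP) int_QP in E.
  exact: constraint_arith E.
have vb : \int[mu]_(x in Pos) (v x ^+ 2) <=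
    3 * (a ^+ 2 * N + b ^+ 2 * NP + \int[mu]_(x in Pos) (z x ^+ 2)).
  have i1 := igZ (a ^+ 2) mP iQQ; have i2 := igZ (b ^+ 2) mP sP.2.
  have i12 := igD mP i1 i2; have i3 := igD mP i12 sz.2.
  rewrite /N /NP -(RintegralZl _ mP iQQ) -(RintegralZl _ mP sP.2) -(RintegralD mP i1 i2).
  rewrite -(RintegralD mP i12 sz.2) -(RintegralZl _ mP i3).
  apply: (le_Rintegral mP sv.2 (igZ 3 mP i3)) => x _; exact: sqrD3_le.
apply: (le_trans vb).
apply: (HK a b _ _ _ _ (I0 S1) (I0 z) _ Zs bE (cauchy_schwarz mP sQ sz)).
by rewrite mulrA; exact: H1.
Qed.
End Coercivity.

(** * The profile of a standing wave *)

Section GrowthAtZero.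
Context {R : realType}.
Implicit Types (s t : R).

Lemma lipschitz_segment (F F' : R -> R) (L B : R) : (forall s, is_derive s 1 F (F' s)) ->
  (forall s, `|s| <= B -> `|F' s| <= L) ->
  forall s t, `|s| <= B -> `|t| <= B -> `|F s - F t| <= L * `|s - t|.
Proof.
move=> dF FL s t; wlog ts : s t / t <= s => [H|].
  case: (leP t s) => [ts|/ltW st] sB tB; first exact: H.
  by rewrite distrC [X in _ * X]distrC; apply: H.
move=> sB tB; have [c /andP[tc cs] ->] := mean_value ts (fun x _ => dF x).
rewrite normrM ler_wpM2r// FL// ler_norml.
move: sB tB; rewrite !ler_norml => /andP[_ sB] /andP[tB _].
by rewrite (le_trans tB)// (le_trans cs).
Qed.

Section nonlinearity.
Variables (G g g2 : R -> R).
Hypothesis dG : forall s, is_derive s 1 G (g s).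
Hypothesis dg : forall s, is_derive s 1 g (g2 s).
Hypothesis cg2 : continuous g2.
Hypothesis G0 : G 0 = 0.
Hypothesis g0 : g 0 = 0.

Lemma growth_at0 (L B : R) : (forall s, `|s| <= B -> `|g2 s| <= L) ->
  forall s, `|s| <= B -> `|g s| <= L * `|s| /\ `|G s| <= L * s ^+ 2.
Proof.
move=> HL s sB.
have z d : 0 <= d -> `|0 : R| <= d by rewrite normr0.
have Hg t : `|t| <= B -> `|g t| <= L * `|t|.
  move=> tB; have := lipschitz_segment dg HL tB (z _ (le_trans (normr_ge0 _) tB)).
  by rewrite g0 !subr0.
split; first exact: Hg.
have L0 : 0 <= L by apply: le_trans (normr_ge0 _) (HL _ sB).
have HH t : `|t| <= `|s| -> `|g t| <= L * `|s|.
  by move=> ts; rewrite (le_trans (Hg _ (le_trans ts sB)))// ler_wpM2l.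
have := lipschitz_segment dG HH (lexx _) (z _ (normr_ge0 s)).
by rewrite G0 !subr0 -mulrA -expr2 real_normK// num_real.
Qed.

Lemma quadratic_bound (B : R) : 0 < B -> exists2 L : R, 0 < L &
  forall s, `|s| <= B -> `|g s| <= L * `|s| /\ `|G s| <= L * s ^+ 2.
Proof.
move=> B0.
have [L L0 HL] : exists2 M : R, 0 < M & forall x, - B <= x <= B -> `|g2 x| <= M.
  by apply: continuous_seg_le; [rewrite (@le_trans _ _ 0)// ?oppr_le0 ltW|exact: continuous_subspaceT].
by exists L => //; apply: growth_at0 => s; rewrite ler_norml; exact: HL.
Qed.

End nonlinearity.
End GrowthAtZero.

Section Profile.
Context {R : realType}.
Local Notation mu := (@lebesgue_measure R).
Implicit Types (a b x y s t : R).
Variables (G g g2 Q P : R -> R) (w : R).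
Hypothesis dG : forall s, is_derive s 1 G (g s).
Hypothesis dg : forall s, is_derive s 1 g (g2 s).
Hypothesis cg2 : continuous g2.
Hypothesis G0 : G 0 = 0.
Hypothesis g0 : g 0 = 0.
Hypothesis g20 : g2 0 = 0.
Hypothesis dQ : forall x, is_derive x 1 Q (P x).
Let A x := g (Q x) + w * Q x.
Let q x := g2 (Q x) + w.
Hypothesis dP : forall x, is_derive x 1 P (A x).
Hypothesis Q_even : forall x, Q (- x) = Q x.
Hypothesis sQT : sq setT Q.
Hypothesis sPT : sq setT P.
Hypothesis Q_nontrivial : exists x, Q x != 0.

Lemma profile_der x : is_derive x 1 A (q x * P x).
Proof.
apply: der_eq (derD (der_comp (dg (Q x)) (dQ x)) (derZ w (dQ x))) _.
by rewrite /q mulrDl.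
Qed.

#[local] Lemma Q_cont : continuous Q. Proof. move=> x; exact: der_continuous (dQ x). Qed.
#[local] Lemma P_cont : continuous P. Proof. move=> x; exact: der_continuous (dP x). Qed.
#[local] Lemma A_cont : continuous A. Proof. move=> x; exact: der_continuous (profile_der x). Qed.

Lemma profile_cq : continuous q.
Proof. by apply: continuousD'; [exact: continuous_comp' cg2 Q_cont|exact: cst_continuous]. Qed.

#[local] Lemma P_odd x : P (- x) = - P x.
Proof.
have d1 := der_comp (dQ (- x)) (derN (der_id x)).
have d2 : is_derive x 1 Q (P (- x) * - 1) by apply: der_ext d1 => y; exact: Q_even.
by rewrite -(der_derive1 (dQ x)) (der_derive1 d2) mulrN1 opprK.
Qed.

Lemma profile_P0 : P 0 = 0.
Proof. by have := P_odd 0; rewrite oppr0 => /eqP; rewrite -addr_eq0 -mulr2n mulrn_eq0 => /eqP. Qed.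

#[local] Lemma sqPos (v : R -> R) : sq setT v -> sq Pos v.
Proof. by apply: sqS => //; exact: mPos. Qed.

#[local] Lemma prim_deriv (u v : R -> R) a b : (forall x, is_derive x 1 u (v x)) -> continuous v ->
  prim u v a b.
Proof. by move=> d c; exact: (prim_C1 (fun x _ => d x) (continuous_subspaceT c)). Qed.

Lemma profile_Q_infty : Q x @[x --> +oo] --> 0.
Proof.
by apply: (@sq_cvg0 _ Q P); [move=> b; exact: prim_deriv dQ P_cont|exact: sqPos|exact: sqPos].
Qed.

#[local] Lemma even_abs x : Q x = Q `|x|.
Proof. by case: (ler0P x) => //; rewrite Q_even. Qed.

Lemma profile_bounded : exists2 B : R, 0 < B & forall x, `|Q x| <= B.
Proof.
have [B B0 HB] : exists2 M : R, 0 < M & forall x, 0 < x -> `|Q x| <= M.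
  apply: bounded_Pos => [x _||]; [exact: Q_cont| |exact: cvg_bounded profile_Q_infty].
  by apply: cvg_bounded; apply: continuous_right0; exact: Q_cont.
exists (B + `|Q 0|) => [|x]; first by rewrite ltr_wpDr.
rewrite even_abs; have [->|x0] := eqVneq x 0; first by rewrite normr0 lerDr ltW.
by rewrite (le_trans (HB _ _)) ?lerDl// normr_gt0.
Qed.

#[local] Lemma g2_bounded : exists2 L : R, 0 < L & forall x y, `|g (Q x) - g (Q y)| <= L * `|Q x - Q y|.
Proof.
have [B B0 HB] := profile_bounded.
have [L L0 HL] : exists2 M : R, 0 < M & forall x, - B <= x <= B -> `|g2 x| <= M.
  by apply: continuous_seg_le; [rewrite (@le_trans _ _ 0)// ?oppr_le0 ltW|exact: continuous_subspaceT].
exists L => // x y; apply: (lipschitz_segment dg (B := B)) => // s; rewrite ler_norml; exact: HL.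
Qed.

(** Feeds the uniqueness arguments below, where [gronwall] compares the profile with another
    solution having the same data at a point. *)
#[local] Lemma A_lipschitz : exists2 L : R, 0 < L & forall x y, `|A x - A y| <= L * `|Q x - Q y|.
Proof.
have [L L0 HL] := g2_bounded; exists (L + `|w|) => [|x y]; first by rewrite ltr_wpDr.
have -> : A x - A y = (g (Q x) - g (Q y)) + w * (Q x - Q y) by rewrite /A; ring.
by rewrite (le_trans (ler_normD _ _))// normrM mulrDl lerD.
Qed.

Lemma profile_q_bounded : exists2 M : R, 0 < M & forall x, 0 < x -> `|q x| <= M.
Proof.
apply: bounded_Pos => [x _||]; first exact: profile_cq.
  by apply: cvg_bounded; apply: continuous_right0; exact: profile_cq.
apply: (@cvg_bounded _ _ _ _ (g2 0 + w)); apply: cvgD; last exact: cvg_cst.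
by apply: continuous_cvg; [exact: cg2|exact: profile_Q_infty].
Qed.

#[local] Lemma little_o (e : R) : 0 < e ->
  exists2 d : R, 0 < d & forall s, `|s| <= d -> `|g s| <= e * `|s| /\ `|G s| <= e * s ^+ 2.
Proof.
move=> e0.
have /cvgrPdist_le/(_ e e0) : g2 x @[x --> 0] --> 0 by rewrite -[X in _ --> X]g20; exact: cg2.
move=> /nbhs_ballP[d d0 Hd]; exists (d / 2) => [|s sd]; first by rewrite divr_gt0.
apply: (growth_at0 dG dg G0 g0 _ sd) => t td.
have := Hd t; rewrite sub0r normrN; apply; rewrite /ball/= sub0r normrN.
by rewrite (le_lt_trans td)// ltr_pdivrMr// ltr_pMr// ltr1n.
Qed.

#[local] Lemma A_bound : exists2 L : R, 0 < L & forall x, `|A x| <= L * `|Q x|.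
Proof.
have [B B0 HB] := profile_bounded.
have [L L0 HL] := quadratic_bound dG dg cg2 G0 g0 B0.
exists (L + `|w|) => [|x]; first by rewrite ltr_wpDr.
rewrite /A (le_trans (ler_normD _ _))// normrM mulrDl lerD//.
by have [] := HL _ (HB x).
Qed.

#[local] Lemma G_bound : exists2 L : R, 0 < L & forall x, `|G (Q x)| <= L * Q x ^+ 2.
Proof.
have [B B0 HB] := profile_bounded.
have [L L0 HL] := quadratic_bound dG dg cg2 G0 g0 B0.
by exists L => // x; have [] := HL _ (HB x).
Qed.

(** Puts [P] in H^1, so that [P] too vanishes at infinity. *)
#[local] Lemma sA : sq setT A.
Proof.
have [L L0 HL] := A_bound.
have mA : measurable_fun setT A by apply: segint_measurable; apply: segint_cont; exact: A_cont.
split => //; apply: (@ig_le _ _ _ (fun x => L ^+ 2 * Q x ^+ 2)) => //.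
- exact: measurable_funX.
- move=> x _; rewrite normrX -exprMn -[leRHS]real_normK ?num_real// lerXn2r ?nnegrE//.
  by rewrite normrM (gtr0_norm L0).
- by apply: igZ => //; case: sQT.
Qed.

Lemma profile_P_infty : P x @[x --> +oo] --> 0.
Proof.
by apply: (@sq_cvg0 _ P A); [move=> b; exact: prim_deriv dP A_cont|exact: sqPos|apply: sqPos; exact: sA].
Qed.

(** The difference of the two sides is conserved along the equation and tends to 0 at infinity. *)
Lemma first_integral x : P x ^+ 2 = 2 * G (Q x) + w * Q x ^+ 2.
Proof.
pose f x := P x ^+ 2 - (2 * G (Q x) + w * Q x ^+ 2).
have df y : is_derive y 1 f 0.
  apply: der_eq (derB (derX2 (dP y))
    (derD (derZ 2 (der_comp (dG (Q y)) (dQ y))) (derZ w (derX2 (dQ y))))) _.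
  by rewrite /A; ring.
have lf : f y @[y --> +oo] --> 0.
  have cG : G (Q y) @[y --> +oo] --> 0.
    rewrite -[X in _ --> X]G0; apply: continuous_cvg; last exact: profile_Q_infty.
    exact: der_continuous (dG 0).
  have -> : (0 : R) = 0 * 0 - (2 * 0 + w * (0 * 0)) by rewrite !mulr0 addr0 subr0.
  apply: cvgB; first by apply: cvgM; exact: profile_P_infty.
  apply: cvgD; first by apply: cvgM; [exact: cvg_cst|exact: cG].
  by apply: cvgM; [exact: cvg_cst|apply: cvgM; exact: profile_Q_infty].
have fx : f = fun=> f x by apply/funext => y; exact: der0_cst df y x.
have : f x = 0.
  have cc : f y @[y --> +oo] --> f x by rewrite fx; exact: cvg_cst.
  by rewrite -(cvg_lim _ lf)// (cvg_lim _ cc).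
by rewrite /f => /eqP; rewrite subr_eq0 => /eqP.
Qed.

(** By [first_integral], [P^2] is at most a constant times [Q^2], so a zero of [Q] propagates to the
    right by [gronwall]. Starting from the zero [- |x|] covers the right half-line, and evenness
    covers the rest. *)
Lemma profile_neq0 x : Q x != 0.
Proof.
apply/eqP => Qx; have [y /eqP] := Q_nontrivial; apply.
have [L L0 HL] := G_bound.
pose f y := Q y ^+ 2.
have H : forall y, - `|x| <= y -> f y = 0.
  apply: (@gronwall _ _ (fun y => 2 * Q y * P y) (1 + 2 * L + `|w|)).
  - by move=> z _; exact: derX2.
  - move=> z _; have F := first_integral z; have /ler_normlW GL := HL z.
    have wl : w * Q z ^+ 2 <= `|w| * Q z ^+ 2 by rewrite ler_wpM2r ?sqr_ge0// ler_norm.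
    have s := sqr_ge0 (Q z - P z); rewrite /f.
    rewrite sqrrB in s; nra.
  - by move=> z; exact: sqr_ge0.
  - by rewrite /f Q_even -even_abs Qx expr0n.
have : f `|y| = 0 by apply: H; rewrite (@le_trans _ _ 0)// oppr_le0.
by rewrite /f -even_abs => /eqP; rewrite sqrf_eq0 => /eqP.
Qed.

#[local] Lemma Q0_gt0 : 0 < `|Q 0|. Proof. by rewrite normr_gt0 profile_neq0. Qed.

#[local] Lemma Q_small (e : R) : 0 < e -> exists2 X : R, 0 < X & forall x, X < x -> `|Q x| < e.
Proof.
move=> e0; have /cvgrPdist_lt/(_ e e0)/near_pinftyE[X X0 H] := profile_Q_infty.
by exists X => // x /H; rewrite sub0r normrN.
Qed.

(** If [P x = 0], then [Q] and its reflection about [x] solve the same equation with the same data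
    at [x], so they coincide. With the symmetry about 0 this makes [Q] periodic of period [2 x] on
    the right half-line, against its decay. *)
Lemma profile_P_neq0 x : 0 < x -> P x != 0.
Proof.
move=> x0; apply/eqP => Px.
have [L L0 HL] := A_lipschitz.
pose d y := Q y - Q (2 * x - y); pose d' y := P y + P (2 * x - y).
have dd y : is_derive y 1 d (d' y).
  apply: der_eq (derB (dQ y) (der_comp (dQ _) (derB (der_cst (2 * x) y) (der_id y)))) _.
  by rewrite /d'; ring.
have dd' y : is_derive y 1 d' (A y - A (2 * x - y)).
  apply: der_eq (derD (dP y) (der_comp (dP _) (derB (der_cst (2 * x) y) (der_id y)))) _.
  by ring.
pose f y := d y ^+ 2 + d' y ^+ 2.
have H : forall y, x <= y -> f y = 0.
  apply: (@gronwall _ _ (fun y => 2 * d y * d' y + 2 * d' y * (A y - A (2 * x - y))) (1 + L)).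
  - by move=> z _; exact: derD (derX2 (dd z)) (derX2 (dd' z)).
  - move=> z _.
    have K : d' z * (A z - A (2 * x - z)) <= L * (`|d' z| * `|d z|).
      rewrite (le_trans (ler_norm _))// normrM mulrCA ler_wpM2l//.
    have s1 : 2 * (d z * d' z) <= f z.
      by rewrite /f; have := sqr_ge0 (d z - d' z); rewrite sqrrB; lra.
    have s2 : 2 * (`|d' z| * `|d z|) <= f z.
      rewrite /f -(real_normK (num_real (d z))) -(real_normK (num_real (d' z))).
      by have := sqr_ge0 (`|d' z| - `|d z|); rewrite sqrrB; lra.
    have s3 := ler_wpM2l (ltW L0) s2.
    rewrite mulrDl mul1r -!mulrA; lra.
  - by move=> z; rewrite addr_ge0 ?sqr_ge0.
  - by rewrite /f /d /d' (_ : 2 * x - x = x); [rewrite subrr Px addr0 expr0n/= addr0|ring].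
have per y : x <= y -> Q y = Q (y - 2 * x).
  move=> /H /eqP; rewrite /f paddr_eq0 ?sqr_ge0// => /andP[]; rewrite sqrf_eq0 subr_eq0.
  by move=> /eqP -> _; rewrite -Q_even opprB.
have pern n : Q (n%:R * (2 * x)) = Q 0.
  elim: n => [|n IH]; first by rewrite mul0r.
  rewrite per; first by rewrite -IH -natr1; congr Q; ring.
  have : 0 <= n%:R * (2 * x) by rewrite mulr_ge0// mulr_ge0// ltW.
  by rewrite -natr1 mulrDl mul1r; lra.
have [X X0 HX] := Q_small Q0_gt0.
pose n := (Num.truncn (X / (2 * x))).+1.
have : X < n%:R * (2 * x) by rewrite -ltr_pdivrMr ?mulr_gt0// truncnS_gt.
by move=> /HX; rewrite pern ltxx.
Qed.

(** Neither factor vanishes, so [Q P] keeps its sign on the half-line; were it positive, [Q^2] would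
    increase and could not tend to 0. *)
Lemma profile_slope_lt0 x : 0 < x -> P x / Q x < 0.
Proof.
move=> x0; rewrite ltNge; apply/negP => h0.
have QP0 : 0 < Q x * P x.
  rewrite lt_neqAle eq_sym mulf_neq0 ?profile_neq0 ?profile_P_neq0//=.
  have -> : Q x * P x = P x / Q x * Q x ^+ 2 by field; exact: profile_neq0.
  by rewrite mulr_ge0// sqr_ge0.
have pos y : x <= y -> 0 <= Q y * P y.
  move=> xy; rewrite leNgt; apply/negP => y0.
  have cc : continuous (fun x => Q x * P x) by apply: continuousM'; [exact: Q_cont|exact: P_cont].
  have [||z /[!in_itv]/= /andP[xz _] /eqP] := @IVT _ (fun x => Q x * P x) x y 0 xy.
  - exact: continuous_subspaceT.
  - by rewrite ge_min le_max (ltW y0) (ltW QP0) orbT.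
  rewrite mulf_eq0 (negbTE (profile_neq0 z)) (negbTE (profile_P_neq0 _))//.
  exact: lt_le_trans xz.
have incr y : x <= y -> Q x ^+ 2 <= Q y ^+ 2.
  move=> xy; apply: (@der_ge0 _ (fun y => Q y ^+ 2) (fun y => 2 * Q y * P y)) => //.
    by move=> z _; exact: derX2.
  by move=> z /andP[xz _]; rewrite -mulrA mulr_ge0// pos.
have Qx0 : 0 < `|Q x| by rewrite normr_gt0 profile_neq0.
have [X X0 HX] := Q_small Qx0.
have /HX : X < X + x + 1 by lra.
by rewrite ltNge -[`|Q x| <= _]ler_sqr ?nnegrE// !real_normK ?num_real// incr//; lra.
Qed.

(** If [A 0 = 0], the constant [Q 0] is a solution with the same data at 0; [Q] would equal it on
    the right half-line and not decay. *)
#[local] Lemma curv_neq0 : A 0 / Q 0 != 0.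
Proof.
rewrite mulf_neq0// ?invr_eq0 ?profile_neq0//; apply/eqP => A0.
have [L L0 HL] := A_lipschitz.
pose f y := (Q y - Q 0) ^+ 2 + P y ^+ 2.
have H : forall y, 0 <= y -> f y = 0.
  apply: (@gronwall _ _ (fun y => 2 * (Q y - Q 0) * P y + 2 * P y * A y) (1 + L)).
  - move=> z _; apply: derD (derX2 _) (derX2 (dP z)).
    by apply: der_eq (derB (dQ z) (der_cst (Q 0) z)) _; rewrite subr0.
  - move=> z _.
    have K : P z * A z <= L * (`|P z| * `|Q z - Q 0|).
      have := HL z 0; rewrite A0 subr0 => HA.
      by rewrite (le_trans (ler_norm _))// normrM mulrCA ler_wpM2l.
    have s1 : 2 * ((Q z - Q 0) * P z) <= f z.
      by rewrite /f; have := sqr_ge0 (Q z - Q 0 - P z); rewrite (sqrrB (Q z - Q 0)); lra.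
    have s2 : 2 * (`|P z| * `|Q z - Q 0|) <= f z.
      rewrite /f -(real_normK (num_real (Q z - Q 0))) -(real_normK (num_real (P z))).
      by have := sqr_ge0 (`|P z| - `|Q z - Q 0|); rewrite sqrrB; lra.
    have s3 := ler_wpM2l (ltW L0) s2.
    rewrite mulrDl mul1r -!mulrA; lra.
  - by move=> z; rewrite addr_ge0 ?sqr_ge0.
  - by rewrite /f subrr profile_P0 expr0n/= addr0.
have [X X0 HX] := Q_small Q0_gt0.
have := HX (X + 1); rewrite ltrDl ltr01 => /(_ isT).
have /H : 0 <= X + 1 by lra.
move=> /eqP; rewrite /f paddr_eq0 ?sqr_ge0// => /andP[]; rewrite sqrf_eq0 subr_eq0.
by move=> /eqP -> _; rewrite ltxx.
Qed.

#[local] Notation h := (slope Q P).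

#[local] Lemma h_der x : is_derive x 1 h (A x / Q x - h x ^+ 2).
Proof. exact: slope_der dQ dP profile_neq0 x. Qed.

#[local] Lemma h_0 : h 0 = 0. Proof. by rewrite /slope profile_P0 mul0r. Qed.

(** This is [h' 0]; were it positive, [h] would increase from [h 0 = 0], but it is negative to the
    right of 0. *)
Lemma profile_curv_lt0 : A 0 / Q 0 < 0.
Proof.
rewrite lt_neqAle curv_neq0 leNgt; apply/negP => c0.
pose f x := A x / Q x - h x ^+ 2.
have cf : {for 0, continuous f}.
  apply: cvgB; first by apply: cvgM; [exact: A_cont|apply: cvgV; [exact: profile_neq0|exact: Q_cont]].
  by apply: cvgM; exact: (der_continuous (h_der 0)).
have f0 : f 0 = A 0 / Q 0 by rewrite /f h_0 expr0n subr0.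
have /cvgrPdist_lt/(_ _ c0)/near_right0E[d d0 Hd] := continuous_right0 cf.
have dp : 0 < d / 2 by rewrite divr_gt0.
have : h (d / 2) < 0 by exact: profile_slope_lt0.
apply/negP; rewrite -leNgt -h_0.
apply: (@der_ge0 _ h f); first exact: ltW.
  by move=> x _; exact: h_der.
move=> x /andP[]; rewrite le_eqVlt => /orP[/eqP <- _|x0 xd]; first by rewrite f0 ltW.
have := Hd _ x0; rewrite f0 => /(_ _)/wrap[]; first by rewrite (le_lt_trans xd)// gtr_pMr// invf_lt1// ltr1n.
by rewrite ltr_norml => /andP[_]; rewrite gtrBl => /ltW.
Qed.

#[local] Lemma cvg_G_ratio : G (Q x) / Q x ^+ 2 @[x --> +oo] --> 0.
Proof.
apply/cvgrPdist_le => e e0; have [d d0 Hd] := little_o e0.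
have [X X0 HX] := Q_small d0; apply/near_pinftyE; exists X => // x /HX/ltW/Hd[_ H].
by rewrite sub0r normrN normrM normfV (ger0_norm (sqr_ge0 _)) ler_pdivrMr// exprn_even_gt0//= profile_neq0.
Qed.

#[local] Lemma cvg_g_ratio : g (Q x) / Q x @[x --> +oo] --> 0.
Proof.
apply/cvgrPdist_le => e e0; have [d d0 Hd] := little_o e0.
have [X X0 HX] := Q_small d0; apply/near_pinftyE; exists X => // x /HX/ltW/Hd[H _].
by rewrite sub0r normrN normrM normfV ler_pdivrMr// normr_gt0 profile_neq0.
Qed.

#[local] Lemma A_ratio x : A x / Q x = g (Q x) / Q x + w.
Proof. by rewrite /A mulrDl mulfK// profile_neq0. Qed.

#[local] Lemma cvg_A_ratio : A x / Q x @[x --> +oo] --> w.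
Proof.
rewrite (_ : (fun x => A x / Q x) = fun x => g (Q x) / Q x + w); last by apply/funext=> x; exact: A_ratio.
by rewrite -[X in _ --> X]add0r; apply: cvgD; [exact: cvg_g_ratio|exact: cvg_cst].
Qed.

#[local] Lemma slope_sq x : h x ^+ 2 = 2 * (G (Q x) / Q x ^+ 2) + w.
Proof. by rewrite /slope expr_div_n first_integral; field; exact: profile_neq0. Qed.

#[local] Lemma cvg_slope_sq : h x ^+ 2 @[x --> +oo] --> w.
Proof.
rewrite (_ : (fun x => h x ^+ 2) = fun x => 2 * (G (Q x) / Q x ^+ 2) + w);
  last by apply/funext=> x; exact: slope_sq.
rewrite -[X in _ --> X]add0r -[X in _ --> X + _](mulr0 2).
by apply: cvgD; [apply: cvgM; [exact: cvg_cst|exact: cvg_G_ratio]|exact: cvg_cst].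
Qed.

(** * Monotonicity of [k] and the resulting dichotomy *)

Hypothesis spectral : forall x, 0 <= 12 * G (Q x) - 7 * Q x * g (Q x) + Q x ^+ 2 * g2 (Q x).

Let k x := 3 * (G (Q x) / Q x ^+ 2) - 2^-1 * (g (Q x) / Q x).

#[local] Lemma k_der x : is_derive x 1 k (- h x / (2 * Q x ^+ 2) *
  (12 * G (Q x) - 7 * Q x * g (Q x) + Q x ^+ 2 * g2 (Q x))).
Proof.
have Q2 : Q x ^+ 2 != 0 by rewrite sqrf_eq0 profile_neq0.
have d1 := @derdiv _ (fun y => G (Q y)) (fun y => Q y ^+ 2) x _ _ Q2
  (der_comp (dG (Q x)) (dQ x)) (derX2 (dQ x)).
have d2 := @derdiv _ (fun y => g (Q y)) Q x _ _ (profile_neq0 x)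
  (der_comp (dg (Q x)) (dQ x)) (dQ x).
rewrite /k; apply: der_eq (derB (derZ 3 d1) (derZ 2^-1 d2)) _.
by rewrite /slope; field; exact: profile_neq0.
Qed.

#[local] Lemma k_nondecreasing x y : 0 <= x -> x <= y -> k x <= k y.
Proof.
move=> x0 xy; apply: (der_ge0 xy (fun z _ => k_der z)) => z /andP[xz _].
rewrite mulr_ge0// mulr_ge0//; last by rewrite invr_ge0 mulr_ge0// sqr_ge0.
move: (le_trans x0 xz); rewrite le_eqVlt => /orP[/eqP <-|z0]; first by rewrite h_0 oppr0.
by rewrite oppr_ge0 ltW// profile_slope_lt0.
Qed.

#[local] Lemma k_infty : k x @[x --> +oo] --> 0.
Proof.
have -> : (0 : R) = 3 * 0 - 2^-1 * 0 by rewrite !mulr0 subrr.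
by apply: cvgB; (apply: cvgM; first exact: cvg_cst); [exact: cvg_G_ratio|exact: cvg_g_ratio].
Qed.

#[local] Lemma k_le0 x : 0 <= x -> k x <= 0.
Proof.
move=> x0; apply: cvgr_to_ge k_infty _; apply/near_pinftyE; exists (x + 1); first lra.
by move=> y xy; apply: k_nondecreasing => //; lra.
Qed.

#[local] Lemma h_derE x : A x / Q x - h x ^+ 2 = 2 * h x ^+ 2 - 2 * w - 2 * k x.
Proof. by rewrite A_ratio slope_sq /k; field; exact: profile_neq0. Qed.

(** As the limit of [h^2], the frequency is nonnegative. If it were 0, then [h' = 2 h^2 - 2 k >= 0]
    because [k <= 0], whence [h 1 >= h 0 = 0], against the sign of [h]. *)
Lemma frequency_gt0 : 0 < w.
Proof.
rewrite lt_neqAle; apply/andP; split; last first.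
  by apply: cvgr_to_ge cvg_slope_sq _; near=> x; exact: sqr_ge0.
apply/eqP => w0; have := profile_slope_lt0 ltr01; apply/negP; rewrite -leNgt.
suff : h 0 <= h 1 by rewrite h_0.
apply: (der_ge0 ler01 (fun z _ => h_der z)) => z /andP[z0 _].
rewrite h_derE -w0 mulr0 subr0 subr_ge0 (@le_trans _ _ 0)//.
  by rewrite pmulr_rle0// k_le0.
by rewrite mulr_ge0// sqr_ge0.
Unshelve. all: by end_near. Qed.

#[local] Lemma slope_infty : h x @[x --> +oo] --> - Num.sqrt w.
Proof.
have H : - Num.sqrt (h x ^+ 2) @[x --> +oo] --> - Num.sqrt w.
  by apply: cvgN; apply: continuous_cvg; [exact: sqrt_continuous|exact: cvg_slope_sq].
apply: cvg_trans H; apply: near_eq_cvg; apply/near_pinftyE; exists 1 => // x x1.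
by rewrite sqrtr_sqr ltr0_norm ?opprK// profile_slope_lt0// (lt_trans _ x1).
Qed.

#[local] Lemma k0E : k 0 = - w - (A 0 / Q 0) / 2.
Proof.
have := h_derE 0; rewrite h_0 expr0n/=; lra.
Qed.

#[local] Lemma excessE x : 2 * h x ^+ 2 - excess Q P A x = 2 * (k x - k 0).
Proof. rewrite /excess /curv k0E; have := h_derE x; lra. Qed.

Lemma profile_coercivity : (exists2 x : R, 0 < x & k 0 < k x) ->
  exists2 K : R, 0 < K & forall v v', (forall b, prim v v' 0 b) ->
  sq Pos v -> sq Pos v' -> \int[mu]_(x in Pos) (Q x * v x) = 0 ->
  \int[mu]_(x in Pos) (v x ^+ 2) <=
    K * \int[mu]_(x in Pos) (v' x ^+ 2 + q x * v x ^+ 2).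
Proof.
move=> [x0 x00 kx0].
apply: (@coercivity _ Q P A q (Num.sqrt w)) => //.
- exact: profile_der.
- exact: profile_cq.
- exact: profile_neq0.
- exact: profile_P0.
- exact: profile_slope_lt0.
- exact: profile_curv_lt0.
- exact: sqPos.
- exact: sqPos.
- by rewrite sqrtr_gt0 frequency_gt0.
- exact: slope_infty.
- by rewrite sqr_sqrtr ?(ltW frequency_gt0)//; exact: cvg_A_ratio.
- exact: profile_q_bounded.
- by move=> x xp; rewrite -subr_ge0 excessE mulr_ge0// subr_ge0 k_nondecreasing// ltW.
- by exists x0 => //; rewrite -subr_gt0 excessE mulr_gt0// subr_gt0.
Qed.

#[local] Lemma k_critical : ~ (exists2 x : R, 0 < x & k 0 < k x) ->
  forall x, 6 * G (Q x) = g (Q x) * Q x.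
Proof.
move=> nk.
have kc x : 0 <= x -> k x = k 0.
  rewrite le_eqVlt => /orP[/eqP <-//|x0]; apply/eqP.
  rewrite eq_le (k_nondecreasing (lexx _) (ltW x0)) andbT leNgt.
  by apply/negP => H; apply: nk; exists x.
have k00 : k 0 = 0.
  have H : k x @[x --> +oo] --> k 0.
    have H0 : (fun x : R => k `|x|) x @[x --> +oo] --> k 0.
      by rewrite (_ : (fun x : R => k `|x|) = fun=> k 0); [exact: cvg_cst|apply/funext => y /=; rewrite kc].
    apply: cvg_trans H0; apply: near_eq_cvg; apply/near_pinftyE; exists 1 => // x x1.
    by rewrite /= ger0_norm// (le_trans _ (ltW x1)).
  by rewrite -(cvg_lim _ H)// (cvg_lim _ k_infty).
move=> x; have := kc `|x| (normr_ge0 x); rewrite k00 /k -even_abs => H.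
have : (2 * Q x ^+ 2) * (3 * (G (Q x) / Q x ^+ 2) - 2^-1 * (g (Q x) / Q x)) = 0 by rewrite H mulr0.
have -> : (2 * Q x ^+ 2) * (3 * (G (Q x) / Q x ^+ 2) - 2^-1 * (g (Q x) / Q x)) = 6 * G (Q x) - g (Q x) * Q x.
  by field; exact: profile_neq0.
by move=> /eqP; rewrite subr_eq0 => /eqP.
Qed.

(** Then [k] is constant on the half-line and equal to its limit 0, that is, [6 G(Q) = Q g(Q)].
    Together with [first_integral] this makes the energy density the derivative of [Q P / 4], which
    vanishes at 0 and at infinity. *)
Lemma critical_energy : ~ (exists2 x : R, 0 < x & k 0 < k x) ->
  2^-1 * \int[mu]_x (P x ^+ 2) + \int[mu]_x G (Q x) = 0.
Proof.
move=> /k_critical cr.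
have mQ : measurable_fun setT Q by case: sQT.
have [L L0 HL] := G_bound.
have iG : ig setT (fun x => G (Q x)).
  apply: (@ig_le _ _ _ (fun x => L * Q x ^+ 2)) => //.
    apply: segint_measurable; apply: segint_cont; apply: continuous_comp' Q_cont.
    by move=> s; exact: der_continuous (dG s).
  by apply: igZ => //; case: sQT.
have iP : ig setT (fun x => P x ^+ 2) by case: sPT.
pose f x := 2^-1 * P x ^+ 2 + G (Q x).
have fI : ig setT f by apply: igD => //; exact: igZ.
have fe x : f (- x) = f x by rewrite /f P_odd sqrrN Q_even.
have fp : ig Pos f by apply: igS fI => //; exact: mPos.
have [_ If] := RI_even fe (ig_meas fI) fp.
have E1 : \int[mu]_x f x = 2^-1 * \int[mu]_x (P x ^+ 2) + \int[mu]_x G (Q x).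
  rewrite /f RintegralD//; last exact: igZ.
  by rewrite RintegralZl.
rewrite -E1 If.
have df x : is_derive x 1 (fun y => 4^-1 * (Q y * P y)) (f x).
  apply: der_eq (derZ 4^-1 (derM (dQ x) (dP x))) _.
  have := cr x; have := first_integral x; rewrite /f /A => H1 H2; lra.
have cf : continuous f.
  apply: continuousD'.
    apply: continuousM'; [exact: cst_continuous|].
    by apply: continuousM'; exact: P_cont.
  by apply: continuous_comp' Q_cont => s; exact: der_continuous (dG s).
have pr a b : prim (fun y => 4^-1 * (Q y * P y)) f a b by exact: prim_deriv.
have c1 := cvg_RI_expanding fp.
have c2 : \int[mu]_(x in expanding n) f x @[n --> \oo] --> 0.
  have -> : (fun n => \int[mu]_(x in expanding n) f x) =
    fun n => 4^-1 * (Q n.+1%:R * P n.+1%:R) - 4^-1 * (Q n.+1%:R^-1 * P n.+1%:R^-1).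
    apply/funext => n; rewrite -(prim_FTC _ (pr _ _))//.
    by rewrite (@le_trans _ _ 1)// ?ler1n// invf_le1// ?ler1n// ltr0n.
  have -> : (0 : R) = 4^-1 * (0 * 0) - 4^-1 * (Q 0 * P 0) by rewrite profile_P0 !mulr0 subr0.
  apply: cvgB; apply: cvgM; try exact: cvg_cst; apply: cvgM.
  - exact: cvg_expanding_pinfty profile_Q_infty.
  - exact: cvg_expanding_pinfty profile_P_infty.
  - apply: cvg_expanding_right0; apply: continuous_right0; exact: Q_cont.
  - apply: cvg_expanding_right0; apply: continuous_right0; exact: P_cont.
by rewrite -(cvg_lim _ c1)// (cvg_lim _ c2)// mulr0.
Qed.

Theorem profile_dichotomy :
  (exists2 K : R, 0 < K & forall v v', (forall b, prim v v' 0 b) ->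
  sq Pos v -> sq Pos v' -> \int[mu]_(x in Pos) (Q x * v x) = 0 ->
  \int[mu]_(x in Pos) (v x ^+ 2) <=
    K * \int[mu]_(x in Pos) (v' x ^+ 2 + (g2 (Q x) + w) * v x ^+ 2)) \/
  2^-1 * \int[mu]_x (P x ^+ 2) + \int[mu]_x G (Q x) = 0.
Proof.
have [kx|/critical_energy] := pselect (exists2 x : R, 0 < x & k 0 < k x); last by right.
by left; exact: profile_coercivity.
Qed.

End Profile.

(** * The modulus of a complex Sobolev function *)

Section Modulus.
Context {R : realType}.
Local Notation mu := (@lebesgue_measure R).
Implicit Types (x y a b e s : R).

Lemma primT_intro (u w : R -> R) : (forall a b, a <= b -> prim u w a b) -> primT u w.
Proof.
move=> H a b; have [|/ltW ba] := leP a b; first exact: H.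
exact: (primS ba ba (H _ _ ba)).
Qed.

#[local] Lemma inner_gt0 e s : 0 < e -> 0 < s ^+ 2 + e.
Proof. by move=> e0; rewrite ltr_wpDl// sqr_ge0. Qed.

(* A C^1 approximation of [sqrt |s|] on the whole line, so that no sign condition
   on [s] enters the chain rule. *)
Definition soft_sqrt e s := Num.sqrt (Num.sqrt (s ^+ 2 + e)).
Definition soft_sqrt' e s := (2 * soft_sqrt e s)^-1 * ((2 * Num.sqrt (s ^+ 2 + e))^-1 * (2 * s)).

#[local] Lemma soft_gt0 e s : 0 < e -> 0 < soft_sqrt e s.
Proof. by move=> e0; rewrite !sqrtr_gt0 inner_gt0. Qed.

Lemma soft_sqrt_der e s : 0 < e -> is_derive s 1 (soft_sqrt e) (soft_sqrt' e s).
Proof.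
move=> e0.
have i0 : 0 < s ^+ 2 + e by exact: inner_gt0.
have d1 : is_derive s 1 (fun t => t ^+ 2 + e) (2 * s).
  by apply: der_eq (derD (derX2 (der_id s)) (der_cst e s)) _; rewrite mulr1 addr0.
have d2 := @der_comp _ _ (fun t => t ^+ 2 + e) s _ _ (is_derive1_sqrt i0) d1.
have i1 : 0 < Num.sqrt (s ^+ 2 + e) by rewrite sqrtr_gt0.
exact: (@der_comp _ _ (fun t => Num.sqrt (t ^+ 2 + e)) s _ _ (is_derive1_sqrt i1) d2).
Qed.

Lemma soft_sqrt'_continuous e : 0 < e -> continuous (soft_sqrt' e).
Proof.
move=> e0; change (forall s : R, {for s, continuous (soft_sqrt' e)}) => s; rewrite /soft_sqrt'.
have cid : {for s, continuous (fun t : R => t)} by exact: cvg_id.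
have c1 : {for s, continuous (fun t : R => Num.sqrt (t ^+ 2 + e))}.
  apply: continuous_comp; last exact: sqrt_continuous.
  apply: cvgD; last exact: cvg_cst.
  by apply: cvgM; exact: cid.
apply: cvgM.
  apply: cvgV; first by rewrite mulf_neq0 ?pnatr_eq0// gt_eqF// soft_gt0.
  by apply: cvgM; [exact: cvg_cst|exact: der_continuous (soft_sqrt_der s e0)].
apply: cvgM.
  apply: cvgV; first by rewrite mulf_neq0 ?pnatr_eq0// gt_eqF// sqrtr_gt0 inner_gt0.
  by apply: cvgM; [exact: cvg_cst|exact: c1].
by apply: cvgM; [exact: cvg_cst|exact: cid].
Qed.

(** A bound independent of [e]: it dominates the densities of the approximations of the modulus by
    [|w1| + |w2|]. *)
Lemma soft_sqrt'_bound e s : 0 < e -> 0 <= s ->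
  0 <= soft_sqrt' e s /\ soft_sqrt' e s * (2 * Num.sqrt s) <= 1.
Proof.
move=> e0 s0.
have i0 : 0 < Num.sqrt (s ^+ 2 + e) by rewrite sqrtr_gt0 inner_gt0.
have F0 := soft_gt0 s e0.
have si : s <= Num.sqrt (s ^+ 2 + e).
  by rewrite -[leLHS](ger0_norm s0) -sqrtr_sqr ler_sqrt ?lerDl ?ltW// inner_gt0.
have sF : Num.sqrt s <= soft_sqrt e s by rewrite ler_sqrt// ltW.
split; first by rewrite !mulr_ge0// invr_ge0 mulr_ge0// ltW.
have -> : soft_sqrt' e s * (2 * Num.sqrt s) =
    (s / Num.sqrt (s ^+ 2 + e)) * (Num.sqrt s / soft_sqrt e s).
  by rewrite /soft_sqrt'; field; rewrite !gt_eqF.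
apply: mulr_ile1; rewrite ?ler_pdivrMr// ?mul1r//; first exact: divr_ge0 s0 (ltW i0).
exact: divr_ge0 (sqrtr_ge0 _) (ltW F0).
Qed.

#[local] Notation eps := (fun n : nat => n.+1%:R^-1 : R).

#[local] Lemma eps_gt0 n : 0 < eps n. Proof. by rewrite invr_gt0 ltr0n. Qed.

#[local] Lemma cvg_inner s : 0 <= s -> Num.sqrt (s ^+ 2 + eps n) @[n --> \oo] --> s.
Proof.
move=> s0; rewrite -[X in _ --> X](ger0_norm s0) -sqrtr_sqr.
apply: continuous_cvg; first exact: sqrt_continuous.
by rewrite -[X in _ --> X]addr0; apply: cvgD; [exact: cvg_cst|exact: cvg_harmonic].
Qed.

Lemma soft_sqrt_cvg s : 0 <= s -> soft_sqrt (eps n) s @[n --> \oo] --> Num.sqrt s.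
Proof.
by move=> s0; apply: continuous_cvg; [exact: sqrt_continuous|exact: cvg_inner].
Qed.

Lemma soft_sqrt'_cvg s : 0 <= s -> soft_sqrt' (eps n) s @[n --> \oo] --> (2 * Num.sqrt s)^-1.
Proof.
(* At [s = 0] both the sequence and the limit are 0, the inverse of 0 being 0. *)
rewrite le_eqVlt => /orP[/eqP <-|s0].
  rewrite sqrtr0 mulr0 invr0 /soft_sqrt' mulr0.
  by rewrite (_ : (fun n => _) = fun=> 0); [exact: cvg_cst|apply/funext => n; rewrite !mulr0].
have -> : (2 * Num.sqrt s)^-1 = (2 * Num.sqrt s)^-1 * ((2 * s)^-1 * (2 * s)).
  by rewrite mulVf ?mulr1// mulf_neq0// gt_eqF.
apply: cvgM.
  apply: cvgV; first by rewrite mulf_neq0// gt_eqF// sqrtr_gt0.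
  by apply: cvgM; [exact: cvg_cst|exact: soft_sqrt_cvg (ltW s0)].
apply: cvgM; last exact: cvg_cst.
apply: cvgV; first by rewrite mulf_neq0// gt_eqF.
by apply: cvgM; [exact: cvg_cst|exact: cvg_inner (ltW s0)].
Qed.

Variables (u1 w1 u2 w2 : R -> R).
Hypothesis p1 : primT u1 w1.
Hypothesis p2 : primT u2 w2.

Definition modulus x := Num.sqrt (u1 x ^+ 2 + u2 x ^+ 2).
(** On the zeros of [modulus] the quotient is 0 by the convention on division, which is an
    admissible value for the density there. *)
Definition modulus' x := (u1 x * w1 x + u2 x * w2 x) / modulus x.

Let r x := u1 x ^+ 2 + u2 x ^+ 2.
#[local] Lemma r_ge0 x : 0 <= r x. Proof. by rewrite addr_ge0 ?sqr_ge0. Qed.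

#[local] Lemma prim_soft e a b : 0 < e -> a <= b ->
  prim (fun x => soft_sqrt e (r x)) (fun x => soft_sqrt' e (r x) * (2 * (u1 x * w1 x + u2 x * w2 x))) a b.
Proof.
move=> e0 ab.
have P : prim r (fun x => 2 * (u1 x * w1 x + u2 x * w2 x)) a b.
  apply: prim_ext (primD (primM ab (p1 a b) (p1 a b)) (primM ab (p2 a b) (p2 a b))) => x _.
    by rewrite /r !expr2.
  by ring.
exact: prim_comp ab P (fun s => soft_sqrt_der s e0) (soft_sqrt'_continuous e0).
Qed.

#[local] Lemma abs_le_modulus x : `|u1 x| <= modulus x /\ `|u2 x| <= modulus x.
Proof.
by split; rewrite -sqrtr_sqr ler_sqrt ?r_ge0// ?lerDl ?lerDr sqr_ge0.
Qed.

(** The diamagnetic inequality: Cauchy-Schwarz in the plane, with [u1 w2 - u2 w1] as the defect. *)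
Lemma modulus'_sq x : modulus' x ^+ 2 <= w1 x ^+ 2 + w2 x ^+ 2.
Proof.
have [m0|m0] := eqVneq (modulus x) 0.
  by rewrite /modulus' m0 invr0 mulr0 expr0n addr_ge0 ?sqr_ge0.
have m2 : 0 < modulus x ^+ 2 by rewrite exprn_even_gt0.
rewrite /modulus' expr_div_n ler_pdivrMr// sqr_sqrtr; last exact: r_ge0.
by have := sqr_ge0 (u1 x * w2 x - u2 x * w1 x); lra.
Qed.

(** The chain rule holds for the softened roots of [u1^2 + u2^2]; dominated convergence on each
    segment passes it to the limit, including across the zeros of the modulus. *)
Lemma primT_modulus : primT modulus modulus'.
Proof.
apply: primT_intro => a b ab.
pose f n x := soft_sqrt' (eps n) (r x) * (2 * (u1 x * w1 x + u2 x * w2 x)).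
have pf n : prim (fun x => soft_sqrt (eps n) (r x)) (f n) a b by exact: prim_soft (eps_gt0 n) ab.
have key x y : a <= x -> y <= b -> ig `[x, y] modulus' /\
    \int[mu]_(t in `[x, y]) f n t @[n --> \oo] --> \int[mu]_(t in `[x, y]) modulus' t.
  move=> ax yb.
  have mf n : measurable_fun `[x, y] (f n) by apply: ig_meas; apply: igcc ax yb _; case: (pf n).
  have cf z : f n z @[n --> \oo] --> modulus' z.
    have -> : modulus' z = (2 * Num.sqrt (r z))^-1 * (2 * (u1 z * w1 z + u2 z * w2 z)).
      rewrite /modulus' -/(r z) -/(modulus z).
      have [->|m0] := eqVneq (modulus z) 0; first by rewrite mulr0 invr0 mulr0 mul0r.
      by field.
    by apply: cvgM; [exact: soft_sqrt'_cvg (r_ge0 z)|exact: cvg_cst].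
  apply: (@cvg_RI_dominated _ _ _ _ (fun z => `|w1 z| + `|w2 z|)) => //.
  - by apply: (measurable_fun_cvg mf) => z _; exact: cf.
  - move=> n z _; have [d0 d1] := soft_sqrt'_bound (eps_gt0 n) (r_ge0 z).
    rewrite /f normrM (ger0_norm d0).
    have [l1 l2] := abs_le_modulus z.
    have H : `|2 * (u1 z * w1 z + u2 z * w2 z)| <= (2 * modulus z) * (`|w1 z| + `|w2 z|).
      rewrite normrM ger0_norm// -mulrA ler_pM2l// (le_trans (ler_normD _ _))// !normrM mulrDr.
      by rewrite lerD// ler_wpM2r.
    rewrite (le_trans (ler_wpM2l d0 H))// mulrA -[leRHS]mul1r ler_wpM2r// addr_ge0//.
  - by apply: igD => //; apply: ig_norm => //; [exact: (p1 x y).1|exact: (p2 x y).1].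
split; first by have [] := key a b (lexx _) (lexx _).
move=> x y ax xy yb; have [_ c1] := key x y ax yb.
have c2 : \int[mu]_(t in `[x, y]) f n t @[n --> \oo] --> modulus y - modulus x.
  rewrite (_ : (fun n => _) = fun n => soft_sqrt (eps n) (r y) - soft_sqrt (eps n) (r x)).
    by apply: cvgB; apply: soft_sqrt_cvg; exact: r_ge0.
  by apply/funext => n; have [_ ->] := pf n.
by rewrite -(cvg_lim _ c1)// -(cvg_lim _ c2).
Qed.

End Modulus.

(** * Reflection at a half-mass point *)

Section Reflection.
Context {R : realType}.
Local Notation mu := (@lebesgue_measure R).
Implicit Types (x y a b e s : R).

Lemma primitive_cvg (F f : R -> R) : primT F f -> ig Pos f -> (forall x, 0 <= f x) ->
  F x @[x --> +oo] --> F 0 + \int[mu]_(x in Pos) f x.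
Proof.
move=> Ff fI f0; set I := \int[mu]_(x in Pos) f x.
have mono x y : x <= y -> F x <= F y.
  move=> xy; rewrite -subr_ge0 (prim_FTC xy (Ff x y)).
  by apply: Rintegral_ge0 => z _; exact: f0.
have c1 : F n.+1%:R @[n --> \oo] --> F 0 + I.
  have -> : (fun n : nat => F n.+1%:R) = fun n => \int[mu]_(x in expanding n) f x + F n.+1%:R^-1.
    apply/funext => n; rewrite -(prim_FTC _ (Ff _ _)) ?subrK//.
    by rewrite (@le_trans _ _ 1)// ?ler1n// invf_le1// ?ler1n// ltr0n.
  rewrite addrC; apply: cvgD; first exact: cvg_RI_expanding.
  by apply: cvg_expanding_right0; apply: continuous_right0; exact: primT_continuous Ff _.
have up x : F x <= F 0 + I.
  apply: cvgr_to_ge c1 _; exists (Num.truncn x).+1 => // n /= xn; apply: mono.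
  rewrite (le_trans (ltW (truncnS_gt x)))// ler_nat ltnW// ltnS.
apply/cvgrPdist_lt => e e0.
move/cvgrPdist_lt : (c1) => /(_ e e0)[N _ HN].
apply/near_pinftyE; exists N.+1%:R => // x xN.
rewrite ger0_norm ?subr_ge0//; have := HN N (leqnn N).
rewrite ger0_norm ?subr_ge0//; apply: le_lt_trans; rewrite lerD2l lerN2; apply: mono; exact: ltW.
Qed.

(** Both sides are the limit of [F (a + x) - F a] as [x] tends to infinity. *)
Lemma RI_Pos_shift (F f : R -> R) a : primT F f -> ig setT f -> (forall x, 0 <= f x) ->
  \int[mu]_(x in Pos) f (a + x) = F 0 + \int[mu]_(x in Pos) f x - F a.
Proof.
move=> Ff fI f0.
have mP := @mPos R.
have c1 := primitive_cvg Ff (igS mP measurableT (@subsetT _ _) fI) f0.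
have [fa _] := RI_shift a fI.
have c2 := primitive_cvg (primT_shift a Ff) (igS mP measurableT (@subsetT _ _) fa) (fun x => f0 (a + x)).
have c3 : F (a + x) @[x --> +oo] --> F 0 + \int[mu]_(x in Pos) f x.
  apply/cvgrPdist_lt => e e0; move/cvgrPdist_lt : c1 => /(_ e e0)/near_pinftyE[X X0 H].
  apply/near_pinftyE; exists (X + `|a|) => [|x xX]; first by rewrite ltr_wpDr.
  by apply: H; have := ler_norm (- a); rewrite normrN; lra.
have : F 0 + \int[mu]_(x in Pos) f x = F (a + 0) + \int[mu]_(x in Pos) f (a + x).
  by rewrite -(cvg_lim _ c3)// (cvg_lim _ c2).
by rewrite addr0; lra.
Qed.

Lemma half_mass_point (f : R -> R) : continuous f -> ig setT f -> (forall x, 0 <= f x) ->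
  0 < \int[mu]_x f x -> exists a, \int[mu]_(x in Pos) f (a + x) = 2^-1 * \int[mu]_x f x.
Proof.
move=> cf fI f0 If.
have Ff := primitive_primT (segint_cont cf); set F := primitive f in Ff.
have mP := @mPos R.
have [f1 f2 E] := RI_comp_opp_Pos fI.
have c1 := primitive_cvg Ff f1 f0.
have pFo : primT (fun x => - F (- x)) (fun x => f (- x)).
  move=> a b; apply: prim_ext (primZ (-1) (prim_opp (Ff (- b) (- a)))) => x _; lra.
have c2 := primitive_cvg pFo f2 (fun x => f0 (- x)).
rewrite oppr0 in c2.
set I1 := \int[mu]_(x in Pos) f x in E c1; set I2 := \int[mu]_(x in Pos) f (- x) in E c2.
have If2 : 0 < (I1 + I2) / 2 by rewrite -E divr_gt0.
move/cvgrPdist_lt : (c1) => /(_ _ If2)/near_pinftyE[X X0 HX].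
move/cvgrPdist_lt : (c2) => /(_ _ If2)/near_pinftyE[Y Y0 HY].
have {}HX := HX (X + 1) _; have {}HY := HY (Y + 1) _.
have /HX : X < X + 1 by lra.
have /HY : Y < Y + 1 by lra.
rewrite !ltr_norml => /andP[_ h2] /andP[_ h1].
have XY : - (Y + 1) <= X + 1 by lra.
have cF : {within `[- (Y + 1), X + 1], continuous F}.
  by apply: continuous_subspaceT; exact: primT_continuous Ff.
(* The mass to the right of [a] is [I1 - (F a - F 0)]; it equals half of [I1 + I2] exactly when
   [F a] is this value. *)
have mid : Num.min (F (- (Y + 1))) (F (X + 1)) <= F 0 + (I1 - I2) / 2 <=
    Num.max (F (- (Y + 1))) (F (X + 1)).
  by rewrite ge_min le_max; apply/andP; split; apply/orP; [left|right]; lra.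
have [a _ Fa] := IVT XY cF mid.
by exists a; rewrite (RI_Pos_shift a Ff fI f0) Fa E -/I1; lra.
Qed.

Lemma sq_opp (v : R -> R) : sq setT v -> sq setT (fun x => v (- x)).
Proof.
move=> [mv iv]; have [iv' _] := RI_opp iv; split => //.
apply: (measurableT_comp mv); exact: oppr_measurable.
Qed.

Lemma sq_shift a (v : R -> R) : sq setT v -> sq setT (fun x => v (a + x)).
Proof.
move=> [mv iv]; have [iv' _] := RI_shift a iv; split => //.
by apply: (measurableT_comp mv); apply: measurable_funD => //; exact: measurable_cst.
Qed.

Lemma H1_bounded (u w : R -> R) : primT u w -> sq setT u -> sq setT w ->
  exists2 B : R, 0 < B & forall x, `|u x| <= B.
Proof.
move=> p su sw; have mP := @mPos R.
have half (v v' : R -> R) : primT v v' -> sq setT v -> sq setT v' ->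
    exists2 M : R, 0 < M & forall x, 0 < x -> `|v x| <= M.
  move=> pv sv sv'; have cv : continuous v by exact: primT_continuous pv.
  apply: bounded_Pos => [x _||]; first exact: cv.
    by apply: cvg_bounded; apply: continuous_right0; exact: cv.
  apply: cvg_bounded; apply: (@sq_cvg0 _ v v') => //; [exact: sqS sv|exact: sqS sv'].
have [B B0 HB] := half _ _ p su sw.
have po : primT (fun x => u (- x)) (fun x => - w (- x)) by move=> a b; exact: prim_opp (p _ _).
have [C C0 HC] := half _ _ po (sq_opp su) (sqN measurableT (sq_opp sw)).
exists (B + C + `|u 0|) => [|x]; first by rewrite ltr_wpDr// addr_gt0.
case: (ltgtP x 0) => [x0|x0|->]; last by rewrite lerDr addr_ge0// ltW.
- rewrite -[x in u x]opprK (le_trans (HC (- x) _)) ?oppr_gt0//.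
  by rewrite addrAC lerDr addr_ge0// ltW.
- by rewrite (le_trans (HB x x0))// -addrA lerDl addr_ge0// ltW.
Qed.

Variables (G : R -> R) (lam : R).
Hypothesis cG : continuous G.
Hypothesis G_quadratic : forall B, 0 < B ->
  exists2 L : R, 0 < L & forall s, `|s| <= B -> `|G s| <= L * s ^+ 2.

Lemma potential_ig (u w : R -> R) : primT u w -> sq setT u -> sq setT w ->
  ig setT (fun x => G (u x)).
Proof.
move=> p su sw; have [B B0 HB] := H1_bounded p su sw; have [L L0 HL] := G_quadratic B0.
apply: (@ig_le _ _ _ (fun x => L * u x ^+ 2)) => //.
- apply: segint_measurable; apply: segint_cont; apply: continuous_comp' cG _.
  exact: primT_continuous p.
- by move=> x _; exact: HL.
- by apply: igZ => //; case: su.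
Qed.

Hypothesis even_energy_ge0 : forall u, H1r u -> \int[mu]_x (u x ^+ 2) = lam ->
  0 <= 2^-1 * \int[mu]_x (wD u x ^+ 2) + \int[mu]_x G (u x).

#[local] Lemma oddify_sq (w : R -> R) x : oddify w (- x) ^+ 2 = oddify w x ^+ 2.
Proof.
rewrite /oddify oppr_ge0 opprK; case: ltgtP => [x0|x0|->]; last by rewrite oppr0.
- by rewrite sqrrN.
- by rewrite sqrrN.
Qed.

(** Even reflection doubles the mass, the kinetic part and the potential part alike, so the
    hypothesis on even functions of mass [lam] applies to [evenify u]. *)
#[local] Lemma half_line_energy (u w : R -> R) : primT u w -> sq setT u -> sq setT w ->
  \int[mu]_(x in Pos) (u x ^+ 2) = 2^-1 * lam ->
  0 <= 2^-1 * \int[mu]_(x in Pos) (w x ^+ 2) + \int[mu]_(x in Pos) G (u x).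
Proof.
move=> p su sw Iu; have mP := @mPos R.
have pe := primT_evenify (p 0).
have iG := potential_ig p su sw.
have even (h k : R -> R) : measurable_fun setT h -> (forall x, h (- x) = h x) ->
    (forall x, 0 < x -> h x = k x) -> ig setT k ->
    ig setT h /\ \int[mu]_x h x = 2 * \int[mu]_(x in Pos) k x.
  move=> mh eh hk kI.
  have hI : ig Pos h by apply: (@ig_eq _ Pos k) => // [x /PosE/hk//|]; exact: igS kI.
  have [h1 h2] := RI_even eh mh hI; split => //; rewrite h2; congr (_ * _).
  by apply: eq_Rintegral => x /[!inE] /PosE/hk.
have mo : measurable_fun setT (oddify w) by apply: segint_measurable; exact: primT_segint pe.
have ce : continuous (evenify u) := primT_continuous pe.
have me : measurable_fun setT (evenify u) by apply: segint_measurable; exact: segint_cont.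
have [ve ie] : ig setT (fun x => evenify u x ^+ 2) /\
    \int[mu]_x (evenify u x ^+ 2) = 2 * \int[mu]_(x in Pos) (u x ^+ 2).
  apply: even; [exact: measurable_funX|by move=> x; rewrite evenify_even| |by case: su].
  by move=> x x0; rewrite /evenify gtr0_norm.
have [vo io] : ig setT (fun x => oddify w x ^+ 2) /\
    \int[mu]_x (oddify w x ^+ 2) = 2 * \int[mu]_(x in Pos) (w x ^+ 2).
  apply: even; [exact: measurable_funX|by move=> x; rewrite oddify_sq| |by case: sw].
  by move=> x x0; rewrite /oddify ltW.
have [vg ig'] : ig setT (fun x => G (evenify u x)) /\
    \int[mu]_x G (evenify u x) = 2 * \int[mu]_(x in Pos) G (u x).
  apply: even => //; last 2 first.
  - by move=> x; rewrite evenify_even.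
  - by move=> x x0; rewrite /evenify gtr0_norm.
  by apply: segint_measurable; apply: segint_cont; exact: continuous_comp'.
have Hr : H1r (evenify u).
  by split; [exact: (H1_intro pe)|exact: evenify_even].
have := even_energy_ge0 Hr; rewrite ie Iu (RI_wD2 pe) io ig' => H.
have : 0 <= 2^-1 * (2 * \int[mu]_(x in Pos) w x ^+ 2) + 2 * \int[mu]_(x in Pos) G (u x).
  by apply: H; field.
lra.
Qed.

Lemma nonneg_energy (g w : R -> R) : 0 < lam -> primT g w -> sq setT g -> sq setT w ->
  \int[mu]_x (g x ^+ 2) = lam ->
  0 <= 2^-1 * \int[mu]_x (w x ^+ 2) + \int[mu]_x G (g x).
Proof.
move=> lam0 p sg sw Ig; have mP := @mPos R.
have cg : continuous g := primT_continuous p.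
have ig2 : ig setT (fun x => g x ^+ 2) by case: sg.
have [||a Ia] := @half_mass_point (fun x => g x ^+ 2) _ ig2 (fun x => sqr_ge0 _).
- by move=> x; apply: cvgM; exact: cg.
- by rewrite Ig.
have ps := primT_shift a p.
have sgs := sq_shift a sg; have sws := sq_shift a sw.
have pr : primT (fun x => g (a + - x)) (fun x => - w (a + - x)).
  by move=> c d; exact: prim_opp (ps _ _).
have iw2 : ig setT (fun x => w x ^+ 2) by case: sw.
have iG := potential_ig p sg sw.
have both (f : R -> R) : ig setT f -> \int[mu]_x f x =
    \int[mu]_(x in Pos) f (a + x) + \int[mu]_(x in Pos) f (a + - x).
  by move=> fI; have [i1 <-] := RI_shift a fI; have [] := RI_comp_opp_Pos i1.
have E1 := half_line_energy ps sgs sws.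
have E2 := half_line_energy pr (sq_opp sgs) (sqN measurableT (sq_opp sws)).
have := both _ ig2; rewrite Ia Ig => Ib.
have {}E1 := E1 (etrans Ia _); rewrite Ig in E1; have {}E1 := E1 erefl.
have {}E2 : 0 <= 2^-1 * \int[mu]_(x in Pos) (w (a + - x) ^+ 2) + \int[mu]_(x in Pos) G (g (a + - x)).
  have -> : \int[mu]_(x in Pos) (w (a + - x) ^+ 2) = \int[mu]_(x in Pos) ((- w (a + - x)) ^+ 2).
    by apply: eq_Rintegral => x _; rewrite sqrrN.
  by apply: E2; lra.
rewrite (both _ iw2) (both _ iG); lra.
Qed.

End Reflection.

(** * Energies of real and complex functions *)

Section Bridges.
Context {R : realType}.
Local Notation mu := (@lebesgue_measure R).
Implicit Types (x y a b s : R).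

Lemma normc_sq (z : R[i]) : Normc.normc z ^+ 2 = complex.Re z ^+ 2 + complex.Im z ^+ 2.
Proof. by case: z => a b /=; rewrite sqr_sqrtr// addr_ge0// sqr_ge0. Qed.

Lemma normc_modulus (u : R -> R[i]) x :
  Normc.normc (u x) = modulus (fun y => complex.Re (u y)) (fun y => complex.Im (u y)) x.
Proof. by rewrite /modulus; case: (u x). Qed.

Lemma normc_real s : Normc.normc (s%:C) = `|s|.
Proof. by rewrite /= expr0n addr0 sqrtr_sqr. Qed.

Lemma H1_zero : H1 (fun=> 0 : R).
Proof.
have z : sq setT (fun=> 0 : R).
  by split; [exact: measurable_cst|apply: (@ig_eq _ _ (fun=> 0)) => [//|x _|]; [rewrite expr0n|exact: ig0]].
by apply: (@H1_intro _ _ (fun=> 0)) => // a b; exact: prim_cst.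
Qed.

Lemma H1C_toC (v : R -> R) : H1 v -> H1C (toC v).
Proof. by move=> hv; split; [exact: hv|exact: H1_zero]. Qed.

Lemma mass_toC (v : R -> R) : mass (toC v) = \int[mu]_x (v x ^+ 2).
Proof.
by apply: eq_Rintegral => x _; rewrite normc_sq /= expr0n addr0.
Qed.

Lemma kinetic_toC (v : R -> R) : H1 v ->
  \int[mu]_x (Normc.normc (wDC (toC v) x) ^+ 2) = \int[mu]_x (wD v x ^+ 2).
Proof.
move=> /H1_elim[pv _ [mv _]].
(* The weak derivative chosen for the imaginary part, the zero function, is known to vanish only
   almost everywhere. *)
have [z0 p0] := wD_ae (fun a b => @prim_cst R 0 a b : prim (fun=> 0) (fun=> 0) a b).
have m0 : measurable_fun setT (wD (fun=> 0 : R)) by apply: segint_measurable; exact: primT_segint p0.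
under eq_Rintegral do rewrite normc_sq /=.
apply: RI_ae => //.
- by apply: ae_imp z0 => x <-; rewrite expr0n addr0.
- by apply: measurable_funD; exact: measurable_funX.
- exact: measurable_funX.
Qed.

Lemma energy_toC (G : R -> R) (v : R -> R) : (forall s, G (- s) = G s) -> H1 v ->
  energy G (toC v) = 2^-1 * \int[mu]_x (wD v x ^+ 2) + \int[mu]_x G (v x).
Proof.
move=> Ge hv; rewrite /energy kinetic_toC//; congr (_ + _).
apply: eq_Rintegral => x _; rewrite /potential normc_real.
by case: ler0P.
Qed.

(** Gauge invariance with [z = -1] makes [f] odd, hence its primitive even. Evenness identifies
    [G |v|], which enters the energy, with [G v] for real [v]. *)
Lemma gauge_even (f : R[i] -> R[i]) (G : R -> R) :
  (forall s z : R[i], `|z| = 1 -> f (z * s) = z * f s) ->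
  (forall x, is_derive x 1 G (complex.Re (f x%:C))) -> forall s, G (- s) = G s.
Proof.
move=> fg dG.
have odd x : complex.Re (f (- x)%:C) = - complex.Re (f x%:C).
  have -> : (- x)%:C = -1 * x%:C by rewrite mulN1r rmorphN.
  by rewrite fg ?normrN1// mulN1r; case: (f _).
have d x : is_derive x 1 (fun y => G (- y) - G y) 0.
  apply: der_eq (derB (der_comp (dG (- x)) (derN (der_id x))) (dG x)) _.
  by rewrite odd; ring.
move=> s; have := der0_cst d s 0; rewrite oppr0 subrr => /eqP.
by rewrite subr_eq0 => /eqP.
Qed.

Lemma primT_ae (u w w' : R -> R) : primT u w -> {ae mu, forall x, w x = w' x} -> segint w' ->
  primT u w'.
Proof.
move=> p e sw a b; split; first exact: sw.
move=> x y ax xy yb; rewrite (prim_FTC xy (p x y)); apply: RI_ae => //.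
  exact: ig_meas (p x y).1.
exact: ig_meas (sw x y).
Qed.

(** Regularity bootstrap: the weak equation gives [wD Q] an absolutely continuous representative
    [P], whose continuity makes [Q] continuously differentiable; the right-hand side is then
    continuous and [P] is differentiable everywhere. *)
Lemma solves_profile (G : R -> R) (w : R) (Q : R -> R) : continuous (derive1 G) -> H1 Q -> solves G w Q ->
  exists P, [/\ forall x, is_derive x 1 Q (P x),
    forall x, is_derive x 1 P (derive1 G (Q x) + w * Q x),
    {ae mu, forall x, wD Q x = P x} & sq setT P].
Proof.
move=> cg /H1_elim[pQ sQ sD] /weak_deriv_primT[P pP e].
have cP := primT_continuous pP; have cQ := primT_continuous pQ.
exists P; split => //.
- move=> x; apply: primT_der => //.
  by apply: primT_ae pQ e _; exact: segint_cont.
- move=> x; apply: (primT_der (w := fun x => derive1 G (Q x) + w * Q x)) => //.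
  apply: continuousD'; first exact: continuous_comp'.
  by apply: continuousM' => //; exact: cst_continuous.
- by apply: sq_ae sD => //; apply: segint_measurable; exact: segint_cont.
Qed.

(** Passing to the modulus preserves the mass and the potential term and does not increase the
    kinetic term. *)
Lemma energy_ge0 (G : R -> R) (lam : R) (u : R -> R[i]) : continuous G ->
  (forall B, 0 < B -> exists2 L : R, 0 < L & forall s, `|s| <= B -> `|G s| <= L * s ^+ 2) ->
  (forall v, H1r v -> \int[mu]_x (v x ^+ 2) = lam ->
    0 <= 2^-1 * \int[mu]_x (wD v x ^+ 2) + \int[mu]_x G (v x)) ->
  0 < lam -> mass_sphere lam u -> 0 <= energy G u.
Proof.
move=> cG Gq Hv lam0 [[h1 h2] um].
have [p1 s1 t1] := H1_elim h1; have [p2 s2 t2] := H1_elim h2.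
have pm := primT_modulus p1 p2.
set g := modulus _ _ in pm; set g' := modulus' _ _ _ _ in pm.
have gE x : Normc.normc (u x) = g x by exact: normc_modulus.
have g2E x : g x ^+ 2 = complex.Re (u x) ^+ 2 + complex.Im (u x) ^+ 2 by rewrite -gE normc_sq.
have mg : measurable_fun setT g by apply: segint_measurable; apply: segint_cont; exact: primT_continuous pm.
have mg' : measurable_fun setT g' by apply: segint_measurable; exact: primT_segint pm.
have sg : sq setT g.
  split => //; apply: (@ig_eq _ _ (fun x => complex.Re (u x) ^+ 2 + complex.Im (u x) ^+ 2)) => //.
  by apply: igD => //; [case: s1|case: s2].
have iD : ig setT (fun x => wD (fun y => complex.Re (u y)) x ^+ 2 + wD (fun y => complex.Im (u y)) x ^+ 2).
  by apply: igD => //; [case: t1|case: t2].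
have le x : g' x ^+ 2 <= wD (fun y => complex.Re (u y)) x ^+ 2 + wD (fun y => complex.Im (u y)) x ^+ 2.
  exact: modulus'_sq.
have sg' : sq setT g'.
  split => //; apply: ig_le iD => //; first exact: measurable_funX.
  by move=> x _; rewrite ger0_norm ?sqr_ge0.
have Ig : \int[mu]_x (g x ^+ 2) = lam by rewrite -um; apply: eq_Rintegral => x _; rewrite gE.
have H := nonneg_energy cG Gq Hv lam0 pm sg sg' Ig.
rewrite /energy (le_trans H)// lerD//; last first.
  by rewrite le_eqVlt; apply/orP; left; apply/eqP; apply: eq_Rintegral => x _; rewrite /potential gE.
rewrite ler_wpM2l//.
have -> : \int[mu]_x (Normc.normc (wDC u x) ^+ 2) =
  \int[mu]_x (wD (fun y => complex.Re (u y)) x ^+ 2 + wD (fun y => complex.Im (u y)) x ^+ 2).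
  by apply: eq_Rintegral => x _; rewrite normc_sq.
by apply: le_Rintegral => //; case: sg'.
Qed.

Lemma Lnorm2_eq1 (v : R -> R) : 'N[mu]_2%:E[EFin \o v]%E = 1%E -> \int[mu]_x (v x ^+ 2) = 1.
Proof.
move=> N1; have n2 : (2 : R) != 0 by [].
have := poweR_Lnorm mu (EFin \o v) n2; rewrite N1 poweR1r => E.
rewrite /Rintegral -[RHS](_ : fine 1%E = 1)// E; congr fine; apply: eq_integral => x _ /=.
by rewrite -[2 in RHS]/(2%:R) powR_mulrn// real_normK// num_real.
Qed.

End Bridges.

(** * From half-line coercivity to non-degeneracy on the line *)

Lemma coercive_nondegenerate (R : realType) (G : R -> R) (w K B : R) (Q : R -> R) :
  continuous (derive1n 2 G) -> continuous Q -> (forall x, Q (- x) = Q x) ->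
  sq setT Q -> (forall x, `|Q x| <= B) -> 0 < K ->
  (forall v v' : R -> R, (forall b, prim v v' 0 b) -> sq Pos v -> sq Pos v' ->
    \int[@lebesgue_measure R]_(x in Pos) (Q x * v x) = 0 ->
    \int[@lebesgue_measure R]_(x in Pos) (v x ^+ 2) <=
    K * \int[@lebesgue_measure R]_(x in Pos) (v' x ^+ 2 + (derive1n 2 G (Q x) + w) * v x ^+ 2)) ->
  nondegenerate_min G w Q.
Proof.
set mu := @lebesgue_measure R; move=> cG2 cQ Qe sQ QB K0 H.
have mP := @mPos R.
have toPos (u : R -> R) : sq setT u -> sq Pos u by apply: sqS.
(* The Hessian is bounded below by [1/K]: a normalised even [v] has squared norm [1/2] on each
   half-line, so each half contributes at least [1/(2 K)]. *)
rewrite /nondegenerate_min (@lt_le_trans _ _ (K^-1)%:E)//; first by rewrite lte_fin invr_gt0.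
apply/ereal_infP => _ [v [[[hv ve] vQ] vN] <-]; rewrite lee_fin.
have [pv sv sv'] := H1_elim hv.
set v' := wD v in pv sv'.
have cv := primT_continuous pv.
have Iv := Lnorm2_eq1 vN.
have half (u : R -> R) : (forall x, u (- x) = u x) -> ig setT u ->
    \int[mu]_x u x = 2 * \int[mu]_(x in Pos) u x.
  move=> ue iu; have iuP : ig Pos u by exact: igS iu.
  by have [_] := RI_even ue (ig_meas iu) iuP.
have iv : ig setT (fun x => v x ^+ 2) by case: sv.
have Iv2 : \int[mu]_(x in Pos) (v x ^+ 2) = 2^-1.
  by have := half _ (fun x => congr1 (fun y => y ^+ 2) (ve x)) iv; rewrite Iv; lra.
have IQv : \int[mu]_(x in Pos) (Q x * v x) = 0.
  have e x : Q (- x) * v (- x) = Q x * v x by rewrite Qe ve.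
  have := half _ e (sqM measurableT sQ sv).
  rewrite (_ : \int[mu]_x (Q x * v x) = 0); first by lra.
  by rewrite -vQ; apply: eq_Rintegral => x _; rewrite mulrC.
pose q x := derive1n 2 G (Q x) + w.
have cq : continuous q.
  by apply: continuousD'; [exact: continuous_comp'|exact: cst_continuous].
have mq : measurable_fun setT q by apply: segint_measurable; exact: segint_cont.
have [M M0 HM] : exists2 M : R, 0 < M & forall s, - B <= s <= B -> `|derive1n 2 G s| <= M.
  apply: continuous_seg_le; last exact: continuous_subspaceT.
  by have := le_trans (normr_ge0 _) (QB 0); lra.
have qM x : `|q x| <= M + `|w|.
  by rewrite (le_trans (ler_normD _ _))// lerD2r HM// -ler_norml.
have iqv : ig setT (fun x => q x * v x ^+ 2) by apply: ig_Mb (fun x _ => qM x) iv.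
have ixi : ig setT (fun x => v' x ^+ 2 + q x * v x ^+ 2) by apply: igD => //; case: sv'.
have [_ _ xiE] := RI_comp_opp_Pos ixi.
have H1 := H v v' (pv 0) (toPos _ sv) (toPos _ sv') IQv.
(* The chosen derivative [v'] need not be odd at every point, so the left half-line is treated with
   the reflected density of the same even [v]. *)
have pv2 b : prim v (fun x => - v' (- x)) 0 b.
  by apply: prim_ext (prim_opp (pv _ _)) => // x _; exact: ve.
have H2 := H v _ pv2 (toPos _ sv) (toPos _ (sqN measurableT (sq_opp sv'))) IQv.
have E2 : \int[mu]_(x in Pos) (v' (- x) ^+ 2 + q (- x) * v (- x) ^+ 2) =
    \int[mu]_(x in Pos) ((- v' (- x)) ^+ 2 + (derive1n 2 G (Q x) + w) * v x ^+ 2).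
  by apply: eq_Rintegral => x _; rewrite sqrrN /q Qe ve.
have -> : xi G w Q v = \int[mu]_x (v' x ^+ 2 + q x * v x ^+ 2) by [].
rewrite xiE E2 -[leLHS]mulr1 mulrC ler_pdivrMr// mulrC mulrDr.
rewrite -/mu Iv2 in H1 H2.
have -> : 1 = 2^-1 + 2^-1 :> R by field.
exact: lerD.
Qed.

Theorem theorem2 (R : realType) (f : R[i] -> R[i]) (G : R -> R)
    (C p q pstar sstar : R)
    (f_C1 : real_C1 f)
    (f_conj : forall s : R[i], f s^* = (f s)^*)
    (f_gauge : forall s z : R[i], `|z| = 1 -> f (z * s) = z * f s)
    (G_primitive : forall x : R, is_derive x 1 G (complex.Re (f x%:C)))
    (G_0 : G 0 = 0)
    (G1 : exists s0 : R, G s0 < 0)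
    (C_gt0 : 0 < C)
    (pstar_bounds : 2 < pstar < 6)
    (pq_bounds : 2 < p <= q)
    (G2_growth : forall s : R,
       `|derive1 G s| <= C * (`|s| `^ (p - 1) + `|s| `^ (q - 1)))
    (G2_lower : forall s : R, sstar <= s ->
       - C * `|s| `^ (pstar - 1) <= derive1 G s)
    (G3_C2 : C2 G)
    (G3 : forall (w : R) (Q : R -> R), H1 Q -> solves G w Q ->
       forall x : R,
       0 <= 12 * G (Q x) - 7 * Q x * derive1 G (Q x) + Q x ^+ 2 * derive1n 2 G (Q x))
    (G4 : forall s : R,
       `|derive1n 2 G s| <= C * (`|s| `^ (p - 2) + `|s| `^ (q - 2))) :
  forall lam : R, (lambda_star G < lam%:E)%E ->
  forall R0 : R -> R, minimum_H1r G lam R0 ->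
  forall w0 : R, solves G w0 R0 ->
  nondegenerate_min G w0 R0.
Proof.
move=> lam lam_star Q [[hQ Qe] Qm Qmin] w sol.
have [p2 pq] := andP pq_bounds.
have lam0 : 0 < lam.
  by rewrite -lte_fin (le_lt_trans _ lam_star)// /lambda_star le_max lexx.
have [dG0 dg0 cG2] := G3_C2.
have dG (s : R) : is_derive s 1 G (derive1 G s) by exact: derivable_der.
have dg (s : R) : is_derive s 1 (derive1 G) (derive1n 2 G s) by exact: derivable_der.
have cG : continuous G by move=> s; exact: der_continuous (dG s).
have cg : continuous (derive1 G) by move=> s; exact: der_continuous (dg s).
have pow0 (a b : R) : a != 0 -> b != 0 -> C * (`|0 : R| `^ a + `|0 : R| `^ b) = 0.
  by move=> a0 b0; rewrite normr0 !powR0// addr0 mulr0.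
have g0 : derive1 G 0 = 0.
  by apply/eqP; rewrite -normr_le0 (le_trans (G2_growth 0))// pow0 ?gt_eqF//; lra.
have g20 : derive1n 2 G 0 = 0.
  by apply/eqP; rewrite -normr_le0 (le_trans (G4 0))// pow0 ?gt_eqF//; lra.
have Ge := gauge_even f_gauge G_primitive.
have [P [dQ dP DP sP]] := solves_profile cg hQ sol.
have [pQ sQ sD] := H1_elim hQ.
have IQ : \int[@lebesgue_measure R]_x (Q x ^+ 2) = lam by rewrite -mass_toC; case: Qm.
have Qne : exists x : R, Q x != 0.
  apply: contrapT => nQ; have Q0 x : Q x = 0.
    by apply/eqP; apply: contrapT => /negP Qx; apply: nQ; exists x.
  move: lam0; rewrite -IQ (_ : (fun x => _) = fun=> 0); first by rewrite RI0// ltxx.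
  by apply/funext => x; rewrite Q0 expr0n.
have [[K K0 HK]|E0] := profile_dichotomy dG dg cG2 G_0 g0 g20 dQ dP Qe sQ sP Qne (G3 w Q hQ sol).
  have [B B0 QB] := H1_bounded pQ sQ sD.
  exact: coercive_nondegenerate (primT_continuous pQ) Qe sQ QB K0 HK.
exfalso; move: lam_star; apply/negP; rewrite -leNgt.
have Gq (B : R) : 0 < B -> exists2 L : R, 0 < L & forall s, `|s| <= B -> `|G s| <= L * s ^+ 2.
  move=> B0; have [L L0 HL] := quadratic_bound dG dg cG2 G_0 g0 B0.
  by exists L => // s sB; have [] := HL s sB.
have EQ : energy G (toC Q) = 0.
  rewrite energy_toC// -[RHS]E0; congr (_ * _ + _); apply: RI_ae => //.
  - by apply: ae_imp DP => x ->.
  - by apply: measurable_funX; case: sD.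
  - by apply: measurable_funX; case: sP.
have real_ge0 (v : R -> R) : H1r v -> \int[@lebesgue_measure R]_x (v x ^+ 2) = lam ->
    0 <= 2^-1 * \int[@lebesgue_measure R]_x (wD v x ^+ 2) + \int[@lebesgue_measure R]_x G (v x).
  move=> hv Iv; rewrite -energy_toC//; last by case: hv.
  rewrite -EQ; apply: Qmin => //; split; last by rewrite mass_toC.
  by apply: H1C_toC; case: hv.
(* The infimum over the complex sphere is attained at the profile, so [lam] belongs to the set whose
   supremum enters [lambda_star]. *)
have min0 : min_energy G lam = 0%E.
  apply/eqP; rewrite eq_le; apply/andP; split.
    by apply: ereal_inf_lbound; exists (toC Q) => //; rewrite EQ.
  by apply/ereal_infP => _ [u hu <-]; rewrite lee_fin; exact: energy_ge0 cG Gq real_ge0 lam0 hu.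
rewrite /lambda_star le_max; apply/orP; right.
by apply: ereal_sup_ubound; exists lam.
Qed.
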